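(* Let $1\le k\le m$, $n\ge 1$, and let $\Omega_0=\sum_{s=1}^k A_s\,\frac{dt_s}{t_s}$ be a closed diagonal matrix $1$-form with logarithmic pole on the normal crossing $\Sigma=\{t_1\cdots t_k=0\}\subset(\mathbb C^m,0)$, where $A_1,\dots,A_k$ are constant diagonal $n\times n$ complex matrices. Assume that $\Omega_0$ is non-resonant. Then any flat meromorphic matrix $1$-form on $(\mathbb C^m,0)$ of the form $\Omega=\Omega_0+\Theta$, where $\Theta$ is a holomorphic matrix $1$-form, is holomorphically gauge equivalent to $\Omega_0$ near the origin.
   Context: $(\mathbb C^m,0)$ denotes a sufficiently small neighborhood (polydisc) of the origin in $\mathbb C^m$ with coordinates $t=(t_1,\dots,t_m)$. A matrix $1$-form $\Omega$ (an $n\times n$ matrix whose entries are meromorphic $1$-forms) is flat (integrable) if $d\Omega=\Omega\wedge\Omega$, where $(\Omega\wedge\Omega)_{ij}=\sum_l\omega_{il}\wedge\omega_{lj}$. Two matrix $1$-forms $\Omega,\Omega'$ with the same polar locus are holomorphically gauge equivalent if there is a holomorphic and holomorphically invertible matrix function $H$ with values in $\mathrm{GL}(n,\mathbb C)$, defined everywhere including the polar locus, such that $\Omega'=dH\cdot H^{-1}+H\,\Omega\,H^{-1}$. Write $\Omega_0=\mathrm{diag}\{\alpha_1,\dots,\alpha_n\}$ with $\alpha_i=\sum_{s=1}^k a_i^s\,\frac{dt_s}{t_s}$, $a_i^s\in\mathbb C$. The form $\Omega_0$ is called resonant if for some $i\ne j$ all the residues $a_i^s-a_j^s$, $s=1,\dots,k$,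 of the difference $\alpha_i-\alpha_j$ are integers; otherwise $\Omega_0$ is called non-resonant. *)

(* Defs.v *)
From HB Require Import structures.
From mathcomp Require Import all_boot all_order all_algebra.
From mathcomp Require Import complex.
From mathcomp Require Import boolp classical_sets reals topology normedtype.
From mathcomp Require Import derive.

Set Implicit Arguments.
Unset Strict Implicit.
Unset Printing Implicit Defensive.

Import Order.TTheory GRing.Theory Num.Theory.
Import numFieldNormedType.Exports.

Local Open Scope ring_scope.
Local Open Scope classical_set_scope.
Local Open Scope complex_scope.

(* R[i] is a numFieldType, hence R[i]^o is a normed module over R[i]; these
   instances put the same structure on R[i] itself, as
   numFieldNormedType.Exports does for abstract number fields.  Consequently
   'rV[R[i]]_m and 'M[R[i]]_n carry the sup norm over the field R[i], and
   [differentiable] and ['D_v] below are complex (Frechet and directional)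
   differentiation. *)
HB.instance Definition _ (R : rcfType) := PseudoPointedMetric.copy R[i] R[i]^o.
HB.instance Definition _ (R : rcfType) := GRing.ComAlgebra.copy R[i] R[i]^o.
HB.instance Definition _ (R : rcfType) := Vector.copy R[i] R[i]^o.
HB.instance Definition _ (R : rcfType) := NormedModule.copy R[i] R[i]^o.

(* w s t is the coefficient of dt_s in the 1-form w at the point t. *)
Definition form1 (R : realType) (m : nat) : Type :=
  'I_m -> 'rV[R[i]]_m -> R[i].

(* h p q t is the value of the 2-form h at t on the pair of coordinate fields
   (d/dt_p, d/dt_q), so that h = \sum_(p < q) h p q dt_p /\ dt_q. *)
Definition form2 (R : realType) (m : nat) : Type :=
  'I_m -> 'I_m -> 'rV[R[i]]_m -> R[i].

Definition mxform1 (R : realType) (m n : nat) : Type :=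
  'I_n -> 'I_n -> form1 R m.

Section Forms.
Context {R : realType} {m n : nat}.
Local Notation C := R[i].
Implicit Types (t : 'rV[C]_m) (D S : set 'rV[C]_m).

Definition partial {W : normedModType C} (p : 'I_m) (f : 'rV[C]_m -> W) t : W :=
  'D_(delta_mx 0 p) f t.

Definition extd (w : form1 R m) : form2 R m :=
  fun p q t => partial p (w q) t - partial q (w p) t.

Definition wedge (w h : form1 R m) : form2 R m :=
  fun p q t => w p t * h q t - w q t * h p t.

(* dt_s / t_s; meaningful only where t_s != 0 (elsewhere 0^-1 = 0). *)
Definition dlog (s : 'I_m) : form1 R m :=
  fun p t => if p == s then (t 0 s)^-1 else 0.

Definition mxform_add (W W' : mxform1 R m n) : mxform1 R m n :=
  fun i j p t => W i j p t + W' i j p t.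

Definition coefmx (W : mxform1 R m n) (p : 'I_m) t : 'M[C]_n :=
  \matrix_(i, j) W i j p t.

Definition holomorphic_mxform D (W : mxform1 R m n) : Prop :=
  forall i j p t, D t -> differentiable (W i j p) t.

Definition flat D (W : mxform1 R m n) : Prop :=
  forall i j p q t, D t ->
    extd (W i j) p q t = \sum_(l < n) wedge (W i l) (W l j) p q t.

(* Gauge equivalence on D of forms with poles on S: the gauge matrix H is
   holomorphic and invertible on all of D, S included, while the identity
   W' = dH H^-1 + H W H^-1 of meromorphic forms is read off their poles. *)
Definition gauge_equiv D S (W W' : mxform1 R m n) : Prop :=
  exists H : 'rV[C]_m -> 'M[C]_n,
    [/\ forall t, D t -> differentiable H t,
        forall t, D t -> H t \in unitmx &
        forall p t, (D `\` S) t ->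
          coefmx W' p t = partial p H t *m invmx (H t)
                          + H t *m coefmx W p t *m invmx (H t)].

Section Logarithmic.
Variables (k : nat) (le_km : (k <= m)%N).

Definition normal_crossing : set 'rV[C]_m :=
  [set t | \prod_(s < k) t 0 (widen_ord le_km s) = 0].

(* \sum_(s < k) A_s dt_s / t_s *)
Definition log_mxform (A : 'I_k -> 'M[C]_n) : mxform1 R m n :=
  fun i j p t => \sum_(s < k) A s i j * dlog (widen_ord le_km s) p t.

End Logarithmic.

(* For diagonal A_s, the entry A_s i i is the residue a_i^s of the i-th
   diagonal entry of \sum_s A_s dt_s / t_s along t_s = 0. *)
Definition resonant (k : nat) (A : 'I_k -> 'M[C]_n) : Prop :=
  exists i j : 'I_n, i != j /\
    forall s : 'I_k, exists z : int, A s i i - A s j j = z%:~R.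

End Forms.

(* Main.v *)
Require Import Defs.
From HB Require Import structures.
From mathcomp Require Import all_boot all_order all_algebra.
From mathcomp Require Import complex perm.
From mathcomp Require Import boolp classical_sets functions reals topology normedtype.
From mathcomp Require Import derive sequences exp trigo.
From mathcomp Require Import measure lebesgue_measure lebesgue_integral ftc.
From mathcomp Require Import interval_inference landau.
From mathcomp Require Import ring lra.

(** Write Omega = Omega_0 + Theta, let D_p = t_p d/dt_p, T_p = t_p Theta_p, and
    let A_p be the diagonal residue along t_p = 0, with A_p = 0 for a coordinate
    without pole. The gauge matrix H sought satisfies
      D_p H = [A_p, H] - H T_p   for every p.
    The (i, j) entry of the left side minus the commutator is
    (D_p - a) h_ij, where a is the difference of the residues of alpha_i and
    alpha_j along t_p = 0. By nonresonance every i <> j has a coordinate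
    s = s(i, j) for which a is not an integer, and then D_s - a is invertible on
    holomorphic functions of a polydisc, with a bound that does not depend on
    the radius: if (D_s - a) u = g, then along the rotation
    t_s -> exp(2 pi i x) t_s the function exp(- 2 pi i a x) u has the derivative
    2 pi i exp(- 2 pi i a x) g, and it is multiplied by exp(- 2 pi i a) <> 1 over
    one turn, so that u is an average of g over the turn
    ([euler_bound], [euler_solution]). There is thus no need of power series and
    no small denominator appears.

    For each off-diagonal entry only the equation with p = s(i, j) is imposed,
    and for each diagonal entry only the sum of the equations over p, which the
    radial primitive solves ([radial_bound], [radial_solution]). Since T_p
    carries the factor t_p, these equations are a contraction for H on a small
    polydisc, and have a solution with H(0) = 1 ([partial_gauge_fixpoint]).

    The remaining equations follow from flatness. Let Psi_p = D_p H - [A_p, H]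
    + H T_p be the defect. Flatness of Omega, which after multiplication by the
    coordinates extends across the polar locus ([flat_euler]), gives
      D_q Psi_p - [A_q, Psi_p] = D_p Psi_q - [A_p, Psi_q] + Psi_q T_p - Psi_p T_q
    ([defect_closed]). In the entry (i, j) with q = s(i, j) the terms D_p Psi_q
    and [A_p, Psi_q] vanish by construction, so the entry of Psi_p solves an
    Euler equation whose right side is small against Psi, and the same holds for
    the diagonal entries after summation over q. Hence the bound of Psi can be
    halved indefinitely, and Psi = 0 ([defect_halved], [defect_zero]).

    The function theory comes from one fact, the mean value property of a
    complex differentiable function ([mean_value]), which is Goursat's theorem
    on a rectangle in the logarithmic coordinate ([goursat]). It yields the
    Cauchy estimate for the derivative, then a quadratic Taylor remainder with a
    constant that depends only on a bound of the function ([cauchy_remainder],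
    [taylor_uniform]). With that remainder, uniform limits, partial derivatives
    and averages over parameters of holomorphic functions are holomorphic
    ([differentiable_uniform_limit], [pder_hol], [average_hol]), and mixed
    partial derivatives agree ([pder_comm]). *)

Set Implicit Arguments.
Unset Strict Implicit.
Unset Printing Implicit Defensive.

Import Order.TTheory GRing.Theory Num.Theory.
Import numFieldNormedType.Exports.

Local Open Scope ring_scope.
Local Open Scope classical_set_scope.
Local Open Scope complex_scope.

Local Notation nc := (@Normc.normc _).
Local Notation Re := (@complex.Re _).
Local Notation Im := (@complex.Im _).

(** * The modulus as a real number *)

Section Modulus.
Context {R : realType}.
Implicit Types z w : R[i].

Lemma nc_ge0 z : 0 <= nc z.
Proof. by case: z => a b; exact: sqrtr_ge0. Qed.

Lemma nc0 : nc (0 : R[i]) = 0. Proof. exact: Normc.normc0. Qed.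

Lemma nc1 : nc (1 : R[i]) = 1. Proof. exact: Normc.normc1. Qed.

Lemma nc_eq0 z : (nc z == 0) = (z == 0).
Proof.
by apply/eqP/eqP => [/Normc.eq0_normc|->]; rewrite ?nc0.
Qed.

Lemma nc_gt0 z : (0 < nc z) = (z != 0).
Proof. by rewrite lt0r nc_ge0 andbT nc_eq0. Qed.

Lemma ncM z w : nc (z * w) = nc z * nc w. Proof. exact: Normc.normcM. Qed.

Lemma ncV z : nc z^-1 = (nc z)^-1. Proof. exact: Normc.normcV. Qed.

Lemma ncN z : nc (- z) = nc z. Proof. exact: normcN. Qed.

Lemma ncD z w : nc (z + w) <= nc z + nc w. Proof. exact: le_normcD. Qed.

Lemma ncB z w : nc (z - w) <= nc z + nc w.
Proof. by rewrite -(ncN w); exact: ncD. Qed.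

Lemma nc_dist z w : nc (z - w) = nc (w - z).
Proof. by rewrite -ncN opprB. Qed.

Lemma nc_real (x : R) : nc x%:C = `|x|.
Proof. by rewrite /= expr0n addr0 sqrtr_sqr. Qed.

Lemma norm_nc z : `|z| = (nc z)%:C. Proof. by case: z. Qed.

Lemma Re_le_nc z : `|Re z| <= nc z.
Proof. by rewrite -lecR -norm_nc normc_ge_Re. Qed.

Lemma Im_le_nc z : `|Im z| <= nc z.
Proof.
case: z => a b /=; rewrite -sqrtr_sqr ler_wsqrtr // lerDr sqr_ge0 //.
Qed.

Lemma nc_le_ReIm z : nc z <= `|Re z| + `|Im z|.
Proof.
rewrite {1}[z]complexE; apply: le_trans (ncD _ _) _.
rewrite ncM !nc_real lerD2l // [nc _](_ : _ = 1) ?mul1r //=.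
by rewrite expr0n expr1n add0r sqrtr1.
Qed.

Lemma ReB z w : Re (z - w) = Re z - Re w. Proof. by case: z w => [a b] []. Qed.

Lemma ImB z w : Im (z - w) = Im z - Im w. Proof. by case: z w => [a b] []. Qed.

Lemma Re_mul_real z (x : R) : Re (z * x%:C) = Re z * x.
Proof. by case: z => a b /=; rewrite mulr0 subr0. Qed.

Lemma Im_mul_real z (x : R) : Im (z * x%:C) = Im z * x.
Proof. by case: z => a b /=; rewrite mulr0 add0r. Qed.

Lemma nc_sum (I : Type) (s : seq I) (P : pred I) (F : I -> R[i]) :
  nc (\sum_(i <- s | P i) F i) <= \sum_(i <- s | P i) nc (F i).
Proof.
elim/big_rec2: _ => [|i y x _ le_xy]; first by rewrite nc0.
by apply: le_trans (ncD _ _) _; rewrite lerD2l.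
Qed.

Lemma nc_le_eps z : (forall e, 0 < e -> nc z <= e) -> z = 0.
Proof.
move=> small; apply: Normc.eq0_normc; apply/eqP; rewrite eq_le nc_ge0 andbT.
by apply/ler_addgt0Pr => e /small; rewrite add0r.
Qed.

End Modulus.

(** * Derivatives in epsilon-delta form *)

Section EpsilonDelta.
Context {R : realType}.

Definition seminorm (V : zmodType) (nv : V -> R) :=
  [/\ forall x, 0 <= nv x, forall x y, nv (x + y) <= nv x + nv y
    & forall x, nv (- x) = nv x].

Definition cont_at (V W : zmodType) (nv : V -> R) (nw : W -> R)
    (f : V -> W) (x : V) :=
  forall e, 0 < e -> exists2 d, 0 < d &
    forall h, nv h <= d -> nw (f (x + h) - f x) <= e.

(** The sizes nv and nw are real-valued, and arbitrary, so that one calculus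
    serves real curves, functions of one complex variable and of several, with
    all estimates in an ordered field. *)
Definition der (V W : zmodType) (nv : V -> R) (nw : W -> R)
    (f : V -> W) (x : V) (L : V -> W) :=
  forall e, 0 < e -> exists2 d, 0 < d &
    forall h, nv h <= d -> nw (f (x + h) - f x - L h) <= e * nv h.

Lemma seminorm_nc : seminorm (@Normc.normc R).
Proof. by split; [exact: nc_ge0|exact: ncD|exact: ncN]. Qed.

Lemma seminorm_norm : seminorm (@Num.norm R R).
Proof. by split; [exact: normr_ge0|exact: ler_normD|exact: normrN]. Qed.

Lemma fder_ext (V W : zmodType) (nv : V -> R) (nw : W -> R) (f : V -> W) x L L' :
  L =1 L' -> der nv nw f x L -> der nv nw f x L'.
Proof. by move=> /funext ->. Qed.

Lemma fder_local (V W : zmodType) (nv : V -> R) (nw : W -> R) (f g : V -> W) x L d0 :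
  nv 0 = 0 -> 0 < d0 -> (forall h, nv h <= d0 -> f (x + h) = g (x + h)) ->
  der nv nw f x L -> der nv nw g x L.
Proof.
move=> nv0 d0_gt0 fg df e e_gt0; have [d d_gt0 dfe] := df e e_gt0.
exists (Num.min d d0); first by rewrite lt_min d_gt0.
move=> h; rewrite le_min => /andP[hd hd0].
have <- : f x = g x by rewrite -[x]addr0 fg // nv0 ltW.
by rewrite -fg // dfe.
Qed.

Lemma fder_lip (V W : zmodType) (nv : V -> R) (nw : W -> R) (f : V -> W) x L K :
  seminorm nw -> (forall h, nw (L h) <= K * nv h) -> der nv nw f x L ->
  exists2 d, 0 < d & forall h, nv h <= d -> nw (f (x + h) - f x) <= (K + 1) * nv h.
Proof.
move=> [_ nwD _] LK /(_ 1 ltr01) [d d_gt0 dP]; exists d => // h hd.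
rewrite -[f _ - _](subrK (L h)) mulrDl addrC.
by apply: le_trans (nwD _ _) _; rewrite lerD ?LK ?dP.
Qed.

Lemma fder_cont (V W : zmodType) (nv : V -> R) (nw : W -> R) (f : V -> W) x L K :
  seminorm nv -> seminorm nw -> 0 <= K -> (forall h, nw (L h) <= K * nv h) ->
  der nv nw f x L -> cont_at nv nw f x.
Proof.
move=> [nv0 _ _] snw K0 LK /(fder_lip snw LK) [d d_gt0 dP] e e_gt0.
have K1 : 0 < K + 1 by lra.
exists (Num.min d (e / (K + 1))); first by rewrite lt_min d_gt0 divr_gt0.
move=> h; rewrite le_min => /andP[hd he]; apply: le_trans (dP h hd) _.
by rewrite mulrC -ler_pdivlMr.
Qed.

Lemma fder_comp (V W Z : zmodType) (nv : V -> R) (nw : W -> R) (nz : Z -> R)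
    (f : W -> Z) (g : V -> W) x L M K K' :
  seminorm nv -> seminorm nw -> seminorm nz -> 0 <= K -> 0 <= K' ->
  (forall h, nw (L h) <= K * nv h) -> (forall h, nz (M h) <= K' * nw h) ->
  (forall u v, M (u - v) = M u - M v) ->
  der nv nw g x L -> der nw nz f (g x) M ->
  der nv nz (f \o g) x (M \o L).
Proof.
move=> [nv0 _ _] snw [_ nzD _] K0 K'0 LK MK MB dg df e e_gt0.
have [d1 d1_gt0 lipg] := fder_lip snw LK dg.
have K1 : 0 < K + 1 by lra. have K1' : 0 < K' + 1 by lra.
have e2K1 : 0 < e / 2 / (K + 1) by rewrite !divr_gt0.
have e2K1' : 0 < e / 2 / (K' + 1) by rewrite !divr_gt0.
have [d2 d2_gt0 dfe] := df _ e2K1.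
have [d3 d3_gt0 dge] := dg _ e2K1'.
exists (Num.min (Num.min d1 d3) (d2 / (K + 1))).
  by rewrite !lt_min d1_gt0 d3_gt0 divr_gt0.
move=> h; rewrite !le_min -andbA => /and3P[h1 h3 h2] /=.
set k := g (x + h) - g x.
have kle : nw k <= (K + 1) * nv h by exact: lipg.
have kd2 : nw k <= d2.
  by apply: le_trans kle _; rewrite mulrC -ler_pdivlMr.
have -> : f (g (x + h)) - f (g x) - M (L h)
    = (f (g x + k) - f (g x) - M k) + M (k - L h).
  have -> : g x + k = g (x + h) by rewrite addrC subrK.
  by rewrite (MB k) addrA subrK.
apply: le_trans (nzD _ _) _.
have A1 := dfe _ kd2.
have A2 : nz (M (k - L h)) <= K' * nw (k - L h) by exact: MK.
have A3 : nw (k - L h) <= _ := dge _ h3.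
have B1 : e / 2 / (K + 1) * nw k <= e / 2 * nv h.
  rewrite [leRHS](_ : _ = e / 2 / (K + 1) * ((K + 1) * nv h)); last first.
    by rewrite mulrA divfK // gt_eqF.
  by rewrite ler_pM2l.
have B2 : K' * nw (k - L h) <= e / 2 * nv h.
  rewrite [leRHS](_ : _ = (K' + 1) * (e / 2 / (K' + 1) * nv h)); last first.
    by rewrite mulrA [(K' + 1) * _]mulrC divfK // gt_eqF.
  apply: le_trans (ler_wpM2l K'0 A3) _.
  by rewrite ler_wpM2r ?lerDl // mulr_ge0 // ltW.
lra.
Qed.

Lemma fder_cst (V W : zmodType) (nv : V -> R) (nw : W -> R) (c : W) x :
  seminorm nv -> nw 0 = 0 -> der nv nw (fun=> c) x (fun=> 0).
Proof.
move=> [nv0 _ _] nw0 e e_gt0; exists 1 => // h _; rewrite !subrr nw0.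
by rewrite mulr_ge0 // ltW.
Qed.

Lemma fder_add (V W : zmodType) (nv : V -> R) (nw : W -> R) (f g : V -> W) x L M :
  seminorm nw -> der nv nw f x L -> der nv nw g x M ->
  der nv nw (fun y => f y + g y) x (fun h => L h + M h).
Proof.
move=> [_ nwD _] df dg e e_gt0.
have e2 : 0 < e / 2 by rewrite divr_gt0.
have [d1 d1_gt0 dfe] := df _ e2; have [d2 d2_gt0 dge] := dg _ e2.
exists (Num.min d1 d2); first by rewrite lt_min d1_gt0.
move=> h; rewrite le_min => /andP[h1 h2].
rewrite (_ : _ - _ - _ = (f (x + h) - f x - L h) + (g (x + h) - g x - M h)).
  apply: le_trans (nwD _ _) _; rewrite [e](splitr) mulrDl.
  by rewrite lerD ?dfe ?dge.
rewrite [in LHS](opprD (f x)) [in LHS](opprD (L h)) (addrACA (f (x + h))).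
by rewrite (addrACA (f (x + h) - f x)).
Qed.

Lemma fder_opp (V W : zmodType) (nv : V -> R) (nw : W -> R) (f : V -> W) x L :
  seminorm nw -> der nv nw f x L ->
  der nv nw (fun y => - f y) x (fun h => - L h).
Proof.
move=> [_ _ nwN] df e /df[d d_gt0 dP]; exists d => // h /dP.
by rewrite -!opprD nwN.
Qed.

Lemma fder_mul (V : zmodType) (nv : V -> R) (f g : V -> R[i]) x L M K K' :
  seminorm nv -> 0 <= K -> 0 <= K' ->
  (forall h, nc (L h) <= K * nv h) -> (forall h, nc (M h) <= K' * nv h) ->
  der nv nc f x L -> der nv nc g x M ->
  der nv nc (fun y => f y * g y) x (fun h => L h * g x + f x * M h).
Proof.
move=> [nv0 _ _] K0 K'0 LK MK df dg e e_gt0.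
have [d1 d1_gt0 lf] := fder_lip seminorm_nc LK df.
have [d2 d2_gt0 lg] := fder_lip seminorm_nc MK dg.
pose A := nc (g x) + 1; pose B := nc (f x) + 1; pose P := (K + 1) * (K' + 1).
have A_gt0 : 0 < A by rewrite ltr_wpDl ?nc_ge0.
have B_gt0 : 0 < B by rewrite ltr_wpDl ?nc_ge0.
have P_gt0 : 0 < P by rewrite mulr_gt0 ?ltr_wpDl.
have e3 : 0 < e / 3 by rewrite divr_gt0.
have [d3 d3_gt0 dfe] := df _ (divr_gt0 e3 A_gt0).
have [d4 d4_gt0 dge] := dg _ (divr_gt0 e3 B_gt0).
exists (Num.min (Num.min (Num.min d1 d2) (Num.min d3 d4)) (e / 3 / P)).
  by rewrite !lt_min d1_gt0 d2_gt0 d3_gt0 d4_gt0 divr_gt0.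
move=> h; rewrite !le_min -!andbA => /and5P[h1 h2 h3 h4 h5].
have -> : f (x + h) * g (x + h) - f x * g x - (L h * g x + f x * M h)
  = (f (x + h) - f x - L h) * g x + f x * (g (x + h) - g x - M h)
    + (f (x + h) - f x) * (g (x + h) - g x) by ring.
apply: le_trans (ncD _ _) _; apply: le_trans (lerD (ncD _ _) (lexx _)) _.
rewrite !ncM; have nvh := nv0 h.
have T1 : nc (f (x + h) - f x - L h) * nc (g x) <= e / 3 * nv h.
  apply: le_trans (ler_wpM2r (nc_ge0 _) (dfe h h3)) _.
  rewrite mulrAC ler_wpM2r // -[leRHS](divfK (lt0r_neq0 A_gt0)).
  by rewrite ler_wpM2l ?lerDl // divr_ge0 ?ltW.
have T2 : nc (f x) * nc (g (x + h) - g x - M h) <= e / 3 * nv h.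
  rewrite mulrC; apply: le_trans (ler_wpM2r (nc_ge0 _) (dge h h4)) _.
  rewrite mulrAC ler_wpM2r // -[leRHS](divfK (lt0r_neq0 B_gt0)).
  by rewrite ler_wpM2l ?lerDl // divr_ge0 ?ltW.
have T3 : nc (f (x + h) - f x) * nc (g (x + h) - g x) <= e / 3 * nv h.
  apply: le_trans (ler_pM (nc_ge0 _) (nc_ge0 _) (lf h h1) (lg h h2)) _.
  rewrite mulrACA -/P mulrA ler_wpM2r // mulrC.
  by rewrite -ler_pdivlMr.
lra.
Qed.

End EpsilonDelta.

Notation derR g x d := (der (@Num.norm _ _) nc g x (fun h => d * h%:C)).
Notation derC g z d := (der nc nc g z (fun h => d * h)).
Notation contR := (cont_at (@Num.norm _ _) nc).

(** * Complex functions of a real variable *)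

Section RealCurves.
Context {R : realType}.
Implicit Types (g : R -> R[i]) (u : R -> R).

Lemma der_is_derive u (x d : R) :
  der (@Num.norm _ _) (@Num.norm _ _) u x (fun h => d * h) -> is_derive x 1 u d.
Proof.
move=> du.
have cv : h^-1 *: ((u \o shift x) (h *: 1) - u x) @[h --> 0^'] --> d.
  apply/cvgrPdist_le => e e_gt0; have [r r_gt0 rP] := du e e_gt0.
  near=> h; have h0 : h != 0 by near: h; exact: nbhs_dnbhs_neq.
  have hr : `|h| <= r.
    near: h; apply: dnbhs0_le; exact: r_gt0.
  have := rP h hr; rewrite /= [_ *: 1]mulr1 => ule.
  rewrite -(@ler_pM2r _ `|h|) ?normr_gt0 // -normrM mulrBl.
  have -> : h^-1 *: (u (h + x) - u x) * h = u (x + h) - u x.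
    by rewrite /GRing.scale /= mulrAC mulVf ?mul1r // [h + x]addrC.
  by rewrite distrC.
by apply: DeriveDef; [apply/cvg_ex; exists d|exact/cvg_lim].
Unshelve. all: by end_near. Qed.

Lemma derR_Re g x (d : R[i]) : derR g x d ->
  der (@Num.norm _ _) (@Num.norm _ _) (fun y => Re (g y)) x (fun h => Re d * h).
Proof.
move=> dg e /dg[r r_gt0 rP]; exists r => // h /rP; apply: le_trans.
by have := Re_le_nc (g (x + h) - g x - d * h%:C); rewrite !ReB Re_mul_real.
Qed.

Lemma derR_Im g x (d : R[i]) : derR g x d ->
  der (@Num.norm _ _) (@Num.norm _ _) (fun y => Im (g y)) x (fun h => Im d * h).
Proof.
move=> dg e /dg[r r_gt0 rP]; exists r => // h /rP; apply: le_trans.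
by have := Im_le_nc (g (x + h) - g x - d * h%:C); rewrite !ImB Im_mul_real.
Qed.

Lemma cont_at_continuous u x :
  cont_at (@Num.norm _ _) (@Num.norm _ _) u x -> {for x, continuous u}.
Proof.
move=> cu; apply/cvgrPdist_le => e /cu[r r_gt0 rP].
near=> y; have yr : `|x - y| <= r by near: y; apply: cvgr_dist_le; [exact: cvg_id|].
rewrite distrC -[y](subrK x) [_ + x]addrC; apply: rP.
by rewrite distrC.
Unshelve. all: by end_near. Qed.

Lemma contR_Re g x : contR g x ->
  cont_at (@Num.norm _ _) (@Num.norm _ _) (fun y => Re (g y)) x.
Proof.
move=> cg e /cg[r r_gt0 rP]; exists r => // h /rP; apply: le_trans.
by have := Re_le_nc (g (x + h) - g x); rewrite ReB.
Qed.

Lemma contR_Im g x : contR g x ->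
  cont_at (@Num.norm _ _) (@Num.norm _ _) (fun y => Im (g y)) x.
Proof.
move=> cg e /cg[r r_gt0 rP]; exists r => // h /rP; apply: le_trans.
by have := Im_le_nc (g (x + h) - g x); rewrite ImB.
Qed.

Lemma mvt_real u (v : R -> R) a b M : a <= b ->
  (forall x, a < x < b ->
    der (@Num.norm _ _) (@Num.norm _ _) u x (fun h => v x * h)) ->
  (forall x, a <= x <= b -> cont_at (@Num.norm _ _) (@Num.norm _ _) u x) ->
  (forall x, a < x < b -> `|v x| <= M) ->
  `|u b - u a| <= M * (b - a).
Proof.
rewrite le_eqVlt => /orP[/eqP ->|ab] du cu vM; first by rewrite !subrr normr0 mulr0.
have [||c cab ->] := @MVT _ u v a b ab.
- by move=> x; rewrite in_itv /= => xab; exact/der_is_derive/du.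
- apply: continuous_in_subspaceT => x; rewrite inE /= in_itv /= => xab.
  exact/cont_at_continuous/cu.
move: cab; rewrite in_itv /= => cab.
by rewrite normrM [`|b - a|]gtr0_norm ?subr_gt0 // ler_wpM2r ?vM // subr_ge0 ltW.
Qed.

(** Applied to real and imaginary parts, whence the factor 2. *)
Lemma mvt g (v : R -> R[i]) a b M : a <= b ->
  (forall x, a < x < b -> derR g x (v x)) ->
  (forall x, a <= x <= b -> contR g x) ->
  (forall x, a < x < b -> nc (v x) <= M) ->
  nc (g b - g a) <= 2 * M * (b - a).
Proof.
move=> ab dg cg vM; apply: le_trans (nc_le_ReIm _) _.
have -> : 2 * M * (b - a) = M * (b - a) + M * (b - a) by ring.
rewrite lerD //.
- have := @mvt_real (fun y => Re (g y)) (fun y => Re (v y)) a b M ab.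
  rewrite ReB; apply.
  + by move=> x /dg /derR_Re.
  + by move=> x /cg /contR_Re.
  + by move=> x /vM; apply: le_trans; exact: Re_le_nc.
- have := @mvt_real (fun y => Im (g y)) (fun y => Im (v y)) a b M ab.
  rewrite ImB; apply.
  + by move=> x /dg /derR_Im.
  + by move=> x /cg /contR_Im.
  + by move=> x /vM; apply: le_trans; exact: Im_le_nc.
Qed.

Lemma derR_bound (d : R[i]) (h : R) : nc (d * h%:C) <= nc d * `|h|.
Proof. by rewrite ncM nc_real. Qed.

Lemma derR_contR g x d : derR g x d -> contR g x.
Proof.
apply: (fder_cont seminorm_norm seminorm_nc (nc_ge0 d)) => h; exact: derR_bound.
Qed.

Lemma derR_eq g x d d' : d = d' -> derR g x d -> derR g x d'.
Proof. by move=> ->. Qed.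

Lemma derR_cst (c : R[i]) x : derR (fun=> c) x 0.
Proof.
apply: (@fder_ext _ _ _ _ _ _ _ (fun=> 0)) => [h|]; first by rewrite mul0r.
exact: fder_cst seminorm_norm nc0.
Qed.

Lemma derR_add g k x d d' : derR g x d -> derR k x d' ->
  derR (fun y => g y + k y) x (d + d').
Proof.
move=> dg dk; apply: fder_ext (fder_add seminorm_nc dg dk) => h.
by rewrite mulrDl.
Qed.

Lemma derR_opp g x d : derR g x d -> derR (fun y => - g y) x (- d).
Proof.
move=> dg; apply: fder_ext (fder_opp seminorm_nc dg) => h.
by rewrite mulNr.
Qed.

Lemma derR_mul g k x d d' : derR g x d -> derR k x d' ->
  derR (fun y => g y * k y) x (d * k x + g x * d').
Proof.
move=> dg dk; apply: fder_ext (fder_mul seminorm_norm (nc_ge0 d) (nc_ge0 d') _ _ dg dk).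
- by move=> h; rewrite mulrDl mulrAC mulrA.
- by move=> h; exact: derR_bound.
- by move=> h; exact: derR_bound.
Qed.

Lemma derR_id x : derR (fun y : R => y%:C) x 1.
Proof.
move=> e e_gt0; exists 1 => // h _; rewrite mul1r rmorphD [x%:C + _ - _]addrAC subrr add0r subrr nc0.
by rewrite mulr_ge0 // ltW.
Qed.

Lemma derR_sum (I : Type) (s : seq I) (g : I -> R -> R[i]) (d : I -> R[i]) x :
  (forall i, derR (g i) x (d i)) ->
  derR (fun y => \sum_(i <- s) g i y) x (\sum_(i <- s) d i).
Proof.
move=> dg; elim: s => [|i s IH].
  rewrite big_nil; under eq_fun do rewrite big_nil; exact: derR_cst.
rewrite big_cons; under eq_fun do rewrite big_cons; exact: derR_add (dg i) IH.
Qed.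

End RealCurves.

(** * Integrals of continuous complex functions on the line *)

Section Antiderivative.
Context {R : realType}.
Implicit Types (g : R -> R[i]) (u : R -> R).

Lemma is_derive_der u (x d : R) : is_derive x 1 u d ->
  der (@Num.norm _ _) (@Num.norm _ _) u x (fun h => d * h).
Proof.
move=> [du dE] e e_gt0.
have /cvgrPdist_le /(_ e e_gt0) : h^-1 *: ((u \o shift x) (h *: 1) - u x) @[h --> 0^'] --> d.
  by rewrite -dE; exact: du.
move=> /= /nbhs_ballP[r /= r_gt0 rP].
exists (r / 2); first by rewrite divr_gt0.
move=> h hr; have [->|h0] := eqVneq h 0.
  by rewrite addr0 subrr mulr0 subr0 normr0 mulr0.
have hb : ball (0 : R) r h.
  by rewrite /ball /= sub0r normrN; apply: le_lt_trans hr _; lra.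
have := rP h hb h0; rewrite /= [_ *: 1]mulr1 => ule.
have -> : u (x + h) - u x - d * h = - (d - h^-1 *: (u (h + x) - u x)) * h.
  by rewrite mulNr mulrBl /GRing.scale /= mulrAC mulVf // mul1r opprB [h + x]addrC.
by rewrite normrM normrN ler_wpM2r.
Qed.

Lemma zero_derivative_const u a b : a <= b ->
  (forall x, a <= x <= b ->
    der (@Num.norm _ _) (@Num.norm _ _) u x (fun h => 0 * h)) -> u a = u b.
Proof.
move=> ab du; apply/eqP; rewrite eq_sym -subr_eq0 -normr_le0.
have := @mvt_real _ u (fun=> 0) a b 0 ab; rewrite mul0r; apply.
- by move=> x /andP[ax xb]; apply: du; rewrite !ltW.
- move=> x xab; apply: (fder_cont seminorm_norm seminorm_norm (lexx 0) _ (du x xab)).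
  by move=> h; rewrite !mul0r normr0.
- by move=> *; rewrite normr0.
Qed.

(** A continuous function on the line has an antiderivative: integrate from
    the left end of a window, and glue the antiderivatives of all windows by
    normalizing them at the origin. *)
Lemma antiderivative_real u :
  (forall x, cont_at (@Num.norm _ _) (@Num.norm _ _) u x) ->
  exists F : R -> R, forall x,
    der (@Num.norm _ _) (@Num.norm _ _) F x (fun h => u x * h).
Proof.
move=> cu.
have ctu : continuous u by move=> x; exact/cont_at_continuous/cu.
pose W (N x : R) := (\int[lebesgue_measure]_(t in `[(- N)%R, x]) u t)%R.
have dW N x : - N < x < N ->
    der (@Num.norm _ _) (@Num.norm _ _) (W N) x (fun h => u x * h).
  move=> /andP[Nx xN]; apply: is_derive_der.
  have int := @continuous_compact_integrable _ u _ (@segment_compact _ (- N) N)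
    (continuous_subspaceT ctu).
  have [dF FE] := continuous_FTC1_closed xN int Nx (ctu x).
  by apply: DeriveDef; [exact: dF|rewrite -derive1E FE].
have WB N M x : `|x| < N -> N <= M -> W N x - W N 0 = W M x - W M 0.
  rewrite ltr_norml => /andP[Nx xN] NM.
  have dWW y : - N < y < N ->
      der (@Num.norm _ _) (@Num.norm _ _) (fun y => W N y - W M y) y (fun h => 0 * h).
    move=> /andP[Ny yN].
    apply: (@fder_ext _ _ _ _ _ _ _ (fun h => u y * h - u y * h)) => [h|].
      by rewrite subrr mul0r.
    apply: (@fder_add R R R (@Num.norm _ _) (@Num.norm _ _) (W N) (fun y => - W M y) y (fun h => u y * h)
      (fun h => - (u y * h)) seminorm_norm); first by apply: dW; rewrite Ny.
    by apply: (@fder_opp R R R (@Num.norm _ _) (@Num.norm _ _) (W M) y (fun h => u y * h) seminorm_norm); apply: dW; lra.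
  suff : W N x - W M x = W N 0 - W M 0 by lra.
  have [x0|x0] := leP x 0.
    by apply: (@zero_derivative_const (fun y => W N y - W M y)) => // y /andP[? ?]; apply: dWW; lra.
  apply/esym/(@zero_derivative_const (fun y => W N y - W M y)); first exact: ltW.
  by move=> y /andP[? ?]; apply: dWW; lra.
exists (fun x => W (`|x| + 1) x - W (`|x| + 1) 0) => x.
pose N := `|x| + 2.
apply: (@fder_local _ _ _ _ _ (fun y => W N y - W N 0) _ _ _ 1 (normr0 _) ltr01).
  move=> h h1; have := ler_normD x h; have := normr_ge0 h; have := normr_ge0 x.
  by move=> ? ? ?; apply/esym/WB; rewrite /N; lra.
apply: (@fder_ext _ _ _ _ _ _ _ (fun h => u x * h + 0)) => [h|]; first by rewrite addr0.
apply: (@fder_add R R R (@Num.norm _ _) (@Num.norm _ _) (W N) (fun=> - W N 0) x (fun h => u x * h)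
      (fun=> 0) seminorm_norm).
  by apply: dW; have := ler_norm x; have := ler_norm (- x); rewrite normrN /N; lra.
by apply: fder_cst; [exact: seminorm_norm|rewrite normr0].
Qed.

Lemma antiderivative g : (forall x, contR g x) ->
  exists G : R -> R[i], forall x, derR G x (g x).
Proof.
move=> cg.
have [F dF] := antiderivative_real (fun x => contR_Re (cg x)).
have [K dK] := antiderivative_real (fun x => contR_Im (cg x)).
exists (fun x => F x +i* K x) => x e e_gt0.
have e2 : 0 < e / 2 by rewrite divr_gt0.
have [d d_gt0 dP] := dF x _ e2; have [d' d'_gt0 d'P] := dK x _ e2.
exists (Num.min d d'); first by rewrite lt_min d_gt0.
move=> h; rewrite le_min => /andP[hd hd'].
apply: le_trans (nc_le_ReIm _) _.
cbv beta; rewrite !ReB !ImB Re_mul_real Im_mul_real [e]splitr mulrDl.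
by apply: lerD; [exact: dP|exact: d'P].
Qed.

(** A chosen antiderivative; its increments are the integrals. *)
Definition prim g : R -> R[i] :=
  if pselect (exists G : R -> R[i], forall x, derR G x (g x)) is left H
  then projT1 (cid H) else g.

Definition cint g (a b : R) : R[i] := prim g b - prim g a.

Lemma derR_prim g x : (forall x, contR g x) -> derR (prim g) x (g x).
Proof.
move=> /antiderivative gG; rewrite /prim; case: pselect => // H.
exact: (projT2 (cid H)).
Qed.

Lemma contR_cst (c : R[i]) (x : R) : contR (fun=> c) x.
Proof. exact/derR_contR/derR_cst. Qed.

Lemma contR_add g k x : contR g x -> contR k x -> contR (fun y => g y + k y) x.
Proof.
move=> cg ck e e_gt0; have e2 : 0 < e / 2 by rewrite divr_gt0.
have [d d_gt0 dP] := cg _ e2; have [d' d'_gt0 d'P] := ck _ e2.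
exists (Num.min d d'); first by rewrite lt_min d_gt0.
move=> h; rewrite le_min => /andP[/dP hd /d'P hd'].
rewrite (_ : _ - _ = (g (x + h) - g x) + (k (x + h) - k x)); last by ring.
apply: le_trans (ncD _ _) _; lra.
Qed.

Lemma contR_mul g k x : contR g x -> contR k x -> contR (fun y => g y * k y) x.
Proof.
move=> cg ck e e_gt0.
pose A := nc (g x) + 1; pose B := nc (k x) + 1.
have A_gt0 : 0 < A by rewrite ltr_wpDl ?nc_ge0.
have B_gt0 : 0 < B by rewrite ltr_wpDl ?nc_ge0.
have e2 : 0 < e / 2 by rewrite divr_gt0.
have [d d_gt0 dP] := cg _ (divr_gt0 e2 B_gt0).
have [d' d'_gt0 d'P] := ck _ (divr_gt0 e2 A_gt0).
have [d1 d1_gt0 d1P] := cg _ ltr01.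
exists (Num.min d (Num.min d' d1)); first by rewrite !lt_min d_gt0 d'_gt0.
move=> h; rewrite !le_min => /and3P[/dP hd /d'P hd' /d1P hd1].
rewrite (_ : _ - _ = (g (x + h) - g x) * k x + g (x + h) * (k (x + h) - k x)); last by ring.
apply: le_trans (ncD _ _) _; rewrite !ncM [leRHS]splitr lerD //.
  rewrite -[leRHS](divfK (lt0r_neq0 B_gt0)).
  by apply: ler_pM => //; rewrite ?nc_ge0 // lerDl.
rewrite -[leRHS](divfK (lt0r_neq0 A_gt0)) mulrC.
apply: ler_pM => //; rewrite ?nc_ge0 //.
rewrite -[g (x + h)](subrK (g x)) addrC.
by apply: le_trans (ncD _ _) _; rewrite lerD2l.
Qed.

Lemma contR_opp g x : contR g x -> contR (fun y => - g y) x.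
Proof.
move=> cg; have := contR_mul (contR_cst (-1) x) cg.
by under eq_fun do rewrite mulN1r.
Qed.

Lemma contR_sub g k x : contR g x -> contR k x -> contR (fun y => g y - k y) x.
Proof. by move=> cg ck; apply: contR_add => //; exact: contR_opp. Qed.

Lemma contR_sum (I : Type) (s : seq I) (g : I -> R -> R[i]) x :
  (forall i, contR (g i) x) -> contR (fun y => \sum_(i <- s) g i y) x.
Proof.
move=> cg; elim: s => [|i s IH].
  by under eq_fun do rewrite big_nil; exact: contR_cst.
by under eq_fun do rewrite big_cons; exact: contR_add (cg i) IH.
Qed.

Lemma cint_FTC g G a b : a <= b -> (forall x, contR g x) ->
  (forall x, a < x < b -> derR G x (g x)) ->
  (forall x, a <= x <= b -> contR G x) -> cint g a b = G b - G a.
Proof.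
move=> ab cg dG cG; apply/eqP; rewrite -subr_eq0; apply/eqP/Normc.eq0_normc/eqP.
rewrite eq_le nc_ge0 andbT.
have := @mvt _ (fun x => prim g x - G x) (fun=> 0) a b 0 ab.
rewrite mulr0 mul0r => H.
rewrite (_ : _ - _ = prim g b - G b - (prim g a - G a)); last by rewrite /cint; ring.
apply: H.
- move=> x xab; apply: derR_eq (derR_add (derR_prim x cg) (derR_opp (dG x xab))).
  by rewrite subrr.
- by move=> x xab; apply: contR_sub (cG x xab); exact/derR_contR/derR_prim.
- by move=> *; rewrite nc0.
Qed.

Lemma cint_bound g a b M : a <= b -> (forall x, contR g x) ->
  (forall x, a < x < b -> nc (g x) <= M) -> nc (cint g a b) <= 2 * M * (b - a).
Proof.
move=> ab cg gM; apply: mvt ab _ _ gM => x _; first exact: derR_prim.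
exact/derR_contR/derR_prim.
Qed.

Lemma cint_add g k a b : a <= b ->
  (forall x, contR g x) -> (forall x, contR k x) ->
  cint (fun x => g x + k x) a b = cint g a b + cint k a b.
Proof.
move=> ab cg ck; rewrite (@cint_FTC _ (fun x => prim g x + prim k x)) //.
- by rewrite /cint; ring.
- by move=> x; exact: contR_add.
- by move=> x _; apply: derR_add; exact: derR_prim.
- by move=> x _; apply: contR_add; exact/derR_contR/derR_prim.
Qed.

Lemma cint_scale (c : R[i]) g a b : a <= b -> (forall x, contR g x) ->
  cint (fun x => c * g x) a b = c * cint g a b.
Proof.
move=> ab cg; rewrite (@cint_FTC _ (fun x => c * prim g x)) //.
- by rewrite /cint mulrBr.
- by move=> x; apply: contR_mul => //; exact: contR_cst.
- move=> x _; apply: derR_eq (derR_mul (derR_cst c x) (derR_prim x cg)).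
  by rewrite mul0r add0r.
- by move=> x _; apply: contR_mul; [exact: contR_cst|exact/derR_contR/derR_prim].
Qed.

Lemma cint_sub g k a b : a <= b ->
  (forall x, contR g x) -> (forall x, contR k x) ->
  cint (fun x => g x - k x) a b = cint g a b - cint k a b.
Proof.
move=> ab cg ck; rewrite (@cint_FTC _ (fun x => prim g x - prim k x)) //.
- by rewrite /cint; ring.
- by move=> x; exact: contR_sub.
- by move=> x _; apply: derR_add; [|apply: derR_opp]; exact: derR_prim.
- by move=> x _; apply: contR_sub; exact/derR_contR/derR_prim.
Qed.

Lemma cint_sum (I : Type) (s : seq I) (g : I -> R -> R[i]) a b : a <= b ->
  (forall i x, contR (g i) x) ->
  cint (fun x => \sum_(i <- s) g i x) a b = \sum_(i <- s) cint (g i) a b.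
Proof.
move=> ab cg; rewrite (@cint_FTC _ (fun x => \sum_(i <- s) prim (g i) x)) //.
- by rewrite -sumrB.
- by move=> x; exact: contR_sum.
- by move=> x _; apply: derR_sum => i; exact: derR_prim.
- by move=> x _; apply: contR_sum => i; exact/derR_contR/derR_prim.
Qed.

Lemma cint_cst (c : R[i]) a b : a <= b -> cint (fun=> c) a b = c * (b - a)%:C.
Proof.
move=> ab; rewrite (@cint_FTC _ (fun x => c * x%:C)) //.
- by rewrite -mulrBr rmorphB.
- by move=> x; exact: contR_cst.
- move=> x _; apply: derR_eq (derR_mul (derR_cst c x) (derR_id x)).
  by rewrite mul0r add0r mulr1.
- by move=> x _; apply: contR_mul; [exact: contR_cst|exact/derR_contR/derR_id].
Qed.

End Antiderivative.

(** * The complex exponential *)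

Section Exponential.
Context {R : realType}.
Implicit Types z w : R[i].

Definition expi (y : R) : R[i] := cos y +i* sin y.

Definition cexp z : R[i] := (expR (Re z))%:C * expi (Im z).

Lemma nc_expi (y : R) : nc (expi y) = 1.
Proof. by rewrite /expi /= cos2Dsin2 sqrtr1. Qed.

Lemma expiD (x y : R) : expi (x + y) = expi x * expi y.
Proof. by rewrite /expi cosD sinD; apply/eqP; rewrite eq_complex /= eqxx addrC eqxx. Qed.

Lemma Re_cexp z : Re (cexp z) = expR (Re z) * cos (Im z).
Proof. by rewrite /cexp /= mul0r subr0. Qed.

Lemma Im_cexp z : Im (cexp z) = expR (Re z) * sin (Im z).
Proof. by rewrite /cexp /= mul0r addr0. Qed.

Lemma cexpD z w : cexp (z + w) = cexp z * cexp w.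
Proof.
rewrite /cexp; case: z w => [a b] [c d] /=.
rewrite expRD expiD rmorphM /=; exact: mulrACA.
Qed.

Lemma nc_cexp z : nc (cexp z) = expR (Re z).
Proof. by rewrite ncM nc_expi mulr1 nc_real ger0_norm // expR_ge0. Qed.

Lemma cexp0 : cexp 0 = 1.
Proof. by rewrite /cexp /expi /= expR0 cos0 sin0 mul1r. Qed.

Lemma cexp_neq0 z : cexp z != 0.
Proof. by rewrite -nc_gt0 nc_cexp expR_gt0. Qed.

Lemma derC_cexp0 : derC (@cexp) 0 1.
Proof.
move=> e e_gt0; pose e1 := Num.min (e / 8) 1.
have e1_gt0 : 0 < e1 by rewrite lt_min divr_gt0 //= ltr01.
have e1_le1 : e1 <= 1 by rewrite ge_min lexx orbT.
have e1_le : e1 <= e / 8 by rewrite ge_min lexx.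
have [d d_gt0 dP] := is_derive_der (is_derive_expR (0 : R)) e1_gt0.
have [d' d'_gt0 d'P] := is_derive_der (is_derive_cos (0 : R)) e1_gt0.
have [d2 d2_gt0 d2P] := is_derive_der (is_derive_sin (0 : R)) e1_gt0.
exists (Num.min (Num.min d d') (Num.min d2 (e1 / 2))).
  by rewrite !lt_min d_gt0 d'_gt0 d2_gt0 divr_gt0.
move=> h; rewrite !le_min -andbA => /and4P[h1 h2 h3 h4].
have re := Re_le_nc h; have im := Im_le_nc h.
have He := dP _ (le_trans re h1); have Hc := d'P _ (le_trans im h2).
have Hs := d2P _ (le_trans im h3).
rewrite !add0r expR0 mul1r in He; rewrite !add0r cos0 sin0 oppr0 mul0r subr0 in Hc.
rewrite !add0r cos0 sin0 mul1r subr0 in Hs.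
rewrite add0r cexp0 mul1r.
apply: le_trans (nc_le_ReIm _) _.
rewrite !ReB !ImB Re_cexp Im_cexp.
set a := Re h in re He *; set b := Im h in im Hc Hs *; set N := nc h in re im h1 h2 h3 h4 *.
rewrite (_ : Re 1 = 1) // (_ : Im 1 = 0) // subr0.
have N0 : 0 <= N by exact: nc_ge0.
have Ea : `|expR a - 1| <= 2 * N.
  rewrite (_ : _ - _ = (expR a - 1 - a) + a); last by ring.
  apply: le_trans (ler_normD _ _) _.
  have : e1 * `|a| <= 1 * N by rewrite ler_pM // ltW.
  lra.
have E2 : expR a <= 2 by move: Ea; rewrite ler_norml => /andP[_]; lra.
have -> : expR a * cos b - 1 - a = expR a * (cos b - 1) + (expR a - 1 - a) by ring.
have -> : expR a * sin b - b = expR a * (sin b - b) + (expR a - 1) * b by ring.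
have e1N : 0 <= e1 * N by rewrite mulr_ge0 // ltW.
have T1 : `|expR a * (cos b - 1)| <= 2 * (e1 * N).
  rewrite normrM ger0_norm ?expR_ge0 // ler_pM ?expR_ge0 //.
  by apply: le_trans Hc _; rewrite ler_pM2l.
have T2 : `|expR a - 1 - a| <= e1 * N by apply: le_trans He _; rewrite ler_pM2l.
have T3 : `|expR a * (sin b - b)| <= 2 * (e1 * N).
  rewrite normrM ger0_norm ?expR_ge0 // ler_pM ?expR_ge0 //.
  by apply: le_trans Hs _; rewrite ler_pM2l.
have T4 : `|(expR a - 1) * b| <= e1 * N.
  rewrite normrM ler_pM //; apply: le_trans Ea _; lra.
have T5 : e1 * N <= e / 8 * N by rewrite ler_wpM2r.
have := ler_normD (expR a * (cos b - 1)) (expR a - 1 - a).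
have := ler_normD (expR a * (sin b - b)) ((expR a - 1) * b).
lra.
Qed.

Lemma derC_cexp z : derC (@cexp) z (cexp z).
Proof.
move=> e e_gt0; have z_gt0 : 0 < nc (cexp z) by rewrite nc_gt0 cexp_neq0.
have [d d_gt0 dP] := derC_cexp0 (divr_gt0 e_gt0 z_gt0).
exists d => // h /dP; rewrite add0r cexp0 cexpD mul1r => hd.
rewrite (_ : _ - _ = cexp z * (cexp h - 1 - h)); last by ring.
rewrite ncM; apply: le_trans (ler_wpM2l (ltW z_gt0) hd) _.
by rewrite mulrA [_ * (e / _)]mulrC divfK ?gt_eqF.
Qed.

Lemma derR_derC (f : R[i] -> R[i]) (g : R -> R[i]) (x : R) (d D : R[i]) :
  derR g x d -> derC f (g x) D -> derR (fun y => f (g y)) x (D * d).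
Proof.
move=> dg df; apply: fder_ext (fder_comp seminorm_norm seminorm_nc seminorm_nc
  (nc_ge0 d) (nc_ge0 D) _ _ _ dg df).
- by move=> h; rewrite /= mulrA.
- by move=> h; exact: derR_bound.
- by move=> h; rewrite ncM.
- by move=> u v; exact: mulrBr.
Qed.

Lemma derR_cexp (c : R[i]) (x : R) :
  derR (fun y => cexp (c * y%:C)) x (c * cexp (c * x%:C)).
Proof.
have dl : derR (fun y : R => c * y%:C) x c.
  by apply: derR_eq (derR_mul (derR_cst c x) (derR_id x)); rewrite mul0r add0r mulr1.
by apply: derR_eq (derR_derC dl (@derC_cexp _)); rewrite mulrC.
Qed.

Lemma expi_cexp (y : R) : expi y = cexp ('i * y%:C).
Proof. by rewrite /cexp /= !mul0r mulr0 subr0 mul1r add0r expR0 mul1r. Qed.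

Lemma derR_expi (x : R) : derR expi x ('i * expi x).
Proof.
have -> : expi = (fun y => cexp ('i * y%:C)) by apply/funext => y; exact: expi_cexp.
exact: derR_cexp.
Qed.

Lemma expi_2pi : expi (pi *+ 2) = 1.
Proof.
by rewrite /expi cos2pi sin2pi.
Qed.

Lemma expi0 : expi 0 = 1.
Proof. by rewrite /expi cos0 sin0. Qed.

(** This is what makes the factor [cexp (- 2 pi i a) - 1] invertible for a
    nonintegral [a]. *)
Lemma cexp_eq1 z : cexp z = 1 -> exists k : int, z = 'i * (k%:~R * (pi *+ 2))%:C.
Proof.
move=> z1; have re0 : Re z = 0.
  have := nc_cexp z; rewrite z1 nc1 => /esym/eqP.
  by rewrite -expR0 => /eqP/expR_inj.
have e1 : expi (Im z) = 1 by move: z1; rewrite /cexp re0 expR0 mul1r.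
pose T : R := pi *+ 2.
have T_gt0 : 0 < T by rewrite mulrn_wgt0 // pi_gt0.
have expiT (k : int) : expi (k%:~R * T) = 1.
  have expin (n : nat) : expi (n%:R * T) = 1.
    elim: n => [|n IH]; first by rewrite mul0r expi0.
    by rewrite -addn1 natrD mulrDl mul1r expiD IH expi_2pi mulr1.
  case: k => n; first exact: expin.
  have := expiD (n.+1%:R * T) (- (n.+1%:R * T)).
  by rewrite subrr expi0 expin mul1r NegzE mulrNz mulNr => <-.
pose k := Num.floor (Im z / T); pose y := Im z - k%:~R * T.
have y0 : 0 <= y by rewrite subr_ge0 -ler_pdivlMr // floor_le.
have yT : y < T.
  rewrite ltrBlDr -[X in _ < X + _]mul1r -mulrDl -ltr_pdivrMr //.
  by rewrite addrC -[1]/(1%:~R) -intrD lt_succ_floor.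
have ey : expi y = 1.
  have := expiD y (k%:~R * T); rewrite subrK e1 expiT mulr1 => ->//.
have y_eq0 : y = 0.
  case: ey => cy sy; apply/eqP; rewrite eq_le y0 andbT leNgt; apply/negP => y_gt0.
  have [ypi|piy] := ltP y pi.
    by have := @sin_gt0_pi _ y; rewrite y_gt0 ypi sy ltxx => /(_ isT).
  have [ypi|ypi] := eqVneq y pi.
    by move: cy; rewrite ypi cospi => /eqP; rewrite eq_sym -subr_eq0 opprK -mulr2n pnatr_eq0.
  have y' : 0 < y - pi < pi.
    rewrite subr_gt0 lt_neqAle eq_sym ypi piy /= ltrBlDr.
    by move: yT; rewrite /T mulr2n.
  have := sin_gt0_pi y'; rewrite sinB cospi sinpi sy cy.
  by rewrite !mul0r mulr0 subrr ltxx.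
exists k; move/eqP: y_eq0; rewrite subr_eq0 -/T => /eqP <-.
by rewrite {1}[z]complexE re0 add0r.
Qed.

End Exponential.

(** * Goursat's theorem on rectangles *)

Section Goursat.
Context {R : realType}.
Variables (Z : R -> R -> R[i]) (x0 x1 y0 y1 : R).
Hypothesis (x01 : x0 < x1) (y01 : y0 < y1).
Hypothesis contx : forall y x, contR (Z^~ y) x.
Hypothesis conty : forall x y, contR (Z x) y.
Hypothesis diffZ : forall x y, x0 <= x <= x1 -> y0 <= y <= y1 ->
  exists D : R[i], forall e, 0 < e -> exists2 d, 0 < d & forall x' y',
    x0 <= x' <= x1 -> y0 <= y' <= y1 -> `|x' - x| <= d -> `|y' - y| <= d ->
    nc (Z x' y' - Z x y - D * ((x' - x) +i* (y' - y)))
      <= e * (`|x' - x| + `|y' - y|).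

(** The integral of W (dx + i dy) over the boundary of [a, b] x [c, d]. *)
Definition bdry (W : R -> R -> R[i]) (a b c d : R) : R[i] :=
  cint (W^~ c) a b + 'i * cint (W b) c d - cint (W^~ d) a b - 'i * cint (W a) c d.

Lemma bdry_quarter W a b c d :
  let m := (a + b) / 2 in let n := (c + d) / 2 in
  bdry W a b c d
    = bdry W a m c n + bdry W m b c n + (bdry W a m n d + bdry W m b n d).
Proof. by rewrite /= /bdry /cint; ring. Qed.

Lemma bdry_affine (al D : R[i]) a b c d : a <= b -> c <= d ->
  bdry (fun x y => al + D * (x +i* y)) a b c d = 0.
Proof.
move=> ab cd.
have xyE (x y : R) : x +i* y = x%:C + 'i * y%:C :> R[i].
  by rewrite [LHS]complexE.
pose P (w : R[i]) := al * w + D * (w * w) / 2.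
have dw : forall (u v : R[i]) (x : R), derR (fun t => u + v * t%:C) x v.
  move=> u v x; apply: derR_eq (derR_add (derR_cst u x) (derR_mul (derR_cst v x) (derR_id x))).
  by rewrite mul0r mulr1 !add0r.
have dP : forall (u v : R[i]) (x : R),
    derR (fun t => P (u + v * t%:C)) x ((al + D * (u + v * x%:C)) * v).
  move=> u v x; have dwx := dw u v x.
  apply: derR_eq (derR_add (derR_mul (derR_cst al x) dwx)
    (derR_mul (derR_mul (derR_cst D x) (derR_mul dwx dwx)) (derR_cst (2^-1) x))).
  by rewrite /=; field.
have cW : forall (u v : R[i]) (x : R), contR (fun x => al + D * (u + v * x%:C)) x.
  move=> u v x; apply: contR_add; first exact: contR_cst.
  by apply: contR_mul; [exact: contR_cst|exact: derR_contR (dw u v x)].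
have hor y : cint (fun x => al + D * (x +i* y)) a b = P (b +i* y) - P (a +i* y).
  have E (x : R) : x +i* y = 'i * y%:C + 1 * x%:C by rewrite mul1r xyE addrC.
  under eq_fun do rewrite E; rewrite !E.
  apply: (cint_FTC (G := fun x => P ('i * y%:C + 1 * x%:C)) ab) => [x|x _|x _].
  - exact: cW.
  - by apply: derR_eq (dP _ _ _); rewrite mulr1.
  - exact: derR_contR (dP _ _ _).
have ver x : 'i * cint (fun y => al + D * (x +i* y)) c d = P (x +i* d) - P (x +i* c).
  rewrite -cint_scale //; last first.
    by move=> y; under eq_fun do rewrite xyE; exact: cW.
  rewrite !xyE; under eq_fun do rewrite xyE.
  apply: (cint_FTC (G := fun y => P (x%:C + 'i * y%:C)) cd) => [y|y _|y _].
  - by apply: contR_mul; [exact: contR_cst|exact: cW].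
  - by apply: derR_eq (dP _ _ _); rewrite mulrC.
  - exact: derR_contR (dP _ _ _).
by rewrite /bdry !hor !ver; ring.
Qed.

Lemma bdry_bound W a b c d M : a <= b -> c <= d ->
  (forall y x, contR (W^~ y) x) -> (forall x y, contR (W x) y) ->
  (forall x y, a <= x <= b -> c <= y <= d -> nc (W x y) <= M) ->
  nc (bdry W a b c d) <= 4 * M * (b - a + (d - c)).
Proof.
move=> ab cd cx cy WM.
have i1 : nc ('i : R[i]) = 1 by rewrite /= expr0n expr1n add0r sqrtr1.
have hor y : c <= y <= d -> nc (cint (W^~ y) a b) <= 2 * M * (b - a).
  move=> yi; apply: cint_bound ab (cx y) _ => x /andP[ax xb].
  by apply: WM => //; rewrite !ltW.
have ver x : a <= x <= b -> nc ('i * cint (W x) c d) <= 2 * M * (d - c).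
  move=> xi; rewrite ncM i1 mul1r; apply: cint_bound cd (cy x) _ => y /andP[cy' yd].
  by apply: WM => //; rewrite !ltW.
have h1 := hor c; have h2 := hor d; have h3 := ver a; have h4 := ver b.
rewrite !lexx ?ab ?cd /= in h1 h2 h3 h4.
have {}h1 := h1 isT; have {}h2 := h2 isT; have {}h3 := h3 isT; have {}h4 := h4 isT.
rewrite /bdry; apply: le_trans (ncB _ _) _.
apply: le_trans (lerD (ncB _ _) (lexx _)) _.
apply: le_trans (lerD (lerD (ncD _ _) (lexx _)) (lexx _)) _.
lra.
Qed.

Lemma bdry_sub W W' a b c d : a <= b -> c <= d ->
  (forall y x, contR (W^~ y) x) -> (forall x y, contR (W x) y) ->
  (forall y x, contR (W'^~ y) x) -> (forall x y, contR (W' x) y) ->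
  bdry (fun x y => W x y - W' x y) a b c d = bdry W a b c d - bdry W' a b c d.
Proof. by move=> *; rewrite /bdry !cint_sub //; ring. Qed.

Record rect := Rect { xl : R; xr : R; yl : R; yr : R }.

Definition half_perim (q : rect) := xr q - xl q + (yr q - yl q).

Definition quarter (big : rect -> bool) (q : rect) : rect :=
  let m := (xl q + xr q) / 2 in let n := (yl q + yr q) / 2 in
  let q1 := Rect (xl q) m (yl q) n in let q2 := Rect m (xr q) (yl q) n in
  let q3 := Rect (xl q) m n (yr q) in let q4 := Rect m (xr q) n (yr q) in
  if big q1 then q1 else if big q2 then q2 else if big q3 then q3 else q4.

Definition bdryr (q : rect) := bdry Z (xl q) (xr q) (yl q) (yr q).

(** Goursat: bisection keeps a quarter whose boundary integral is at least the
    given multiple of the squared size, while near the point on which the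
    quarters close down the integrand is affine up to a small multiple of the
    size, and affine integrands have zero boundary integral. *)
Lemma goursat : bdry Z x0 x1 y0 y1 = 0.
Proof.
apply: nc_le_eps => E E_gt0; have lt_x := x01; have lt_y := y01.
pose s0 := x1 - x0 + (y1 - y0); have s0_gt0 : 0 < s0 by rewrite /s0; lra.
pose eps := E / s0 ^+ 2; have eps_gt0 : 0 < eps by rewrite divr_gt0 // exprn_gt0.
suff : nc (bdry Z x0 x1 y0 y1) <= eps * s0 ^+ 2.
  by rewrite /eps divfK // gt_eqF // exprn_gt0.
rewrite leNgt; apply/negP => bigZ.
pose big (q : rect) := eps * half_perim q ^+ 2 < nc (bdryr q).
pose Q n := iter n (quarter big) (Rect x0 x1 y0 y1).
have QS n : Q n.+1 = quarter big (Q n) by [].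
have wf n : [/\ xl (Q n) < xr (Q n), yl (Q n) < yr (Q n), x0 <= xl (Q n) /\ xr (Q n) <= x1
    & y0 <= yl (Q n) /\ yr (Q n) <= y1].
  elim: n => [|n [xx yy [x0x xx1] [y0y yy1]]]; first by split.
  by rewrite QS /quarter; do 3?[case: ifP => _] => /=;
    (split; [ | |split|split]); lra.
have bigQ n : big (Q n).
  elim: n => [|n IH]; first exact: bigZ.
  rewrite QS /quarter; case: ifPn => // n1; case: ifPn => // n2; case: ifPn => // n3.
  apply: contraLR IH => n4; move: n1 n2 n3 n4.
  rewrite /big -!leNgt => n1 n2 n3 n4.
  rewrite /bdryr bdry_quarter.
  apply: le_trans (ncD _ _) _; apply: le_trans (lerD (ncD _ _) (ncD _ _)) _.
  apply: le_trans (lerD (lerD n1 n2) (lerD n3 n4)) _.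
  rewrite /half_perim /= le_eqVlt; apply/orP; left; by apply/eqP; field.
have mono n : [/\ xl (Q n) <= xl (Q n.+1), xr (Q n.+1) <= xr (Q n),
    yl (Q n) <= yl (Q n.+1) & yr (Q n.+1) <= yr (Q n)].
  have [xx yy _ _] := wf n.
  by rewrite QS /quarter; do 3?[case: ifP => _] => /=; split; lra.
have half n : half_perim (Q n) = s0 / 2 ^+ n.
  elim: n => [|n IH]; first by rewrite expr0 divr1.
  rewrite exprS invfM mulrCA -IH QS /quarter /half_perim.
  by do 3?[case: ifP => _] => /=; field.
have monoD n k : [/\ xl (Q n) <= xl (Q (n + k)%N), xr (Q (n + k)%N) <= xr (Q n),
    yl (Q n) <= yl (Q (n + k)%N) & yr (Q (n + k)%N) <= yr (Q n)].
  elim: k => [|k [? ? ? ?]]; first by rewrite addn0; split.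
  by have [? ? ? ?] := mono (n + k)%N; rewrite addnS; split; lra.
have cross n k : xl (Q n) <= xr (Q k) /\ yl (Q n) <= yr (Q k).
  have := monoD k n; rewrite addnC => -[? ? ? ?]; have [? ? ? ?] := monoD n k.
  by have [? ? _ _] := wf (n + k)%N; split; lra.
have sup_in (l r : nat -> R) : (forall n k, l n <= r k) ->
    forall n, l n <= sup (range l) <= r n.
  move=> lr n; have ub : has_ubound (range l).
    by exists (r 0%N) => _ [j _ <-].
  apply/andP; split; first by apply: ub_le_sup => //; exists n.
  by apply: ge_sup; [exists (l 0%N); exists 0%N|move=> _ [j _ <-]].
pose x := sup (range (fun n => xl (Q n))); pose y := sup (range (fun n => yl (Q n))).
have xP n : xl (Q n) <= x <= xr (Q n).
  by apply: (sup_in (fun n => xl (Q n)) (fun n => xr (Q n))) => i j; case: (cross i j).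
have yP n : yl (Q n) <= y <= yr (Q n).
  by apply: (sup_in (fun n => yl (Q n)) (fun n => yr (Q n))) => i j; case: (cross i j).
have [D DP] := diffZ (xP 0%N) (yP 0%N).
have e8 : 0 < eps / 8 by rewrite divr_gt0.
have [d d_gt0 dP] := DP _ e8.
have [n nd] : exists n, half_perim (Q n) <= d.
  exists (Num.truncn (s0 / d)).+1; rewrite half ler_pdivrMr ?exprn_gt0 // mulrC.
  rewrite -ler_pdivrMr //; apply: ltW; apply: lt_le_trans (truncnS_gt _) _.
  by rewrite -natrX ler_nat ltnW // ltn_expl.
have [xx yy [x0x xx1] [y0y yy1]] := wf n; have := bigQ n.
have xn := xP n; have yn := yP n.
pose W x' y' := Z x y - D * (x +i* y) + D * (x' +i* y').
rewrite /big /bdryr; set q := Q n in nd xx yy x0x xx1 y0y yy1 xn yn *.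
have s_gt0 : 0 < half_perim q by rewrite /half_perim; lra.
have cl : forall (u v : R[i]) (t : R), contR (fun t => u + v * t%:C) t.
  move=> u v t; apply: contR_add; first exact: contR_cst.
  apply: contR_mul; first exact: contR_cst.
  exact: derR_contR (derR_id t).
have xyE (x' y' : R) : x' +i* y' = x'%:C + 'i * y'%:C :> R[i].
  by rewrite [LHS]complexE.
have cWx y' t : contR (W^~ y') t.
  have -> : W^~ y' = (fun t => Z x y - D * (x +i* y) + D * 'i * y'%:C + D * t%:C).
    by apply/funext => ?; rewrite /W ![_ +i* y']xyE; ring.
  exact: cl.
have cWy x' t : contR (W x') t.
  have -> : W x' = (fun t => Z x y - D * (x +i* y) + D * x'%:C + D * 'i * t%:C).
    by apply/funext => ?; rewrite /W [x' +i* _]xyE; ring.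
  exact: cl.
have -> : bdry Z (xl q) (xr q) (yl q) (yr q)
    = bdry (fun x' y' => Z x' y' - W x' y') (xl q) (xr q) (yl q) (yr q).
  by rewrite bdry_sub ?bdry_affine ?subr0 // ltW.
apply/negP; rewrite -leNgt.
have bnd : nc (bdry (fun x' y' => Z x' y' - W x' y') (xl q) (xr q) (yl q) (yr q))
    <= 4 * (eps / 8 * half_perim q) * (xr q - xl q + (yr q - yl q)).
  apply: bdry_bound; [exact: ltW|exact: ltW| | |].
  - by move=> *; apply: contR_sub.
  - by move=> *; apply: contR_sub.
  move=> x' y' xi yi.
  have -> : Z x' y' - W x' y' = Z x' y' - Z x y - D * ((x' - x) +i* (y' - y)).
    by rewrite /W !xyE !rmorphB /=; ring.
  have xd : `|x' - x| <= xr q - xl q by rewrite ler_norml; apply/andP; case/andP: xi => ? ?; case/andP: xn => ? ?; split; lra.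
  have yd : `|y' - y| <= yr q - yl q by rewrite ler_norml; lra.
  have xin : x0 <= x' <= x1.
    by case/andP: xi => ? ?; rewrite (le_trans x0x) // (le_trans _ xx1).
  have yin : y0 <= y' <= y1.
    by case/andP: yi => ? ?; rewrite (le_trans y0y) // (le_trans _ yy1).
  have wx : xr q - xl q <= half_perim q by rewrite lerDl subr_ge0 ltW.
  have wy : yr q - yl q <= half_perim q by rewrite lerDr subr_ge0 ltW.
  apply: le_trans (dP _ _ xin yin (le_trans xd (le_trans wx nd))
    (le_trans yd (le_trans wy nd))) _.
  by rewrite ler_pM2l //; apply: lerD.
apply: le_trans bnd _; rewrite -/(half_perim q) expr2.
have := mulr_gt0 eps_gt0 (mulr_gt0 s_gt0 s_gt0).
lra.
Qed.

End Goursat.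

(** * The mean value property *)

Section MeanValue.
Context {R : realType}.
Implicit Types (q f : R[i] -> R[i]).

Lemma derC_bound (d h : R[i]) : nc (d * h) <= nc d * nc h.
Proof. by rewrite ncM. Qed.

Lemma derC_cont f (z d : R[i]) : derC f z d -> cont_at nc nc f z.
Proof. exact: (fder_cont seminorm_nc seminorm_nc (nc_ge0 d) (derC_bound d)). Qed.

Lemma derC_comp f (g : R[i] -> R[i]) (z d D : R[i]) :
  derC g z d -> derC f (g z) D -> derC (fun w => f (g w)) z (D * d).
Proof.
move=> dg df; apply: fder_ext (fder_comp seminorm_nc seminorm_nc seminorm_nc
  (nc_ge0 d) (nc_ge0 D) _ _ _ dg df).
- by move=> h; rewrite /= mulrA.
- by move=> h; exact: derC_bound.
- by move=> h; exact: derC_bound.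
- by move=> u v; exact: mulrBr.
Qed.

Lemma contR_comp f (g : R -> R[i]) (x : R) :
  cont_at nc nc f (g x) -> contR g x -> contR (fun y => f (g y)) x.
Proof.
move=> cf cg e /cf[d /cg[d' d'_gt0 d'P] dP]; exists d' => // h /d'P /dP.
by rewrite [g x + _]addrC subrK.
Qed.

Lemma contR_expi (x : R) : contR (@expi R) x.
Proof. exact: derR_contR (derR_expi x). Qed.

Lemma contR_circle (r x : R) : contR (fun y => r%:C * expi y) x.
Proof. by apply: contR_mul; [exact: contR_cst|exact: contR_expi]. Qed.

Lemma nc_circle (r y : R) : 0 <= r -> nc (r%:C * expi y) = r.
Proof. by move=> r0; rewrite ncM nc_expi mulr1 nc_real ger0_norm. Qed.

Lemma pi2_gt0 : 0 < (pi : R) *+ 2.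
Proof. by rewrite mulrn_wgt0 // pi_gt0. Qed.

(** In the logarithmic coordinate the circles about the origin become vertical
    segments of one period, the horizontal sides of the Goursat rectangle
    cancel by periodicity, and the mean over a circle does not depend on the
    radius; shrink the circle to the origin, where continuity suffices. *)
Lemma mean_value q (rho r : R) : 0 < r -> r < rho ->
  cont_at nc nc q 0 ->
  (forall w, w != 0 -> nc w < rho -> exists D, derC q w D) ->
  cint (fun y => q (r%:C * expi y)) 0 (pi *+ 2) = q 0 * (pi *+ 2)%:C.
Proof.
move=> r_gt0 r_rho q0 dq; have T_gt0 := pi2_gt0.
have circ_neq0 s y : 0 < s -> s%:C * expi y != 0 :> R[i].
  by move=> s0; rewrite -nc_gt0 nc_circle // ltW.
have cq s : 0 < s -> s < rho -> forall y, contR (fun y => q (s%:C * expi y)) y.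
  move=> s0 sr y; apply: contR_comp (contR_circle s y).
  have [|D] := dq (s%:C * expi y) (circ_neq0 _ _ s0); first by rewrite nc_circle // ltW.
  exact: derC_cont.
apply/eqP; rewrite -subr_eq0; apply/eqP/nc_le_eps => e e_gt0.
have e' : 0 < e / (2 * (pi *+ 2)) by rewrite divr_gt0 // mulr_gt0.
have [d d_gt0 dP] := q0 _ e'.
pose r0 := Num.min (r / 2) d.
have r0_gt0 : 0 < r0 by rewrite lt_min d_gt0 divr_gt0.
have r0_r : r0 < r by apply: (@le_lt_trans _ _ (r / 2)); [rewrite ge_min lexx|lra].
have r0_d : r0 <= d by rewrite ge_min lexx orbT.
pose x0 := ln r0; pose x1 := ln r.
have x0E : expR x0 = r0 by rewrite lnK // posrE.
have x1E : expR x1 = r by rewrite lnK // posrE.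
have x01 : x0 < x1 by rewrite ltr_ln ?posrE.
pose Z x y := q ((expR (Num.min x x1))%:C * expi y).
have ltexp x : expR (Num.min x x1) < rho.
  apply: le_lt_trans r_rho; rewrite -x1E ler_expR ge_min lexx orbT //.
have derq x y : x <= x1 -> exists D, derC (fun z => q (cexp z)) (x +i* y) D.
  move=> xx1.
  have [||D dD] := dq (cexp (x +i* y)); first exact: cexp_neq0.
    by rewrite nc_cexp; apply: le_lt_trans r_rho; rewrite -x1E ler_expR.
  by exists (D * cexp (x +i* y)); exact: derC_comp (@derC_cexp _ _) dD.
have conty x y : contR (Z x) y by apply: cq; [exact: expR_gt0|exact: ltexp].
have contx y x : contR (Z^~ y) x.
  have [D /derC_cont cD] := derq (Num.min x x1) y (ltac:(by rewrite ge_min lexx orbT)).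
  have cm : contR (fun x => (Num.min x x1) +i* y) x.
    move=> eps eps_gt0; exists eps => // h hd; apply: le_trans (nc_le_ReIm _) _.
    rewrite ReB ImB /= subrr normr0 addr0; apply: le_trans hd.
    have := ler_norm h; have := ler_norm (- h); rewrite normrN ler_norml => ? ?.
    rewrite /Num.min; case: ltP => ?; case: ltP => ?; apply/andP; split; lra.
  exact: contR_comp cD cm.
have diffZ x y : x0 <= x <= x1 -> 0 <= y <= pi *+ 2 ->
  exists D : R[i], forall e, 0 < e -> exists2 d, 0 < d & forall x' y',
    x0 <= x' <= x1 -> 0 <= y' <= pi *+ 2 -> `|x' - x| <= d -> `|y' - y| <= d ->
    nc (Z x' y' - Z x y - D * ((x' - x) +i* (y' - y)))
      <= e * (`|x' - x| + `|y' - y|).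
  move=> /andP[_ xx1] _; have [D dD] := derq x y xx1; exists D => eps eps_gt0.
  have [dd dd_gt0 ddP] := dD _ eps_gt0.
  exists (dd / 2); first by rewrite divr_gt0.
  move=> x' y' /andP[_ x'x1] _ hx hy.
  have hle : nc ((x' - x) +i* (y' - y)) <= `|x' - x| + `|y' - y| := nc_le_ReIm _.
  have := ddP ((x' - x) +i* (y' - y)).
  have -> : (x +i* y) + ((x' - x) +i* (y' - y)) = x' +i* y' :> R[i].
    by apply/eqP; rewrite eq_complex /= ![_ + (_ - _)]addrC !subrK !eqxx.
  rewrite /Z !min_l // => H; apply: le_trans (H _) _; last by rewrite ler_pM2l.
  by apply: le_trans hle _; lra.
have := goursat x01 T_gt0 contx conty diffZ; rewrite /bdry.
have -> : Z^~ (pi *+ 2) = Z^~ 0.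
  by apply/funext => x; rewrite /Z expi_2pi expi0.
rewrite (_ : _ - _ = 'i * (cint (Z x1) 0 (pi *+ 2) - cint (Z x0) 0 (pi *+ 2)));
  last by ring.
move=> /eqP; rewrite mulf_eq0 => /orP[/eqP/(congr1 nc)|].
  by rewrite nc0 /= expr0n expr1n add0r sqrtr1 => /eqP; rewrite oner_eq0.
rewrite subr_eq0 => /eqP.
rewrite /Z minxx (min_l (ltW x01)) x0E x1E => ->.
have c0 := cq _ r0_gt0 (lt_trans r0_r r_rho).
have cc : forall x : R, contR (fun=> q 0) x by move=> x; exact: contR_cst.
have -> : (pi *+ 2)%:C = (pi *+ 2 - 0)%:C :> R[i] by rewrite subr0.
rewrite -(cint_cst _ (ltW T_gt0)) -(cint_sub (ltW T_gt0) c0 cc).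
apply: (@le_trans _ _ (2 * (e / (2 * (pi *+ 2))) * (pi *+ 2 - 0))).
  apply: cint_bound; [exact: ltW| |].
    by move=> x; apply: contR_sub.
  move=> y _; have := dP (r0%:C * expi y).
  by rewrite add0r; apply; rewrite nc_circle // ltW.
move: T_gt0; set T : R := pi *+ 2 => T_gt0.
have /divfK : 2 * T != 0 by rewrite mulf_neq0 // gt_eqF.
rewrite subr0 => /(_ e) E; lra.
Qed.

End MeanValue.

(** * Cauchy estimates in one variable *)

Section CauchyEstimates.
Context {R : realType}.
Implicit Types (f : R[i] -> R[i]).

Lemma derC_inv (z : R[i]) : z != 0 -> derC (fun w : R[i] => w^-1) z (- z^-2).
Proof.
rewrite -nc_gt0 => z_gt0 e e_gt0; set a := nc z in z_gt0.
exists (Num.min (a / 2) (e * a ^+ 3 / 2)).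
  by rewrite lt_min !divr_gt0 // mulr_gt0 // exprn_gt0.
move=> h; rewrite le_min => /andP[h1 h2].
have zh : a / 2 <= nc (z + h).
  have : nc z <= nc (z + h) + nc h by rewrite -{1}[z](addrK h); exact: ncB.
  rewrite -/a; lra.
have z0 : z != 0 by rewrite -nc_gt0.
have zh0 : z + h != 0 by rewrite -nc_gt0; apply: lt_le_trans zh; rewrite divr_gt0.
have -> : (z + h)^-1 - z^-1 - - z^-2 * h = h * (h / (z ^+ 2 * (z + h))).
  by field; rewrite zh0.
rewrite ncM mulrC ler_wpM2r ?nc_ge0 // ncM ncV ncM expr2 ncM -/a.
rewrite ler_pdivrMr; last by rewrite !mulr_gt0 // (lt_le_trans _ zh) ?divr_gt0.
apply: le_trans h2 _.
have := ler_wpM2l (ltW (mulr_gt0 e_gt0 (mulr_gt0 z_gt0 z_gt0))) zh.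
lra.
Qed.

Lemma derC_shift f (z w D : R[i]) : derC f (z + w) D -> derC (fun w => f (z + w)) w D.
Proof. by move=> df e /df[d d_gt0 dP]; exists d => // h /dP; rewrite addrA. Qed.

Lemma derC_unshift f (z D : R[i]) : derC f z D -> derC (fun w => f (z + w)) 0 D.
Proof. by move=> df; apply: derC_shift; rewrite addr0. Qed.

(** Cauchy's formula for the derivative, as the mean value property of the
    difference quotient, which is continuous at the center. *)
Lemma derivative_mean f (D : R[i]) (rho r : R) : 0 < r -> r < rho ->
  (forall w, nc w < rho -> exists D, derC f w D) -> derC f 0 D ->
  cint (fun y => (f (r%:C * expi y) - f 0) / (r%:C * expi y)) 0 (pi *+ 2)
    = D * (pi *+ 2)%:C.
Proof.
move=> r_gt0 r_rho df df0.
pose q w := if w == 0 then D else (f w - f 0) / w.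
have q0E : q 0 = D by rewrite /q eqxx.
have qE w : w != 0 -> q w = (f w - f 0) / w by rewrite /q => /negPf ->.
rewrite -q0E -(@mean_value _ q rho r) //.
- congr cint; apply/funext => y; rewrite qE // -nc_gt0 nc_circle //.
  exact: ltW.
- move=> e e_gt0; have [d d_gt0 dP] := df0 e e_gt0.
  exists d => // h hd; rewrite add0r q0E.
  have [->|h0] := eqVneq h 0; first by rewrite q0E subrr nc0; exact: ltW.
  rewrite qE // -(ler_pM2r (_ : 0 < nc h)) ?nc_gt0 // -ncM.
  by have := dP h hd; rewrite add0r mulrBl divfK.
- move=> w w0 w_rho; have [D1 dD1] := df w w_rho.
  have dfc : derC (fun w => f w - f 0) w D1.
    move=> e /dD1[d d_gt0 dP]; exists d => // h /dP.
    by rewrite opprB addrA subrK.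
  have := fder_mul seminorm_nc (nc_ge0 D1) (nc_ge0 (- w^-2)) (derC_bound D1)
    (derC_bound _) dfc (derC_inv w0).
  move=> H; exists (D1 * w^-1 + (f w - f 0) * - w^-2).
  have w_gt0 : 0 < nc w by rewrite nc_gt0.
  apply: (fder_local nc0 (d0 := nc w / 2)) (fder_ext _ H).
  + by rewrite divr_gt0.
  + move=> h hw; rewrite qE // -nc_gt0.
    have : nc w <= nc (w + h) + nc h by rewrite -{1}[w](addrK h); exact: ncB.
    lra.
  + by move=> h; ring.
Qed.

(** The integral and mean value bounds each lose a factor 2, so the constants
    are larger than the classical ones; only their shape in M and rho matters. *)
Section Disc.
Variables (f f' : R[i] -> R[i]) (rho M : R).
Hypothesis rho_gt0 : 0 < rho.
Hypothesis df : forall w, nc w < rho -> derC f w (f' w).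
Hypothesis fM : forall w, nc w < rho -> nc (f w) <= M.

Let M_ge0 : 0 <= M.
Proof. by apply: le_trans (fM (w := 0) _); rewrite ?nc_ge0 // nc0. Qed.

Lemma cauchy_derivative (w : R[i]) : nc w <= rho / 2 -> nc (f' w) <= 16 * M / rho.
Proof.
have rho0 := rho_gt0; move=> w_rho; pose r := rho / 4.
have r_gt0 : 0 < r by rewrite divr_gt0.
have in_disc h : nc h < rho / 2 -> nc (w + h) < rho.
  by move=> hr; have := ncD w h; lra.
have r_lt : r < rho / 2 by rewrite /r; lra.
have dg h : nc h < rho / 2 -> exists D, derC (fun h => f (w + h)) h D.
  by move=> hr; exists (f' (w + h)); apply: derC_shift; apply: df; exact: in_disc.
have dw : derC (fun h => f (w + h)) 0 (f' w) by apply: derC_unshift; apply: df; lra.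
have T_gt0 : 0 < (pi : R) *+ 2 := pi2_gt0.
have := derivative_mean r_gt0 r_lt dg dw => /(congr1 nc).
rewrite ncM nc_real (gtr0_norm T_gt0) => E.
rewrite -(ler_pM2r T_gt0) -E.
apply: (@le_trans _ _ (2 * (2 * M / r) * (pi *+ 2 - 0))); last first.
  rewrite subr0 ler_pM2r // /r invf_div; lra.
apply: cint_bound; [exact: ltW| |].
  move=> y; apply: contR_mul.
    apply: contR_sub; last exact: contR_cst.
    have [|D dD] := dg (r%:C * expi y); first by rewrite nc_circle // ltW.
    exact: contR_comp (derC_cont dD) (contR_circle _ _).
  apply: contR_comp (contR_circle _ _); apply: derC_cont (derC_inv _).
  by rewrite -nc_gt0 nc_circle // ltW.
move=> y _; rewrite ncM ncV nc_circle ?(ltW r_gt0) // ler_pM2r ?invr_gt0 //.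
rewrite mulr_natl mulr2n; apply: le_trans (ncB _ _) _.
apply: lerD; apply: fM; apply: in_disc; first by rewrite nc_circle // ltW.
by rewrite nc0 divr_gt0.
Qed.

Lemma derR_segment (g : R[i] -> R[i]) (z h D : R[i]) (x : R) :
  derC g (z + h * x%:C) D -> derR (fun x => g (z + h * x%:C)) x (D * h).
Proof.
apply: (derR_derC (g := fun x => z + h * x%:C)).
apply: derR_eq (derR_add (derR_cst z x) (derR_mul (derR_cst h x) (derR_id x))).
by rewrite mul0r mulr1 !add0r.
Qed.

Lemma nc_segment (z h : R[i]) (x : R) : 0 <= x <= 1 ->
  nc (z + h * x%:C) <= Num.max (nc z) (nc (z + h)).
Proof.
move=> /andP[x0 x1].
have -> : z + h * x%:C = z * (1 - x)%:C + (z + h) * x%:C by rewrite rmorphB rmorph1; ring.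
apply: le_trans (ncD _ _) _; rewrite !ncM !nc_real !ger0_norm ?subr_ge0 //.
set m := Num.max _ _.
have m1 : nc z <= m by rewrite le_max lexx.
have m2 : nc (z + h) <= m by rewrite le_max lexx orbT.
have := ler_wpM2r x0 m2; have x10 : 0 <= 1 - x by rewrite subr_ge0.
have := ler_wpM2r x10 m1; lra.
Qed.

Lemma cauchy_lipschitz (z w : R[i]) : nc z <= rho / 2 -> nc w <= rho / 2 ->
  nc (f w - f z) <= 32 * M / rho * nc (w - z).
Proof.
have rho0 := rho_gt0; move=> z_rho w_rho; pose h := w - z.
have seg x : 0 <= x <= 1 -> nc (z + h * x%:C) <= rho / 2.
  move=> x01; apply: le_trans (nc_segment z h x01) _.
  by rewrite /h addrC subrK ge_max z_rho.
have dseg x : 0 <= x <= 1 -> derR (fun x => f (z + h * x%:C)) x (f' (z + h * x%:C) * h).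
  by move=> /seg ?; apply: derR_segment; apply: df; lra.
have := @mvt _ (fun x => f (z + h * x%:C)) (fun x => f' (z + h * x%:C) * h) 0 1
  (16 * M / rho * nc h) ler01.
have -> : z + h * 1%:C = w by rewrite rmorph1 mulr1 /h addrC subrK.
have -> : z + h * 0%:C = z by rewrite rmorph0 mulr0 addr0.
rewrite subr0 mulr1 => H; rewrite -/h; apply: le_trans (H _ _ _) _.
- by move=> x /andP[x0 x1]; apply: dseg; rewrite !ltW.
- by move=> x /dseg /derR_contR.
- move=> x /andP[x0 x1]; rewrite ncM ler_wpM2r ?nc_ge0 //.
  by apply: cauchy_derivative; apply: seg; rewrite !ltW.
lra.
Qed.

(** Cauchy's formula with a fixed radius shows that the derivative inherits
    the Lipschitz property of the function. *)
Lemma cauchy_derivative_lipschitz (z : R[i]) : nc z <= rho / 4 ->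
  nc (f' z - f' 0) <= 1024 * M / rho ^+ 2 * nc z.
Proof.
have rho0 := rho_gt0; move=> z_rho; pose r := rho / 8.
have r_gt0 : 0 < r by rewrite divr_gt0.
have r_lt : r < rho / 2 by rewrite /r; lra.
have T_gt0 : 0 < (pi : R) *+ 2 := pi2_gt0.
have dg w h : nc w <= rho / 4 -> nc h < rho / 2 -> exists D, derC (fun h => f (w + h)) h D.
  move=> wr hr; exists (f' (w + h)); apply: derC_shift; apply: df.
  by have := ncD w h; lra.
have dw w : nc w <= rho / 4 -> derC (fun h => f (w + h)) 0 (f' w).
  by move=> wr; apply: derC_unshift; apply: df; lra.
have r0 : nc (0 : R[i]) <= rho / 4 by rewrite nc0 ltW // divr_gt0.
pose q w y := (f (w + r%:C * expi y) - f (w + 0)) / (r%:C * expi y).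
have mean w : nc w <= rho / 4 -> cint (q w) 0 (pi *+ 2) = f' w * (pi *+ 2)%:C.
  by move=> wr; apply: derivative_mean r_gt0 r_lt (fun h => dg w h wr) (dw w wr).
have cq w : nc w <= rho / 4 -> forall y, contR (q w) y.
  move=> wr y; apply: contR_mul.
    apply: contR_sub; last exact: contR_cst.
    have [|D dD] := dg w (r%:C * expi y) wr; first by rewrite nc_circle // ltW.
    exact: contR_comp (derC_cont dD) (contR_circle _ _).
  apply: contR_comp (contR_circle _ _); apply: derC_cont (derC_inv _).
  by rewrite -nc_gt0 nc_circle // ltW.
rewrite -(ler_pM2r T_gt0) -[X in nc _ * X](gtr0_norm T_gt0) -nc_real -ncM mulrBl.
rewrite -(mean _ z_rho) -(mean _ r0) -(cint_sub (ltW T_gt0) (cq _ z_rho) (cq _ r0)).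
apply: (@le_trans _ _ (2 * (64 * M / rho * nc z / r) * (pi *+ 2 - 0))); last first.
  rewrite subr0 ler_pM2r // /r invf_div expr2 invfM.
  rewrite le_eqVlt; apply/orP; left; apply/eqP; field; by rewrite gt_eqF.
apply: cint_bound; [exact: ltW| |].
  by move=> y; apply: contR_sub; exact: cq.
move=> y _; rewrite /q -mulrBl ncM ncV nc_circle ?(ltW r_gt0) // ler_pM2r ?invr_gt0 //.
set c := r%:C * expi y.
have cr : nc c = r by rewrite nc_circle // ltW.
have -> : f (z + c) - f (z + 0) - (f (0 + c) - f (0 + 0))
    = (f (z + c) - f c) - (f z - f 0) by rewrite !addr0 !add0r; ring.
apply: le_trans (ncB _ _) _.
have L1 : nc (f (z + c) - f c) <= 32 * M / rho * nc z.
  rewrite -[X in _ * nc X](addrK c z); apply: cauchy_lipschitz.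
    by rewrite cr ltW.
  apply: le_trans (ncD _ _) _; rewrite cr /r; lra.
have L2 : nc (f z - f 0) <= 32 * M / rho * nc z.
  rewrite -[X in _ * nc X](subr0 z); apply: cauchy_lipschitz; lra.
lra.
Qed.

(** The quadratic Taylor bound from which all multivariate regularity below is
    derived. *)
Lemma cauchy_remainder (z : R[i]) : nc z <= rho / 4 ->
  nc (f z - f 0 - f' 0 * z) <= 2048 * M / rho ^+ 2 * nc z ^+ 2.
Proof.
have rho0 := rho_gt0; move=> z_rho.
have seg x : 0 <= x <= 1 -> nc (z * x%:C) <= nc z.
  by move=> /andP[x0 x1]; rewrite ncM nc_real ger0_norm // ler_piMr // nc_ge0.
have dseg x : 0 <= x <= 1 ->
    derR (fun x => f (0 + z * x%:C) - f' 0 * z * x%:C) x (f' (0 + z * x%:C) * z - f' 0 * z).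
  move=> x01; have dfx : derC f (0 + z * x%:C) (f' (0 + z * x%:C)).
    by apply: df; rewrite add0r; have := seg x x01; lra.
  apply: derR_eq (derR_add (derR_segment dfx)
    (derR_opp (derR_mul (derR_cst (f' 0 * z) x) (derR_id x)))).
  by rewrite mul0r mulr1 !add0r.
have := @mvt _ (fun x => f (0 + z * x%:C) - f' 0 * z * x%:C)
  (fun x => f' (0 + z * x%:C) * z - f' 0 * z) 0 1
  (1024 * M / rho ^+ 2 * nc z * nc z) ler01.
rewrite rmorph1 rmorph0 !mulr1 !mulr0 !add0r !subr0 mulr1 => H.
rewrite addrAC; apply: le_trans (H _ _ _) _.
- by move=> x /andP[x0 x1]; apply: dseg; rewrite !ltW.
- by move=> x /dseg /derR_contR.
- move=> x /andP[x0 x1]; rewrite -mulrBl ncM ler_wpM2r ?nc_ge0 // add0r.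
  have xs : nc (z * x%:C) <= nc z by apply: seg; rewrite !ltW.
  apply: le_trans (cauchy_derivative_lipschitz (le_trans xs z_rho)) _.
  by apply: ler_wpM2l xs; exact: divr_ge0 (mulr_ge0 (ler0n _ _) M_ge0) (sqr_ge0 _).
by rewrite expr2; lra.
Qed.

End Disc.
End CauchyEstimates.

(** * Complex differentiability in several variables *)

Section SupNorm.
Context {R : realType} {m : nat}.
Local Notation C := R[i].
Implicit Types t h : 'rV[C]_m.

(** The norm on row vectors over C takes its values in C; estimates are made in
    the real field, with this version of it. *)
Definition vn t : R := \big[Num.max/0]_p nc (t 0 p).

Lemma vn_ge0 t : 0 <= vn t.
Proof. exact: bigmax_ge_id. Qed.

Lemma nc_le_vn t p : nc (t 0 p) <= vn t.
Proof. exact: (le_bigmax _ (fun p => nc (t 0 p))). Qed.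

Lemma vn_le t B : 0 <= B -> (forall p, nc (t 0 p) <= B) -> vn t <= B.
Proof. by move=> B0 tB; apply: bigmax_le. Qed.

Lemma vn0 : vn 0 = 0.
Proof.
apply/eqP; rewrite eq_le vn_ge0 andbT; apply: vn_le => // p.
by rewrite mxE nc0.
Qed.

Lemma vnD t h : vn (t + h) <= vn t + vn h.
Proof.
apply: vn_le => [|p]; first by rewrite addr_ge0 ?vn_ge0.
by rewrite mxE; apply: le_trans (ncD _ _) _; rewrite lerD ?nc_le_vn.
Qed.

Lemma vnN t : vn (- t) = vn t.
Proof. by apply: eq_bigr => p _; rewrite mxE ncN. Qed.

Lemma vnZ (c : C) t : vn (c *: t) = nc c * vn t.
Proof.
apply/eqP; rewrite eq_le; apply/andP; split.
  apply: vn_le => [|p]; first by rewrite mulr_ge0 ?nc_ge0 ?vn_ge0.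
  by rewrite mxE ncM ler_wpM2l ?nc_ge0 ?nc_le_vn.
have [->|c0] := eqVneq c 0; first by rewrite nc0 mul0r vn_ge0.
rewrite mulrC -ler_pdivlMr ?nc_gt0 //.
apply: vn_le => [|p]; first by rewrite divr_ge0 ?nc_ge0 ?vn_ge0.
rewrite ler_pdivlMr ?nc_gt0 // mulrC -ncM.
by have := nc_le_vn (c *: t) p; rewrite mxE.
Qed.

Lemma seminorm_vn : seminorm vn.
Proof. by split; [exact: vn_ge0|exact: vnD|exact: vnN]. Qed.

Lemma vn_delta p : vn (delta_mx 0 p) <= 1.
Proof.
apply: vn_le => // q; rewrite mxE /=; case: (q == p); rewrite ?nc1 ?nc0 //.
Qed.

Lemma vn_eq0 t : vn t = 0 -> t = 0.
Proof.
move=> t0; apply/rowP => p; rewrite mxE; apply: Normc.eq0_normc; apply/eqP.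
by rewrite eq_le nc_ge0 -{1}t0 nc_le_vn.
Qed.

Lemma norm_vn t : `|t| = (vn t)%:C.
Proof.
apply/eqP; rewrite eq_le; apply/andP; split.
  rewrite /Num.norm /=; have [->|/mx_norm_neq0[[i p] /= ->]] := eqVneq (mx_norm t) 0.
    by rewrite ler0c vn_ge0.
  by rewrite norm_nc lecR (ord1 i) nc_le_vn.
have nr : `|t| \is Num.real by exact: normr_real.
have tr p : nc (t 0 p) <= Re `|t|.
  apply/ler_addgt0Pr => e e_gt0; apply: ltW.
  have : ball_ Num.norm (0 : 'rV[C]_m) (Re `|t| + e)%:C t.
    by rewrite /ball_ /= sub0r normrN -{1}(RRe_real nr) ltcR ltrDl.
  rewrite -mx_norm_ball => -[_ /(_ 0 p)].
  by rewrite -ball_normE /= mxE sub0r normrN norm_nc ltcR.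
rewrite -(RRe_real nr) lecR.
by apply: vn_le => //; rewrite -ler0c RRe_real.
Qed.

Lemma nbhs0_vn (A : set 'rV[C]_m) :
  nbhs (0 : 'rV[C]_m) A <-> exists2 r : R, 0 < r & forall h, vn h <= r -> A h.
Proof.
split=> [/nbhs_ballP[e /= e_gt0 eA]|[r r_gt0 rA]].
  have er : e \is Num.real by exact: gtr0_real.
  exists (Re e / 2); first by rewrite divr_gt0 // -ltcR RRe_real.
  move=> h hr; apply: eA; rewrite -ball_normE /= sub0r normrN norm_vn -(RRe_real er) ltcR.
  apply: le_lt_trans hr _; have : 0 < Re e by rewrite -ltcR RRe_real.
  lra.
apply/nbhs_ballP; exists r%:C => /=; first by rewrite ltcR.
move=> h; rewrite -ball_normE /= sub0r normrN norm_vn ltcR => /ltW.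
exact: rA.
Qed.

End SupNorm.

Notation derV f t d :=
  (der vn nc f t (fun h => \sum_p d 0 p * (h : 'rV[_]_(_)) 0 p)).

HB.lock Definition pder (R : realType) (m : nat) (p : 'I_m)
  (f : 'rV[R[i]]_m -> R[i]) (t : 'rV[R[i]]_m) : R[i] := partial p f t.

Section FrechetInterface.
Context {R : realType} {m : nat}.
Local Notation C := R[i].
Implicit Types (t h d : 'rV[C]_m) (f g : 'rV[C]_m -> C).

Definition dotv d h : C := \sum_p d 0 p * h 0 p.

Lemma dotv_is_linear d : linear (dotv d : 'rV[C]_m -> C).
Proof.
move=> c u v; change (\sum_p d 0 p * (c *: u + v) 0 p
  = c * (\sum_p d 0 p * u 0 p) + \sum_p d 0 p * v 0 p).
rewrite mulr_sumr -big_split /=.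
by apply: eq_bigr => p _; rewrite !mxE; ring.
Qed.

HB.instance Definition _ d :=
  GRing.isLinear.Build C 'rV[C]_m C *:%R (dotv d) (dotv_is_linear d).

Lemma dotv_bound d h : nc (dotv d h) <= (\sum_p nc (d 0 p)) * vn h.
Proof.
apply: le_trans (nc_sum _ _ _) _; rewrite mulr_suml; apply: ler_sum => p _.
by rewrite ncM ler_wpM2l ?nc_ge0 ?nc_le_vn.
Qed.

Lemma dotv_delta d p : dotv d (delta_mx 0 p) = d 0 p.
Proof.
rewrite /dotv (bigD1 p) //= mxE !eqxx mulr1 big1 ?addr0 // => q qp.
by rewrite mxE (negPf qp) andbF mulr0.
Qed.

Lemma dotv_continuous d : continuous (dotv d).
Proof.
move=> h; apply/(@cvgrPdist_le _ _ _ _ (nbhs_filter h)) => e e_gt0; pose K := \sum_p nc (d 0 p).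
have K0 : 0 <= K by apply: sumr_ge0 => p _; exact: nc_ge0.
have er : e \is Num.real by exact: gtr0_real.
have e0 : 0 < Re e by rewrite -ltcR RRe_real.
have : nbhs (0 : 'rV[C]_m) [set k | nc (dotv d k) <= Re e].
  apply/nbhs0_vn; exists (Re e / (K + 1)); first by rewrite divr_gt0 // ltr_wpDl.
  move=> k /= ke; apply: le_trans (dotv_bound _ _) _.
  rewrite -/K; apply: (@le_trans _ _ ((K + 1) * vn k)).
    by rewrite ler_wpM2r ?vn_ge0 // lerDl.
  by rewrite mulrC -ler_pdivlMr // ltr_wpDl.
rewrite nearE => /nbhs0_vn[r r_gt0 rP].
apply/nbhs_ballP; exists r%:C => /=; first by rewrite ltcR.
move=> k; rewrite -ball_normE /= norm_vn ltcR => hk.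
rewrite -linearB norm_nc -(RRe_real er) lecR; apply: rP; exact: ltW.
Qed.

Lemma derV_differentiable f t d : derV f t d ->
  differentiable f t /\ 'd f t = dotv d :> ('rV[C]_m -> C).
Proof.
move=> df.
have fE : f \o shift t = cst (f t) + dotv d +o_ (0 : 'rV[C]_m) id.
  apply/eqaddoP => e e_gt0.
  have er : e \is Num.real by exact: gtr0_real.
  have e0 : 0 < Re e by rewrite -ltcR RRe_real.
  have [r r_gt0 rP] := df _ e0.
  apply/nbhs0_vn; exists r => // h /rP; rewrite -lecR -norm_nc => H.
  rewrite norm_vn -(RRe_real er) -rmorphM /=; apply: le_trans H.
  by rewrite [t + h]addrC !fctE opprD addrA.
have dE := diff_unique (@dotv_continuous d) fE.
by split=> //; apply/diff_locallyP; rewrite dE; split=> //; exact: dotv_continuous.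
Qed.

Lemma derV_partial f t d p : derV f t d -> partial p f t = d 0 p.
Proof.
move=> /derV_differentiable[df dE].
by rewrite /partial deriveE // dE dotv_delta.
Qed.

Lemma pder_unique p f t d : derV f t d -> pder p f t = d 0 p.
Proof. by move=> df; rewrite pder.unlock (derV_partial p df). Qed.

Definition grad f t : 'rV[C]_m := \row_p pder p f t.

Lemma grad_coord f t p : grad f t 0 p = pder p f t.
Proof. by rewrite mxE. Qed.

Lemma differentiable_derV f t : differentiable f t -> derV f t (grad f t).
Proof.
move=> df; have /eqaddoP fE := diff_locally df.
move=> e e_gt0; have e0 : 0 < e%:C by rewrite ltcR.
have /nbhs0_vn[r r_gt0 rP] := fE _ e0.
exists r => // h /rP; rewrite norm_vn -rmorphM /= norm_nc lecR; apply: le_trans.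
rewrite !fctE [t + h]addrC opprD addrA le_eqVlt; apply/orP; left; apply/eqP.
congr (nc (_ - _)).
have {2}-> : h = \sum_p h 0 p *: delta_mx 0 p by exact: row_sum_delta.
rewrite linear_sum; apply: eq_bigr => p _.
by rewrite linearZ /= grad_coord pder.unlock /partial deriveE // mulrC.
Qed.

End FrechetInterface.

(** * Geometric convergence *)

Section Sequences.
Context {R : realType}.

Lemma geometric_small (A e : R) : 0 < e ->
  exists N, forall k, (N <= k)%N -> A / 2 ^+ k <= e.
Proof.
move=> e_gt0; exists (Num.truncn (`|A| / e)).+1 => k Nk.
rewrite ler_pdivrMr ?exprn_gt0 // mulrC -ler_pdivrMr //.
apply: (@le_trans _ _ (`|A| / e)); first by rewrite ler_pM2r ?invr_gt0 // ler_norm.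
apply: ltW; apply: lt_le_trans (truncnS_gt _) _.
by rewrite -natrX ler_nat; apply: leq_trans Nk _; rewrite ltnW // ltn_expl.
Qed.

Lemma le_geometric (x y A : R) : (forall N, x <= y + A / 2 ^+ N) -> x <= y.
Proof.
move=> H; apply/ler_addgt0Pr => e /(geometric_small A)[N /(_ N (leqnn N)) AN].
by apply: le_trans (H N) _; rewrite lerD2l.
Qed.

Lemma cauchy_geometric_real (u : nat -> R) K :
  (forall N k, `|u (N + k)%N - u N| <= K / 2 ^+ N) ->
  exists l, forall N, `|u N - l| <= K / 2 ^+ N.
Proof.
move=> H; pose l := sup (range (fun N => u N - K / 2 ^+ N)).
have up N k : u N - K / 2 ^+ N <= u k + K / 2 ^+ k.
  have [Nk|kN] := leqP N k.
    have := H N (k - N)%N; rewrite subnKC // ler_norml => /andP[h1 _].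
    have K0 : 0 <= K / 2 ^+ k by apply: le_trans (H k 0%N).
    lra.
  have := H k (N - k)%N; rewrite subnKC ?(ltnW kN) // ler_norml => /andP[_ h1].
  have K0 : 0 <= K / 2 ^+ N by apply: le_trans (H N 0%N).
  lra.
exists l => N; rewrite ler_norml.
have : u N - K / 2 ^+ N <= l.
  by apply: ub_le_sup; [exists (u 0%N + K / 2 ^+ 0) => _ [j _ <-]|exists N].
have : l <= u N + K / 2 ^+ N.
  by apply: ge_sup; [exists (u 0%N - K / 2 ^+ 0); exists 0%N|move=> _ [j _ <-]].
lra.
Qed.

Lemma cauchy_geometric (u : nat -> R[i]) K :
  (forall N k, nc (u (N + k)%N - u N) <= K / 2 ^+ N) ->
  exists l, forall N, nc (u N - l) <= 2 * K / 2 ^+ N.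
Proof.
move=> H.
have [a aP] : exists a, forall N, `|Re (u N) - a| <= K / 2 ^+ N.
  apply: cauchy_geometric_real => N k; rewrite -ReB.
  exact: le_trans (Re_le_nc _) (H N k).
have [b bP] : exists b, forall N, `|Im (u N) - b| <= K / 2 ^+ N.
  apply: cauchy_geometric_real => N k; rewrite -ImB.
  exact: le_trans (Im_le_nc _) (H N k).
exists (a +i* b) => N; apply: le_trans (nc_le_ReIm _) _.
rewrite ReB ImB /=; have := aP N; have := bP N; lra.
Qed.

End Sequences.

(** * Restriction to curves and to complex lines *)

Section CurvesAndLines.
Context {R : realType} {m : nat}.
Local Notation C := R[i].
Implicit Types (t h d v : 'rV[C]_m) (f g : 'rV[C]_m -> C).

Lemma common_delta (I : finType) (P : I -> R -> Prop) :
  (forall p (d d' : R), d' <= d -> P p d -> P p d') ->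
  (forall p, exists2 d : R, 0 < d & P p d) -> exists2 d : R, 0 < d & forall p, P p d.
Proof.
move=> Pmono Pex.
have /choice[d dP] p : exists d : R, 0 < d /\ P p d.
  by have [d d0 Pd] := Pex p; exists d.
exists (\big[Num.min/1]_p d p).
  by apply: lt_bigmin => // p _; case: (dP p).
move=> p; case: (dP p) => _; apply: Pmono.
exact: bigmin_le.
Qed.

Lemma cont_at_row (c : R -> 'rV[C]_m) (x : R) :
  (forall p, contR (fun y => c y 0 p) x) -> cont_at (@Num.norm _ _) vn c x.
Proof.
move=> cc e e_gt0.
have [|p|d d_gt0 dP] := @common_delta _
    (fun p (d : R) => forall h : R, `|h| <= d -> nc (c (x + h) 0 p - c x 0 p) <= e).
- by move=> p d d' dd' H h hd; apply: H; exact: le_trans dd'.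
- exact: cc.
exists d => // h hd; apply: vn_le => [|p]; first exact: ltW.
by have := dP p h hd; rewrite !mxE.
Qed.

Lemma der_row (c : R -> 'rV[C]_m) (x : R) v :
  (forall p, derR (fun y => c y 0 p) x (v 0 p)) ->
  der (@Num.norm _ _) vn c x (fun h : R => h%:C *: v).
Proof.
move=> cc e e_gt0.
have [|p|d d_gt0 dP] := @common_delta _
  (fun p (d : R) => forall h : R, `|h| <= d -> nc (c (x + h) 0 p - c x 0 p - v 0 p * h%:C) <= e * `|h|).
- by move=> p d d' dd' H h hd; apply: H; exact: le_trans dd'.
- exact: cc.
exists d => // h hd; apply: vn_le => [|p]; first by rewrite mulr_ge0 // ltW.
by have := dP p h hd; rewrite !mxE mulrC.
Qed.

Lemma contR_row f (c : R -> 'rV[C]_m) (x : R) :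
  cont_at vn nc f (c x) -> (forall p, contR (fun y => c y 0 p) x) ->
  contR (fun y => f (c y)) x.
Proof.
move=> cf cc e /cf[d /(cont_at_row cc)[d' d'_gt0 d'P] dP]; exists d' => // h /d'P /dP.
by rewrite [c x + _]addrC subrK.
Qed.

Lemma dotvB d : forall u v, dotv d (u - v) = dotv d u - dotv d v.
Proof. exact: linearB. Qed.

Lemma sum_nc_ge0 d : 0 <= \sum_p nc (d 0 p).
Proof. by apply: sumr_ge0 => p _; exact: nc_ge0. Qed.

Lemma derR_row f (c : R -> 'rV[C]_m) (x : R) v d :
  derV f (c x) d -> (forall p, derR (fun y => c y 0 p) x (v 0 p)) ->
  derR (fun y => f (c y)) x (dotv d v).
Proof.
move=> df dc.
apply: fder_ext (fder_comp seminorm_norm seminorm_vn seminorm_nc (vn_ge0 v)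
  (sum_nc_ge0 d) _ (dotv_bound d) (dotvB d) (der_row dc) df).
- by move=> h; rewrite /= linearZ /= mulrC.
- by move=> h; rewrite vnZ nc_real mulrC.
Qed.

Lemma derC_line f t v (z : C) d :
  derV f (t + z *: v) d -> derC (fun z => f (t + z *: v)) z (dotv d v).
Proof.
move=> df; have dl : der nc vn (fun z => t + z *: v) z (fun h : C => h *: v).
  move=> e e_gt0; exists 1 => // h _.
  rewrite scalerDl addrA [_ + h *: v]addrC addrK subrr vn0.
  by rewrite mulr_ge0 ?nc_ge0 // ltW.
apply: fder_ext (fder_comp seminorm_nc seminorm_vn seminorm_nc (vn_ge0 v)
  (sum_nc_ge0 d) _ (dotv_bound d) (dotvB d) dl df).
- by move=> h; rewrite /= linearZ /= mulrC.
- by move=> h; rewrite vnZ mulrC.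
Qed.

Lemma derV_cont f t d : derV f t d -> cont_at vn nc f t.
Proof. exact: (fder_cont seminorm_vn seminorm_nc (sum_nc_ge0 d) (dotv_bound d)). Qed.

Lemma differentiable_cont f t : differentiable f t -> cont_at vn nc f t.
Proof. by move=> /differentiable_derV /derV_cont. Qed.

End CurvesAndLines.

(** * Cauchy estimates in several variables *)

Section CauchyEstimatesSeveral.
Context {R : realType} {m : nat}.
Local Notation C := R[i].
Implicit Types (t h d v : 'rV[C]_m) (f g : 'rV[C]_m -> C).

Section Ball.
Variables (f : 'rV[C]_m -> C) (t : 'rV[C]_m) (rho M : R).
Hypothesis rho_gt0 : 0 < rho.
Hypothesis df : forall h, vn h < rho -> differentiable f (t + h).
Hypothesis fM : forall h, vn h < rho -> nc (f (t + h)) <= M.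

Let line_in v (z : C) : vn v <= 1 -> nc z < rho -> vn (z *: v) < rho.
Proof.
move=> v1; apply: le_lt_trans; rewrite vnZ ler_piMr ?nc_ge0 //.
Qed.

Let dline v (z : C) : vn v <= 1 -> nc z < rho ->
  derC (fun z => f (t + z *: v)) z (dotv (grad f (t + z *: v)) v).
Proof.
by move=> v1 zr; apply: derC_line; apply: differentiable_derV; apply: df; exact: line_in.
Qed.

Lemma cauchy_gradient v : vn v <= 1 -> nc (dotv (grad f t) v) <= 16 * M / rho.
Proof.
have rho0 := rho_gt0; move=> v1.
have := @cauchy_derivative _ _ _ rho M rho_gt0 (fun z => dline v1)
  (fun z zr => fM (line_in v1 zr)) 0.
by rewrite scale0r addr0; apply; rewrite nc0; lra.
Qed.

Lemma cauchy_partial p : nc (pder p f t) <= 16 * M / rho.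
Proof.
have := cauchy_gradient (vn_delta p); rewrite dotv_delta grad_coord.
exact.
Qed.

(** Restrict to the complex line through t in the direction of h. *)
Lemma taylor_remainder h : vn h <= rho / 4 ->
  nc (f (t + h) - f t - dotv (grad f t) h) <= 2048 * M / rho ^+ 2 * vn h ^+ 2.
Proof.
have rho0 := rho_gt0; move=> h_rho.
have [h0|h_neq0] := eqVneq (vn h) 0.
  by rewrite h0 (vn_eq0 h0) addr0 linear0 subrr subr0 nc0 expr0n mulr0.
have h_gt0 : 0 < vn h by rewrite lt0r h_neq0 vn_ge0.
pose v := (vn h)%:C^-1 *: h.
have ncr : nc (vn h)%:C = vn h by rewrite nc_real ger0_norm // vn_ge0.
have v1 : vn v <= 1 by rewrite vnZ ncV ncr mulVf.
have hE : h = (vn h)%:C *: v.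
  by rewrite scalerA divff ?scale1r // -nc_eq0 ncr.
have := @cauchy_remainder _ _ _ rho M rho_gt0 (fun z => dline v1)
  (fun z zr => fM (line_in v1 zr)) (vn h)%:C.
rewrite ncr scale0r addr0 -hE => /(_ h_rho).
have -> // : dotv (grad f t) v * (vn h)%:C = dotv (grad f t) h.
by rewrite [in RHS]hE [RHS]linearZ /= mulrC.
Qed.

End Ball.

Lemma taylor_uniform (rho M : R) : 0 < rho -> 0 <= M -> exists2 L, 0 <= L &
  forall f t, (forall h, vn h < rho -> differentiable f (t + h)) ->
    (forall h, vn h < rho -> nc (f (t + h)) <= M) ->
    forall h, vn h <= rho / 4 ->
      nc (f (t + h) - f t - dotv (grad f t) h) <= L * vn h ^+ 2.
Proof.
move=> rho_gt0 M0; exists (2048 * M / rho ^+ 2).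
  by apply: divr_ge0; [apply: mulr_ge0; [exact: ler0n|exact: M0]|exact: sqr_ge0].
by move=> f t df fM h; exact: taylor_remainder.
Qed.

(** The gradients converge by the Cauchy estimate for differences, and the
    quadratic remainder, whose constant is common to the sequence, survives in
    the limit. *)
Lemma differentiable_uniform_limit (F : nat -> 'rV[C]_m -> C) f t (rho M B : R) :
  0 < rho ->
  (forall N h, vn h < rho -> differentiable (F N) (t + h)) ->
  (forall N h, vn h < rho -> nc (F N (t + h)) <= M) ->
  (forall N h, vn h < rho -> nc (F N (t + h) - f (t + h)) <= B / 2 ^+ N) ->
  differentiable f t /\
  forall p N, nc (pder p (F N) t - pder p f t) <= 2 * (16 * (2 * B) / rho) / 2 ^+ N.
Proof.
move=> rho_gt0 dF FM Ff.
have B0 : 0 <= B.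
  have := Ff 0%N 0; rewrite vn0 expr0 divr1 => /(_ rho_gt0).
  by apply: le_trans; exact: nc_ge0.
have M0 : 0 <= M.
  have := FM 0%N 0; rewrite vn0 => /(_ rho_gt0).
  by apply: le_trans; exact: nc_ge0.
have half N : 0 < (2 : R) ^- N by rewrite invr_gt0 exprn_gt0.
have halfD N k : (2 : R) ^- (N + k) <= 2 ^- N.
  rewrite lef_pV2 ?posrE ?exprn_gt0 // ler_eXn2l ?leq_addr //; lra.
have gradB N k p : nc (pder p (F (N + k)%N) t - pder p (F N) t)
    <= 16 * (2 * B) / rho / 2 ^+ N.
  have E : pder p (F (N + k)%N) t - pder p (F N) t
      = pder p (F (N + k)%N \- F N) t.
    have d0 K : differentiable (F K) t by rewrite -[t]addr0; apply: dF; rewrite vn0.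
    by rewrite pder.unlock /partial deriveB //; apply: diff_derivable.
  rewrite E; apply: le_trans (@cauchy_partial _ _ rho (2 * B / 2 ^+ N) rho_gt0 _ _ p) _.
  - by move=> h hr; apply: differentiableB; exact: dF.
  - move=> h hr; rewrite /= (_ : _ - _ = (F (N + k)%N (t + h) - f (t + h))
      - (F N (t + h) - f (t + h))); last by rewrite opprB addrA subrK.
    apply: le_trans (ncB _ _) _.
    have := Ff N h hr; have := Ff (N + k)%N h hr.
    by have := ler_wpM2l B0 (halfD N k); lra.
  - by rewrite le_eqVlt; apply/orP; left; apply/eqP; ring.
have [l lP] := choice (fun p => cauchy_geometric (fun N k => gradB N k p)).
pose d : 'rV[C]_m := \row_p l p.
set K := 2 * _ in lP.
have K0 : 0 <= K by rewrite /K !mulr_ge0 // invr_ge0 ltW.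
have [L L0 taylor] := taylor_uniform rho_gt0 M0.
have rem h : vn h <= rho / 4 ->
    nc (f (t + h) - f t - dotv d h) <= L * vn h ^+ 2.
  move=> hr; apply: (@le_geometric _ _ _ (2 * B + (\sum_(p < m) K) * vn h)) => N.
  have hr' : vn h < rho by lra.
  have E : f (t + h) - f t - dotv d h
    = (F N (t + h) - F N t - dotv (grad (F N) t) h)
      - (F N (t + h) - f (t + h)) + (F N t - f t) + (dotv (grad (F N) t) h - dotv d h).
    by ring.
  rewrite E; apply: le_trans (ncD _ _) _.
  have D1 : nc (dotv (grad (F N) t) h - dotv d h) <= (\sum_(p < m) K) * vn h / 2 ^+ N.
    rewrite /dotv -sumrB; apply: le_trans (nc_sum _ _ _) _.
    rewrite -mulrA mulr_suml; apply: ler_sum => p _.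
    rewrite -mulrBl !mxE ncM mulrC [vn h / _]mulrC mulrA mulrC.
    by apply: ler_pM; rewrite ?nc_ge0 ?nc_le_vn ?lP.
  have D2 : nc (F N t - f t) <= B / 2 ^+ N.
    by have := Ff N 0; rewrite vn0 addr0; apply.
  have D3 := Ff N h hr'.
  have D4 := taylor _ _ (dF N) (FM N) h hr.
  apply: le_trans (lerD (ncD _ _) D1) _.
  apply: le_trans (lerD (lerD (ncB _ _) D2) (lexx _)) _.
  lra.
have dd : derV f t d.
  move=> e e_gt0.
  exists (Num.min (rho / 4) (e / (L + 1))).
    by rewrite lt_min !divr_gt0 // ltr_wpDl.
  move=> h; rewrite le_min => /andP[/rem hrem he].
  apply: le_trans hrem _; rewrite expr2 mulrA ler_wpM2r ?vn_ge0 //.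
  apply: (@le_trans _ _ ((L + 1) * vn h)).
    by rewrite ler_wpM2r ?vn_ge0 // lerDl.
  by rewrite mulrC -ler_pdivlMr // ltr_wpDl.
split; first by case: (derV_differentiable dd).
by move=> p N; rewrite (pder_unique p dd) mxE; exact: lP.
Qed.

End CauchyEstimatesSeveral.

Lemma geometric_le (R : realType) (A : R) N : 0 <= A -> A / 2 ^+ N <= A.
Proof.
move=> A0; rewrite ler_pdivrMr; last exact: exprn_gt0.
by apply: ler_peMr => //; apply: exprn_ege1; rewrite ler1n.
Qed.

(** * Partial derivatives *)

Section PartialCalculus.
Context {R : realType} {m : nat}.
Local Notation C := R[i].
Implicit Types (t h : 'rV[C]_m) (f g : 'rV[C]_m -> C).

Lemma derV_row f t (a : 'I_m -> C) :
  der vn nc f t (fun h : 'rV[C]_m => \sum_p a p * h 0 p) -> derV f t (\row_p a p).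
Proof. by apply: fder_ext => h; apply: eq_bigr => p _; rewrite mxE. Qed.

Lemma pder_row_unique f (a : 'I_m -> C) t p :
  der vn nc f t (fun h : 'rV[C]_m => \sum_p a p * h 0 p) -> pder p f t = a p.
Proof. by move=> /derV_row /(pder_unique p) ->; rewrite mxE. Qed.

Lemma differentiable_add f g t : differentiable f t -> differentiable g t ->
  differentiable (fun x => f x + g x) t.
Proof. exact: differentiableD. Qed.

Lemma differentiable_sub f g t : differentiable f t -> differentiable g t ->
  differentiable (fun x => f x - g x) t.
Proof. exact: differentiableB. Qed.

Lemma differentiable_mul f g t : differentiable f t -> differentiable g t ->
  differentiable (fun x => f x * g x) t.
Proof. exact: differentiableM. Qed.

Lemma differentiable_opp f t : differentiable f t -> differentiable (fun x => - f x) t.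
Proof. exact: differentiableN. Qed.

Lemma differentiable_const (c : C) t : differentiable (fun=> c) t.
Proof. exact: differentiable_cst. Qed.

Lemma differentiable_coordinate p t : differentiable (fun x : 'rV[C]_m => x 0 p) t.
Proof. exact: differentiable_coord. Qed.

Lemma differentiable_bigsum (I : Type) (s : seq I) (P : pred I)
    (f : I -> 'rV[C]_m -> C) t :
  (forall i, differentiable (f i) t) ->
  differentiable (fun x => \sum_(i <- s | P i) f i x) t.
Proof.
move=> df; elim: s => [|i s IH].
  by under eq_fun do rewrite big_nil; exact: differentiable_const.
under eq_fun do rewrite big_cons.
by case: (P i); [exact: differentiable_add (df i) IH|exact: IH].
Qed.

Lemma pder_add p f g t : differentiable f t -> differentiable g t ->
  pder p (fun x => f x + g x) t = pder p f t + pder p g t.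
Proof. by move=> df dg; rewrite pder.unlock; apply: deriveD; exact: diff_derivable. Qed.

Lemma pder_sub p f g t : differentiable f t -> differentiable g t ->
  pder p (fun x => f x - g x) t = pder p f t - pder p g t.
Proof. by move=> df dg; rewrite pder.unlock; apply: deriveB; exact: diff_derivable. Qed.

Lemma pder_const p (c : C) t : pder p (fun=> c) t = 0.
Proof. rewrite pder.unlock; exact: derive_cst. Qed.

Lemma pder_mul p f g t : differentiable f t -> differentiable g t ->
  pder p (fun x => f x * g x) t = pder p f t * g t + f t * pder p g t.
Proof.
move=> df dg.
apply: (@pder_row_unique _ (fun q => pder q f t * g t + f t * pder q g t)).
apply: fder_ext (fder_mul seminorm_vn (sum_nc_ge0 _) (sum_nc_ge0 _)
  (dotv_bound _) (dotv_bound _) (differentiable_derV df) (differentiable_derV dg)).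
move=> h; rewrite /dotv mulr_suml mulr_sumr -big_split; apply: eq_bigr => q _.
rewrite !grad_coord.
have E (a b c e k : C) : a * k * c + e * (b * k) = (a * c + e * b) * k by ring.
exact: E.
Qed.

Lemma pder_scale p (c : C) f t : differentiable f t ->
  pder p (fun x => c * f x) t = c * pder p f t.
Proof.
move=> df; rewrite (pder_mul p (differentiable_const c t) df).
by rewrite pder_const mul0r add0r.
Qed.

Lemma pder_coordinate p q t :
  pder p (fun x : 'rV[C]_m => x 0 q) t = (p == q)%:R.
Proof.
have H : derV (fun x : 'rV[C]_m => x 0 q) t (delta_mx 0 q : 'rV[C]_m).
  move=> e e_gt0; exists 1 => // h _.
  rewrite (bigD1 q) //= big1 ?addr0 => [|i iq]; last first.
    by rewrite mxE (negPf iq) mul0r.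
  by rewrite !mxE !eqxx mul1r [t 0 q + _]addrC addrK subrr nc0 mulr_ge0 ?vn_ge0 // ltW.
by rewrite (pder_unique p H) mxE eqxx.
Qed.

Lemma pder_bigsum p (I : Type) (s : seq I) (f : I -> 'rV[C]_m -> C) t :
  (forall i, differentiable (f i) t) ->
  pder p (fun x => \sum_(i <- s) f i x) t = \sum_(i <- s) pder p (f i) t.
Proof.
move=> df; elim: s => [|i s IH].
  rewrite big_nil -[RHS](pder_const p 0 t).
  by congr (pder p _ t); apply/funext => x; rewrite big_nil.
rewrite big_cons -IH -(pder_add p (df i) (differentiable_bigsum _ _ df)).
by congr (pder p _ t); apply/funext => x; rewrite big_cons.
Qed.

End PartialCalculus.

(** * Holomorphic functions on polydiscs *)

Section Polydisc.
Context {R : realType} {m : nat}.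
Local Notation C := R[i].
Implicit Types (t h : 'rV[C]_m) (f g : 'rV[C]_m -> C).

Definition hol (r : R) f := forall t, vn t < r -> differentiable f t.

Definition bounded_by (r M : R) f := forall t, vn t < r -> nc (f t) <= M.

Lemma polydisc_shift (r : R) t h : vn h < r - vn t -> vn (t + h) < r.
Proof. by move=> hr; apply: le_lt_trans (vnD _ _) _; lra. Qed.

Lemma hol_le (r r' : R) f : r' <= r -> hol r f -> hol r' f.
Proof. by move=> rr hf t tr; apply: hf; exact: lt_le_trans rr. Qed.

Lemma bounded_le (r r' M : R) f : r' <= r -> bounded_by r M f -> bounded_by r' M f.
Proof. by move=> rr hf t tr; apply: hf; exact: lt_le_trans rr. Qed.

Lemma pder_bound (r M : R) f p t : hol r f -> bounded_by r M f -> vn t < r ->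
  nc (pder p f t) <= 16 * M / (r - vn t).
Proof.
move=> hf fM tr; apply: cauchy_partial.
- by rewrite subr_gt0.
- by move=> h /polydisc_shift; exact: hf.
- by move=> h /polydisc_shift; exact: fM.
Qed.

(** The difference quotients with steps in geometric progression are
    holomorphic and converge uniformly to the partial derivative; the partial
    derivatives of the quotients converge both to the partial derivative of
    the limit and, as difference quotients, to the other mixed one. *)
Lemma pder_regular (r M : R) f p t : hol r f -> bounded_by r M f -> vn t < r ->
  differentiable (pder p f) t /\
  forall q, differentiable (pder q f) t ->
    pder q (pder p f) t = pder p (pder q f) t.
Proof.
move=> hf fM tr; pose rho := (r - vn t) / 2.
have rho_gt0 : 0 < rho by rewrite /rho; lra.
have M0 : 0 <= M by apply: le_trans (fM t tr); exact: nc_ge0.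
pose s N : R := rho / 4 / 2 ^+ N.
have s_gt0 N : 0 < s N by apply: divr_gt0; [apply: divr_gt0|apply: exprn_gt0].
have s_le N : s N <= rho / 4.
  by apply: geometric_le; apply: ltW; apply: divr_gt0.
have in_r h k : vn h < rho -> vn k < rho -> vn (t + h + k) < r.
  move=> hr kr; have := vnD (t + h) k; have := vnD t h; rewrite /rho in hr kr *; lra.
pose k N : 'rV[C]_m := (s N)%:C *: delta_mx 0 p.
have kv N : vn (k N) <= s N.
  by rewrite vnZ nc_real (gtr0_norm (s_gt0 N)) ler_piMr ?vn_delta //; exact: ltW.
have k_rho N : vn (k N) < rho by have := kv N; have := s_le N; lra.
pose Q N x := (s N)%:C^-1 * (f (x + k N) - f x).
have sC N : (s N)%:C != 0 :> C by rewrite -nc_gt0 nc_real normr_gt0 gt_eqF.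
have dshift N h : vn h < rho -> differentiable (fun x => f (x + k N)) (t + h).
  move=> hr; have H : derV (fun x => f (x + k N)) (t + h) (grad f (t + h + k N)).
    have dfk := differentiable_derV (hf _ (in_r _ _ hr (k_rho N))).
    by move=> e /dfk[d d_gt0 dP]; exists d => // l /dP; rewrite [_ + l + _]addrAC.
  by case: (derV_differentiable H).
have in0 h : vn h < rho -> vn (t + h) < r.
  by move=> hr; rewrite -[t + h]addr0; apply: in_r; rewrite ?vn0.
have dQ N h : vn h < rho -> differentiable (Q N) (t + h).
  move=> hr; apply: differentiable_mul; first exact: differentiable_const.
  by apply: differentiable_sub; [exact: dshift|apply: hf; exact: in0].
have [L L0 taylor] := taylor_uniform (m := m) rho_gt0 M0.
have QB N h : vn h < rho -> nc (Q N (t + h) - pder p f (t + h)) <= L * rho / 4 / 2 ^+ N.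
  move=> hr.
  have := taylor _ _ (fun l lr => hf _ (in_r _ _ hr lr))
    (fun l lr => fM _ (in_r _ _ hr lr)) _ (le_trans (kv N) (s_le N)).
  rewrite linearZ /= dotv_delta grad_coord => T.
  have E : Q N (t + h) - pder p f (t + h)
      = (s N)%:C^-1 * (f (t + h + k N) - f (t + h) - (s N)%:C * pder p f (t + h)).
    by rewrite /Q [in RHS]mulrBr mulKf.
  rewrite E ncM ncV nc_real (gtr0_norm (s_gt0 N)).
  rewrite ler_pdivrMl //; apply: le_trans T _.
  have -> : s N * (L * rho / 4 / 2 ^+ N) = L * (s N) ^+ 2 by rewrite /s expr2; ring.
  rewrite ler_wpM2l // !expr2; apply: ler_pM; rewrite ?vn_ge0 //.
pose B := L * rho / 4.
have B0 : 0 <= B by apply: divr_ge0 => //; apply: mulr_ge0 => //; exact: ltW.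
have BN N : B / 2 ^+ N <= B.
  exact: geometric_le.
have QM N h : vn h < rho -> nc (Q N (t + h)) <= 16 * M / rho + B.
  move=> hr; rewrite -[Q N _](subrK (pder p f (t + h))).
  apply: le_trans (ncD _ _) _; rewrite addrC; apply: lerD.
    apply: cauchy_partial rho_gt0 _ _ _ => l lr; [apply: hf|apply: fM]; exact: in_r.
  exact: le_trans (QB N h hr) (BN N).
have [dp lim] := differentiable_uniform_limit rho_gt0 dQ QM QB.
split=> // q dq; apply/eqP; rewrite -subr_eq0; apply/eqP.
have t0 : vn (0 : 'rV[C]_m) < rho by rewrite vn0.
have QqE N : pder q (Q N) t = (s N)%:C^-1 * (pder q f (t + k N) - pder q f t).
  have d1 : differentiable (fun x => f (x + k N)) t by rewrite -[t]addr0; exact: dshift.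
  have d2 : differentiable f t by exact: hf.
  rewrite pder_scale; last exact: differentiable_sub.
  rewrite pder_sub //; congr (_ * (_ - _)).
  have dfk := differentiable_derV (hf _ (in_r _ _ t0 (k_rho N))); rewrite addr0 in dfk.
  have H : derV (fun x => f (x + k N)) t (grad f (t + k N)).
    by move=> e /dfk[d d_gt0 dP]; exists d => // l /dP; rewrite [_ + l + _]addrAC.
  by rewrite (pder_unique q H) grad_coord.
apply: nc_le_eps => e e_gt0; have e2 : 0 < e / 2 by rewrite divr_gt0.
have [d d_gt0 dP] := differentiable_derV dq e2.
set K := 2 * _ in lim.
have [N1 N1P] := geometric_small K e2.
have [N2 N2P] := geometric_small (rho / 4) d_gt0.
pose N := maxn N1 N2.
have KN : K / 2 ^+ N <= e / 2 by apply: N1P; exact: leq_maxl.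
have sd : s N <= d by apply: N2P; exact: leq_maxr.
have := dP (k N) (le_trans (kv N) sd).
rewrite -/(dotv _ _) linearZ /= dotv_delta grad_coord => T.
rewrite -[_ - _](subrKA (pder q (Q N) t)).
apply: le_trans (ncD _ _) _; rewrite [e]splitr; apply: lerD.
  by rewrite nc_dist; apply: le_trans (lim q N) KN.
rewrite QqE.
have -> : (s N)%:C^-1 * (pder q f (t + k N) - pder q f t) - pder p (pder q f) t
  = (s N)%:C^-1 * (pder q f (t + k N) - pder q f t - (s N)%:C * pder p (pder q f) t).
  by rewrite [in RHS]mulrBr mulKf.
rewrite ncM ncV nc_real (gtr0_norm (s_gt0 N)) ler_pdivrMl //.
by apply: le_trans T _; rewrite mulrC ler_wpM2r // ltW.
Qed.

Lemma pder_hol (r M : R) f p : hol r f -> bounded_by r M f -> hol r (pder p f).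
Proof. by move=> hf fM t tr; case: (pder_regular p hf fM tr). Qed.

Lemma pder_comm (r M : R) f p q t : hol r f -> bounded_by r M f -> vn t < r ->
  pder q (pder p f) t = pder p (pder q f) t.
Proof.
move=> hf fM tr; have [_ ->//] := pder_regular p hf fM tr.
exact: pder_hol hf fM t tr.
Qed.

Lemma contR_hol (r : R) f (c : R -> 'rV[C]_m) (x : R) : hol r f -> vn (c x) < r ->
  (forall p, contR (fun y => c y 0 p) x) -> contR (fun y => f (c y)) x.
Proof. by move=> hf cr; apply: contR_row; apply: differentiable_cont; exact: hf. Qed.

Section Average.
Variables (k : R -> C) (c : 'I_m -> R -> C) (K : R).
Hypothesis contk : forall x, contR k x.
Hypothesis contc : forall p x, contR (c p) x.
Hypothesis c_le1 : forall p x, nc (c p x) <= 1.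
Hypothesis k_le : forall x, 0 < x < 1 -> nc (k x) <= K.

Definition dilate x t : 'rV[C]_m := \row_p (c p x * t 0 p).

(** The contractions commute with the fields t_p d/dt_p, hence so does the
    average; solutions of Euler equations are written in this form. *)
Definition average f t : C := cint (fun x => k x * f (dilate x t)) 0 1.

Lemma vn_dilate x t : vn (dilate x t) <= vn t.
Proof.
apply: vn_le => [|p]; first exact: vn_ge0.
rewrite mxE ncM; apply: le_trans (nc_le_vn t p).
by rewrite ler_piMl ?nc_ge0.
Qed.

Lemma dilateD x t h : dilate x (t + h) = dilate x t + dilate x h.
Proof. by apply/rowP => p; rewrite !mxE mulrDr. Qed.

Lemma contR_dilate t p x : contR (fun x => dilate x t 0 p) x.
Proof.
under eq_fun do rewrite mxE; exact: contR_mul (contc p x) (contR_cst (t 0 p) x).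
Qed.

Lemma contR_average (r : R) f t x : hol r f -> vn t < r ->
  contR (fun x => k x * f (dilate x t)) x.
Proof.
move=> hf tr; apply: contR_mul => //; apply: (contR_hol hf).
  exact: le_lt_trans (vn_dilate _ _) tr.
by move=> p; exact: contR_dilate.
Qed.

Lemma average_derV (r M : R) f t : hol r f -> bounded_by r M f -> vn t < r ->
  der vn nc (average f) t (fun h : 'rV[C]_m =>
    \sum_p cint (fun x => k x * (c p x * pder p f (dilate x t))) 0 1 * h 0 p).
Proof.
move=> hf fM tr e e_gt0; pose rho := r - vn t.
have rho_gt0 : 0 < rho by rewrite /rho; lra.
have M0 : 0 <= M by apply: le_trans (fM t tr); exact: nc_ge0.
have K0 : 0 <= K.
  have half : 0 < (2^-1 : R) < 1 by lra.
  by apply: le_trans (k_le half); exact: nc_ge0.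
have [L L0 taylor] := taylor_uniform (m := m) rho_gt0 M0.
pose L1 := 2 * K * L; have L10 : 0 <= L1.
  by apply: mulr_ge0; [apply: mulr_ge0; [exact: ler0n|]|].
exists (Num.min (rho / 8) (e / (L1 + 1))).
  by rewrite lt_min !divr_gt0 // ltr_wpDl.
move=> h; rewrite le_min => /andP[hr he].
have hr' : vn h < r - vn t by rewrite -/rho; lra.
have cp p x : contR (fun x => k x * (c p x * pder p f (dilate x t))) x.
  apply: contR_mul => //; apply: contR_mul => //; apply: (contR_hol (pder_hol p hf fM)).
    exact: le_lt_trans (vn_dilate _ _) tr.
  by move=> q; exact: contR_dilate.
have ch p x : contR (fun x => h 0 p * (k x * (c p x * pder p f (dilate x t)))) x.
  by apply: contR_mul; [exact: contR_cst|exact: cp].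
have -> : average f (t + h) - average f t -
    \sum_p cint (fun x => k x * (c p x * pder p f (dilate x t))) 0 1 * h 0 p
  = cint (fun x => k x * f (dilate x (t + h)) - k x * f (dilate x t)
      - \sum_p h 0 p * (k x * (c p x * pder p f (dilate x t)))) 0 1.
  rewrite !cint_sub ?ler01 //.
  - rewrite cint_sum ?ler01 //; congr (_ - _ - _); apply: eq_bigr => p _.
    by rewrite cint_scale ?ler01 // mulrC.
  - by move=> x; exact: contR_average hf (polydisc_shift hr').
  - by move=> x; exact: contR_average hf tr.
  - by move=> x; apply: contR_sub; apply: contR_average hf _; rewrite ?polydisc_shift.
  - by move=> x; exact: contR_sum.
apply: (@le_trans _ _ (2 * (K * (L * vn h ^+ 2)) * (1 - 0))).
  apply: cint_bound ler01 _ _ => [x|x x01].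
    apply: contR_sub; last exact: contR_sum.
    by apply: contR_sub; apply: contR_average hf _; rewrite ?polydisc_shift.
  have -> : k x * f (dilate x (t + h)) - k x * f (dilate x t)
      - \sum_p h 0 p * (k x * (c p x * pder p f (dilate x t)))
    = k x * (f (dilate x t + dilate x h) - f (dilate x t)
      - dotv (grad f (dilate x t)) (dilate x h)).
    rewrite dilateD !mulrBr; congr (_ - _); rewrite /dotv mulr_sumr.
    by apply: eq_bigr => p _; rewrite !mxE; ring.
  rewrite ncM; apply: ler_pM; rewrite ?nc_ge0 ?k_le //.
  have dt : vn (dilate x t) <= vn t by exact: vn_dilate.
  have in_r l : vn l < rho -> vn (dilate x t + l) < r.
    by move=> lr; apply: polydisc_shift; rewrite /rho in lr; lra.
  apply: le_trans (taylor f (dilate x t) _ _ _ _) _.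
  - by move=> l lr; apply: hf; exact: in_r.
  - by move=> l lr; apply: fM; exact: in_r.
  - by apply: le_trans (vn_dilate _ _) _; lra.
  - by rewrite ler_wpM2l // !expr2; apply: ler_pM; rewrite ?vn_ge0 ?vn_dilate.
rewrite subr0 mulr1 expr2.
have -> : 2 * (K * (L * (vn h * vn h))) = L1 * vn h * vn h by rewrite /L1; ring.
rewrite ler_wpM2r ?vn_ge0 //.
apply: (@le_trans _ _ ((L1 + 1) * vn h)); first by rewrite ler_wpM2r ?vn_ge0 // lerDl.
by rewrite mulrC -ler_pdivlMr // ltr_wpDl.
Qed.

Lemma average_hol (r M : R) f : hol r f -> bounded_by r M f -> hol r (average f).
Proof.
by move=> hf fM t tr; case: (derV_differentiable (derV_row (average_derV hf fM tr))).
Qed.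

Lemma pder_average (r M : R) f p t : hol r f -> bounded_by r M f -> vn t < r ->
  pder p (average f) t = cint (fun x => k x * (c p x * pder p f (dilate x t))) 0 1.
Proof.
by move=> hf fM tr; rewrite (pder_row_unique p (average_derV hf fM tr)).
Qed.

End Average.
End Polydisc.

(** * Euler operators *)

Section EulerOperators.
Context {R : realType} {m : nat}.
Local Notation C := R[i].
Implicit Types (t : 'rV[C]_m) (u f g : 'rV[C]_m -> C).

Definition euler (s : 'I_m) u t : C := t 0 s * pder s u t.

Lemma euler_add p f g t : differentiable f t -> differentiable g t ->
  euler p (fun t => f t + g t) t = euler p f t + euler p g t.
Proof. by move=> df dg; rewrite /euler pder_add // mulrDr. Qed.

Lemma euler_sub p f g t : differentiable f t -> differentiable g t ->
  euler p (fun t => f t - g t) t = euler p f t - euler p g t.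
Proof. by move=> df dg; rewrite /euler pder_sub // mulrBr. Qed.

Lemma euler_const p (c : C) t : euler p (fun=> c) t = 0.
Proof. by rewrite /euler pder_const mulr0. Qed.

Lemma pder_zero (r' : R) f p t : (forall t, vn t < r' -> f t = 0) -> vn t < r' ->
  pder p f t = 0.
Proof.
move=> f0 tr; apply: (@pder_row_unique _ _ f (fun=> 0)) => e e_gt0.
exists ((r' - vn t) / 2); first by rewrite divr_gt0 // subr_gt0.
move=> h hr; rewrite big1 => [|q _]; last by rewrite mul0r.
rewrite !f0 //; last by apply: polydisc_shift; lra.
by rewrite !subr0 nc0 mulr_ge0 ?vn_ge0 // ltW.
Qed.

Lemma euler_hol (r' B : R) f p : hol r' f -> bounded_by r' B f -> hol r' (euler p f).
Proof.
move=> hf fB t tr; apply: differentiable_mul; first exact: differentiable_coordinate.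
exact: pder_hol hf fB t tr.
Qed.

Lemma euler_mul p f g t : differentiable f t -> differentiable g t ->
  euler p (fun t => f t * g t) t = euler p f t * g t + f t * euler p g t.
Proof. by move=> df dg; rewrite /euler pder_mul //; ring. Qed.

Lemma euler_bigsum p (I : Type) (e : seq I) (f : I -> 'rV[C]_m -> C) t :
  (forall i, differentiable (f i) t) ->
  euler p (fun t => \sum_(i <- e) f i t) t = \sum_(i <- e) euler p (f i) t.
Proof. by move=> df; rewrite /euler pder_bigsum // mulr_sumr. Qed.

Lemma euler_comm (r' B : R) f p q t : hol r' f -> bounded_by r' B f -> vn t < r' ->
  euler q (euler p f) t = euler p (euler q f) t.
Proof.
move=> hf fB tr.
have E a b : euler a (euler b f) t
    = t 0 a * (a == b)%:R * pder b f t + t 0 a * (t 0 b * pder a (pder b f) t).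
  rewrite {1}/euler pder_mul.
  - by rewrite pder_coordinate mulrDr mulrA.
  - exact: differentiable_coordinate.
  - exact: pder_hol hf fB t tr.
rewrite !E (pder_comm p q hf fB tr) eq_sym.
have [->//|_] := eqVneq p q.
by rewrite !mulr0 !mul0r !add0r mulrCA.
Qed.

Section Rotation.
Variables (s : 'I_m) (a : C).
Hypothesis a_nonint : forall z : int, a <> z%:~R.

Let tau : C := 'i * (pi *+ 2)%:C.
Let weight (x : R) : C := cexp (- (tau * a) * x%:C).
Let rot (p : 'I_m) (x : R) : C := if p == s then cexp (tau * x%:C) else 1.

Lemma nc_cexp_imaginary (y x : R) : nc (cexp ('i * y%:C * x%:C)) = 1.
Proof. by rewrite -mulrA -rmorphM -expi_cexp nc_expi. Qed.

Let rot_le1 p x : nc (rot p x) <= 1.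
Proof. by rewrite /rot; case: eqP => _; rewrite ?nc1 // nc_cexp_imaginary. Qed.

Let derR_rot p x : derR (rot p) x (if p == s then tau * cexp (tau * x%:C) else 0).
Proof. by rewrite /rot; case: eqP => _; [exact: derR_cexp|exact: derR_cst]. Qed.

Let contR_rot p x : contR (rot p) x.
Proof. exact: derR_contR (derR_rot p x). Qed.

Let dilate_rot_end t : dilate rot 1 t = t.
Proof.
apply/rowP => p; rewrite mxE /rot; case: eqP => _; last by rewrite mul1r.
by rewrite rmorph1 mulr1 -expi_cexp expi_2pi mul1r.
Qed.

Let dilate_rot_start t : dilate rot 0 t = t.
Proof.
apply/rowP => p; rewrite mxE /rot; case: eqP => _; last by rewrite mul1r.
by rewrite rmorph0 mulr0 cexp0 mul1r.
Qed.

(* The monodromy of t_s^(-a) minus 1. *)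
Let holonomy : C := cexp (- (tau * a)) - 1.

Lemma holonomy_neq0 : holonomy != 0.
Proof.
apply/eqP => /eqP; rewrite subr_eq0 => /eqP /cexp_eq1[k kE].
have i0 : 'i != 0 :> C by rewrite -nc_gt0 /= expr0n expr1n add0r sqrtr1 ltr01.
have T0 : (pi *+ 2)%:C != 0 :> C by rewrite -nc_gt0 nc_real normr_gt0 gt_eqF // pi2_gt0.
have tau0 : tau != 0 by rewrite mulf_neq0.
apply: (a_nonint (z := - k)); apply: (mulfI tau0); rewrite -[LHS]opprK kE.
by rewrite /tau rmorphM /= rmorph_int rmorphN /=; ring.
Qed.

(** Along the rotation of one coordinate, the twisted function has the
    inhomogeneity of the Euler equation as its derivative. *)
Lemma derR_rotation (r : R) u t x : hol r u -> vn t < r ->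
  derR (fun x => weight x * u (dilate rot x t)) x
    (tau * weight x * (euler s u (dilate rot x t) - a * u (dilate rot x t))).
Proof.
move=> hu tr; set y := dilate rot x t.
have yr : vn y < r by apply: le_lt_trans tr; exact: vn_dilate.
pose v : 'rV[C]_m := \row_p (if p == s then tau * cexp (tau * x%:C) * t 0 s else 0).
have dv p : derR (fun x => dilate rot x t 0 p) x (v 0 p).
  under eq_fun do rewrite mxE.
  apply: derR_eq (derR_mul (derR_rot p x) (derR_cst (t 0 p) x)).
  by rewrite mulr0 addr0 mxE; case: eqP => [->|]; rewrite ?mul0r.
have du := derR_row (differentiable_derV (hu _ yr)) dv.
apply: derR_eq (derR_mul (derR_cexp (- (tau * a)) x) du).
have -> : dotv (grad u y) v = tau * euler s u y.
  rewrite /dotv (bigD1 s) //= big1 ?addr0 => [|p ps]; last first.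
    by rewrite [v 0 p]mxE (negPf ps) mulr0.
  rewrite grad_coord /euler [v 0 s]mxE [y 0 s]mxE eqxx /rot eqxx.
  by move: (pder s u y) => *; ring.
by rewrite /weight; ring.
Qed.

Lemma rotation_increment u t :
  weight 1 * u (dilate rot 1 t) - weight 0 * u (dilate rot 0 t) = holonomy * u t.
Proof.
rewrite dilate_rot_end dilate_rot_start /weight rmorph1 rmorph0 mulr1 mulr0 cexp0.
by rewrite -mulrBl.
Qed.

Let wbound : R := expR `|Re (- (tau * a))|.

Let weight_le x : 0 <= x <= 1 -> nc (weight x) <= wbound.
Proof.
move=> /andP[x0 x1]; rewrite nc_cexp ler_expR Re_mul_real.
apply: le_trans (ler_norm _) _; rewrite normrM.
by rewrite ler_piMr // ger0_norm.
Qed.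

Let contR_weight x : contR weight x.
Proof. exact: derR_contR (derR_cexp _ x). Qed.

(** A priori bound: no small denominators, because the increment over one turn
    is a fixed nonzero multiple of the unknown. *)
Lemma euler_bound : exists2 K, 0 <= K & forall (r B : R) u,
  hol r u -> (forall t, vn t < r -> nc (euler s u t - a * u t) <= B) ->
  bounded_by r (K * B) u.
Proof.
exists (2 * (nc tau * wbound) / nc holonomy).
  by rewrite divr_ge0 ?nc_ge0 // mulr_ge0 // mulr_ge0 ?nc_ge0 ?expR_ge0.
move=> r B u hu uB t tr.
have h_gt0 : 0 < nc holonomy by rewrite nc_gt0 holonomy_neq0.
rewrite mulrAC ler_pdivlMr // mulrC -ncM -rotation_increment.
rewrite -[leRHS]mulr1 -[X in _ <= _ * X](subr0 1) -[2 * _ * B]mulrA.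
apply: (mvt (g := fun x => weight x * u (dilate rot x t)) (v := fun x =>
  tau * weight x * (euler s u (dilate rot x t) - a * u (dilate rot x t))) ler01) => x.
- by move=> _; exact: derR_rotation hu tr.
- by move=> _; exact: derR_contR (derR_rotation x hu tr).
- move=> /andP[x0 x1]; rewrite 2!ncM; apply: ler_pM; rewrite ?nc_ge0 ?mulr_ge0 ?nc_ge0 //.
    by rewrite ler_wpM2l ?nc_ge0 // weight_le // !ltW.
  by apply: uB; apply: le_lt_trans tr; exact: vn_dilate.
Qed.

(** The average over one turn with the weight t_s^(-a) inverts the operator,
    as integration by parts along the rotation shows. *)
Lemma euler_solution (r B : R) g : hol r g -> bounded_by r B g ->
  exists2 u, hol r u & forall t, vn t < r -> euler s u t - a * u t = g t.
Proof.
move=> hg gB; pose k x := tau / holonomy * weight x.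
have ck x : contR k x by apply: contR_mul; [exact: contR_cst|exact: contR_weight].
have kb x : 0 < x < 1 -> nc (k x) <= nc (tau / holonomy) * wbound.
  by move=> /andP[x0 x1]; rewrite /k [leLHS]ncM ler_wpM2l ?nc_ge0 // weight_le // !ltW.
exists (average k rot g); first exact: (average_hol ck contR_rot rot_le1 kb hg gB).
move=> t tr.
rewrite /euler (pder_average ck contR_rot rot_le1 kb s hg gB tr) /average.
have hp : hol r (pder s g) := pder_hol s hg gB.
have cg x : contR (fun x => k x * g (dilate rot x t)) x.
  exact: (contR_average ck contR_rot rot_le1 x hg tr).
have cp x : contR (fun x => k x * (rot s x * pder s g (dilate rot x t))) x.
  apply: contR_mul; first exact: ck.
  apply: contR_mul; first exact: contR_rot.
  apply: (contR_hol hp); first by apply: le_lt_trans tr; exact: vn_dilate.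
  by move=> p; exact: contR_dilate.
rewrite -!cint_scale ?ler01 // -cint_sub ?ler01 //; last first.
- by move=> x; apply: contR_mul; [exact: contR_cst|exact: cg].
- by move=> x; apply: contR_mul; [exact: contR_cst|exact: cp].
have E : (fun x => t 0 s * (k x * (rot s x * pder s g (dilate rot x t)))
      - a * (k x * g (dilate rot x t)))
  = (fun x => holonomy^-1 * (tau * weight x *
      (euler s g (dilate rot x t) - a * g (dilate rot x t)))).
  apply/funext => x; rewrite /euler [dilate rot x t 0 s]mxE /k.
  by move: (pder s g _) (g _) (rot s x) (weight x) => *; ring.
rewrite E (cint_FTC (G := fun x => holonomy^-1 * (weight x * g (dilate rot x t)))) ?ler01 //.
- by rewrite -mulrBr rotation_increment mulKf // holonomy_neq0.
- move=> x; rewrite -E; apply: contR_sub.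
    by apply: contR_mul; [exact: contR_cst|exact: cp].
  by apply: contR_mul; [exact: contR_cst|exact: cg].
- move=> x _; apply: derR_eq (derR_mul (derR_cst _ x) (derR_rotation x hg tr)).
  by rewrite mul0r add0r.
- move=> x _; apply: contR_mul; first exact: contR_cst.
  exact: derR_contR (derR_rotation x hg tr).
Qed.

End Rotation.

Section Radial.

(* The parameter of the ray, stopped outside [0, 1] to be defined on the line. *)
Let clamp (x : R) : C := (Num.max 0 (Num.min x 1))%:C.
Let rad (p : 'I_m) (x : R) : C := clamp x.

Let clampE x : 0 <= x <= 1 -> clamp x = x%:C.
Proof. by move=> /andP[x0 x1]; rewrite /clamp min_l // max_r. Qed.

Let clamp_le1 x : nc (clamp x) <= 1.
Proof.
rewrite nc_real ger0_norm ?le_max ?lexx // ge_max ler01 ge_min lexx orbT //.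
Qed.

Let contR_clamp x : contR clamp x.
Proof.
move=> e e_gt0; exists e => // h hd; rewrite /clamp -rmorphB nc_real; apply: le_trans hd.
have := ler_norm h; have := ler_norm (- h); rewrite normrN ler_norml => ? ?.
rewrite /Num.max /Num.min; case: (ltP (x + h) 1) => ?; case: (ltP x 1) => ?;
  do 2![case: ltP => ?]; apply/andP; split; lra.
Qed.

Let derR_clamp x : 0 < x < 1 -> derR clamp x 1.
Proof.
move=> /andP[x0 x1].
have d_gt0 : 0 < Num.min x (1 - x) by rewrite lt_min x0 subr_gt0.
apply: (fder_local (normr0 _) d_gt0) (derR_id x).
move=> h; rewrite le_min ler_norml ler_norml => hd; rewrite clampE //; lra.
Qed.

Let derR_radial (r : R) u t x : hol r u -> vn t < r -> 0 < x < 1 ->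
  derR (fun x => u (dilate rad x t)) x (\sum_p t 0 p * pder p u (dilate rad x t)).
Proof.
move=> hu tr x01; set y := dilate rad x t.
have yr : vn y < r by apply: le_lt_trans tr; apply: vn_dilate => p z; exact: clamp_le1.
have dv p : derR (fun x => dilate rad x t 0 p) x (t 0 p).
  under eq_fun do rewrite mxE.
  apply: derR_eq (derR_mul (derR_clamp x01) (derR_cst (t 0 p) x)).
  by rewrite mulr0 addr0 mul1r.
apply: derR_eq (derR_row (differentiable_derV (hu _ yr)) dv).
by apply: eq_bigr => p _; rewrite grad_coord mulrC.
Qed.

Let contR_radial (r : R) u t x : hol r u -> vn t < r -> contR (fun x => u (dilate rad x t)) x.
Proof.
move=> hu tr; apply: (contR_hol hu).
  by apply: le_lt_trans tr; apply: vn_dilate => p z; exact: clamp_le1.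
by move=> p; apply: contR_dilate => q z; exact: contR_clamp.
Qed.

Let dilate_rad_end t : dilate rad 1 t = t.
Proof.
by apply/rowP => p; rewrite mxE /rad clampE ?ler01 ?lexx // rmorph1 mul1r.
Qed.

Let dilate_rad_start t : dilate rad 0 t = 0.
Proof.
by apply/rowP => p; rewrite !mxE /rad clampE ?ler01 ?lexx // rmorph0 mul0r.
Qed.

(** Integrate along the ray from the origin, on which the radial field is
    the radial derivative times the radius. *)
Lemma radial_bound (r B : R) u (g : 'I_m -> 'rV[C]_m -> C) : 0 < r ->
  hol r u -> u 0 = 0 -> (forall p, bounded_by r B (g p)) ->
  (forall t, vn t < r -> \sum_p euler p u t = \sum_p t 0 p * g p t) ->
  bounded_by r (2 * (m%:R * (r * B))) u.
Proof.
move=> r_gt0 hu u0 gB uE t tr.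
have := @mvt _ (fun x => u (dilate rad x t))
  (fun x => \sum_p t 0 p * pder p u (dilate rad x t)) 0 1 (m%:R * (r * B)) ler01.
rewrite dilate_rad_end dilate_rad_start u0 !subr0 mulr1; apply.
- by move=> x x01; exact: derR_radial hu tr x01.
- by move=> x _; exact: contR_radial hu tr.
- move=> x /andP[x0 x1]; set y := dilate rad x t.
  have yr : vn y < r by apply: le_lt_trans tr; apply: vn_dilate => p z; exact: clamp_le1.
  have yE p : y 0 p = x%:C * t 0 p by rewrite mxE /rad clampE // !ltW.
  have xC : x%:C != 0 :> C by rewrite -nc_gt0 nc_real normr_gt0 gt_eqF.
  have -> : \sum_p t 0 p * pder p u y = \sum_p t 0 p * g p y.
    apply: (mulfI xC); rewrite !mulr_sumr.
    transitivity (\sum_p euler p u y).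
      by apply: eq_bigr => p _; rewrite /euler yE mulrA.
    by rewrite uE //; apply: eq_bigr => p _; rewrite yE mulrA.
  apply: le_trans (nc_sum _ _ _) _.
  rewrite -[m in m%:R]card_ord -sum1_card natr_sum mulr_suml; apply: ler_sum => p _.
  rewrite mul1r ncM; apply: ler_pM; rewrite ?nc_ge0 //; last exact: gB.
  by apply: ltW; apply: le_lt_trans tr; exact: nc_le_vn.
Qed.

(** Averaging over the ray inverts 1 plus the radial field, and multiplication
    by t_p shifts the radial field by 1. *)
Lemma radial_solution (r B : R) (g : 'I_m -> 'rV[C]_m -> C) :
  (forall p, hol r (g p)) -> (forall p, bounded_by r B (g p)) ->
  exists u, [/\ hol r u, u 0 = 0 &
    forall t, vn t < r -> \sum_p euler p u t = \sum_p t 0 p * g p t].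
Proof.
move=> hg gB; pose one (x : R) : C := 1.
have c1 x : contR one x by exact: contR_cst.
have k1 x : 0 < x < 1 -> nc (one x) <= 1 by rewrite nc1.
have cr p x : contR (rad p) x by exact: contR_clamp.
have r1 p x : nc (rad p x) <= 1 by exact: clamp_le1.
pose J p := average one rad (g p).
have hJ p : hol r (J p) := average_hol c1 cr r1 k1 (hg p) (gB p).
have dtJ p t : vn t < r -> differentiable (fun t => t 0 p * J p t) t.
  by move=> tr; apply: differentiable_mul; [exact: differentiable_coordinate|exact: hJ].
exists (fun t => \sum_p t 0 p * J p t); split.
- move=> t tr; apply: differentiable_bigsum => p.
  exact: dtJ.
- by rewrite big1 // => p _; rewrite mxE mul0r.
move=> t tr.
have JE q : J q t + \sum_p t 0 p * pder p (J q) t = g q t.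
  have cg x : contR (fun x => one x * g q (dilate rad x t)) x.
    exact: (contR_average c1 cr r1 x (hg q) tr).
  have cp p x : contR (fun x => t 0 p * (one x * (rad p x * pder p (g q) (dilate rad x t)))) x.
    apply: contR_mul; first exact: contR_cst.
    apply: contR_mul; first exact: c1.
    apply: contR_mul; first exact: cr.
    exact: contR_radial (pder_hol p (hg q) (gB q)) tr.
  have -> : \sum_p t 0 p * pder p (J q) t
      = cint (fun x => \sum_p t 0 p * (one x * (rad p x * pder p (g q) (dilate rad x t)))) 0 1.
    rewrite cint_sum ?ler01 //; apply: eq_bigr => p _.
    rewrite /J (pder_average c1 cr r1 k1 p (hg q) (gB q) tr) cint_scale ?ler01 //.
    move=> x; apply: contR_mul; first exact: c1.
    apply: contR_mul; first exact: cr.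
    exact: contR_radial (pder_hol p (hg q) (gB q)) tr.
  rewrite /J /average -cint_add ?ler01 //; last by move=> x; exact: contR_sum.
  rewrite (cint_FTC (G := fun x => clamp x * g q (dilate rad x t))) ?ler01 //.
  - rewrite dilate_rad_end clampE ?ler01 ?lexx // rmorph1 mul1r.
    by rewrite clampE ?ler01 ?lexx // rmorph0 mul0r subr0.
  - by move=> x; apply: contR_add; [exact: cg|exact: contR_sum].
  - move=> x x01; apply: derR_eq (derR_mul (derR_clamp x01) (derR_radial (hg q) tr x01)).
    congr (_ + _); rewrite mulr_sumr; apply: eq_bigr => p _.
    by rewrite /one mul1r mulrCA.
  - move=> x _; apply: contR_mul; first exact: contR_clamp.
    exact: contR_radial (hg q) tr.
have pE p : euler p (fun t => \sum_q t 0 q * J q t) t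
    = \sum_q ((p == q)%:R * (t 0 p * J q t) + t 0 q * (t 0 p * pder p (J q) t)).
  rewrite /euler pder_bigsum; last by move=> q; exact: dtJ.
  rewrite mulr_sumr; apply: eq_bigr => q _.
  rewrite pder_mul; [|exact: differentiable_coordinate|exact: hJ].
  by rewrite pder_coordinate; move: (pder p (J q) t) (J q t) => *; ring.
transitivity (\sum_q t 0 q * (J q t + \sum_p t 0 p * pder p (J q) t)); last first.
  by apply: eq_bigr => q _; rewrite JE.
under eq_bigr do rewrite pE.
rewrite exchange_big /=; apply: eq_bigr => q _.
rewrite big_split mulrDr mulr_sumr; congr (_ + _).
rewrite (bigD1 q) //= eqxx mul1r big1 ?addr0 // => p pq.
by rewrite (negPf pq) mul0r.
Qed.

End Radial.
End EulerOperators.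

(** * Gauge transformation of a nonresonant logarithmic connection *)

Section NormalForm.
Context {R : realType} {m n : nat}.
Local Notation C := R[i].
Local Notation fn := ('rV[C]_m -> C).
Implicit Types (t : 'rV[C]_m) (X Y : 'I_n -> 'I_n -> fn).

Variables (al : 'I_n -> 'I_m -> C) (s : 'I_n -> 'I_n -> 'I_m).
Variables (Th : 'I_n -> 'I_n -> 'I_m -> fn) (R0 M : R).

Let dal (i j : 'I_n) (p : 'I_m) : C := al i p - al j p.
(* The coefficient of Theta on dt_p / t_p. *)
Let T (i j : 'I_n) (p : 'I_m) : fn := fun t => t 0 p * Th i j p t.

Hypothesis R0_gt0 : 0 < R0.
Hypothesis M_ge0 : 0 <= M.
Hypothesis nonres : forall i j, i != j -> forall z : int, dal i j (s i j) <> z%:~R.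
Hypothesis Th_hol : forall i j p, hol R0 (Th i j p).
Hypothesis Th_le : forall i j p, bounded_by R0 M (Th i j p).
Hypothesis flatT : forall i j p q t, vn t < R0 ->
  euler p (T i j q) t - euler q (T i j p) t
    = dal i j p * T i j q t - dal i j q * T i j p t
      + \sum_l (T i l p t * T l j q t - T i l q t * T l j p t).

Lemma uniform_euler_bound : exists2 K, 0 <= K & forall i j, i != j ->
  forall (r B : R) u, 0 <= B -> hol r u ->
  (forall t, vn t < r -> nc (euler (s i j) u t - dal i j (s i j) * u t) <= B) ->
  bounded_by r (K * B) u.
Proof.
have ex (ij : 'I_n * 'I_n) : exists K, 0 <= K /\ (ij.1 != ij.2 ->
    forall (r B : R) u, 0 <= B -> hol r u ->
    (forall t, vn t < r ->
      nc (euler (s ij.1 ij.2) u t - dal ij.1 ij.2 (s ij.1 ij.2) * u t) <= B) ->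
    bounded_by r (K * B) u).
  have [e|ne] := eqVneq ij.1 ij.2; first by exists 0; split.
  have [K K0 KP] := euler_bound (s ij.1 ij.2) (nonres ne).
  by exists K; split=> // _ r B u _; exact: KP.
have [K KP] := choice ex.
exists (\sum_ij K ij); first by apply: sumr_ge0 => ij _; case: (KP ij).
move=> i j ne r B u B0 hu uB t tr.
have [_ /(_ ne r B u B0 hu uB t tr) H] := KP (i, j).
apply: le_trans H _; rewrite ler_wpM2r // (bigD1 (i, j)) //= lerDl.
by apply: sumr_ge0 => ij _; case: (KP ij).
Qed.

Definition mulTh X p i j : fn := fun t => \sum_l X i l t * Th l j p t.

Section Radius.
Variables (K r : R).
Hypothesis K_ge0 : 0 <= K.
Hypothesis KP : forall i j, i != j ->
  forall (r B : R) u, 0 <= B -> hol r u ->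
  (forall t, vn t < r -> nc (euler (s i j) u t - dal i j (s i j) * u t) <= B) ->
  bounded_by r (K * B) u.
Hypothesis r_gt0 : 0 < r.
Hypothesis r_le : r <= R0.
(* K bounds the inverses of the off-diagonal Euler operators and
   2 m (m + 1) the radial inverse as applied to the defect below; r n M bounds
   the multiplication by t_p Theta_p. *)
Hypothesis small : (K + 2 * (m%:R * (m%:R + 1))) * (r * (n%:R * M)) <= 4^-1.

Let small_K B : 0 <= B -> K * (r * (n%:R * (B * M))) <= B / 4.
Proof.
move=> B0; have sm := small; have K0 := K_ge0.
have N0 : 0 <= r * (n%:R * M) by rewrite mulr_ge0 ?mulr_ge0 ?ler0n // ltW.
have m0 : 0 <= 2 * (m%:R * (m%:R + 1)) :> R.
  by rewrite mulr_ge0 ?mulr_ge0 ?addr_ge0 ?ler0n.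
have h1 : K * (r * (n%:R * M)) <= 4^-1.
  by apply: le_trans sm; rewrite ler_wpM2r // lerDl.
have := ler_wpM2r B0 h1; lra.
Qed.

Let small_m B : 0 <= B -> 2 * (m%:R * (r * ((m%:R + 1) * (n%:R * (B * M))))) <= B / 4.
Proof.
move=> B0; have sm := small; have K0 := K_ge0.
have N0 : 0 <= r * (n%:R * M) by rewrite mulr_ge0 ?mulr_ge0 ?ler0n // ltW.
have h1 : 2 * (m%:R * (m%:R + 1)) * (r * (n%:R * M)) <= 4^-1.
  by apply: le_trans sm; rewrite ler_wpM2r // lerDr.
have := ler_wpM2r B0 h1; lra.
Qed.

Let Thr i j p : hol r (Th i j p).
Proof. exact: hol_le r_le (Th_hol i j p). Qed.

Lemma mulTh_hol X p i j : (forall i j, hol r (X i j)) -> hol r (mulTh X p i j).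
Proof.
move=> hX t tr; apply: differentiable_bigsum => l.
by apply: differentiable_mul; [exact: hX|exact: Thr].
Qed.

Lemma mulTh_le X p i j B t : 0 <= B -> vn t < r -> (forall i j, nc (X i j t) <= B) ->
  nc (mulTh X p i j t) <= n%:R * (B * M).
Proof.
move=> B0 tr XB; apply: le_trans (nc_sum _ _ _) _.
rewrite -[n in n%:R]card_ord -sum1_card natr_sum mulr_suml; apply: ler_sum => l _.
rewrite mul1r ncM; apply: ler_pM; rewrite ?nc_ge0 //.
by apply: Th_le; exact: lt_le_trans r_le.
Qed.

(** The part of the gauge equation that is solved: the component along the
    chosen nonresonant variable for the off-diagonal entries, the radial one
    for the diagonal entries. *)
Definition partial_gauge X Y :=
  [/\ forall i j t, i != j -> vn t < r ->
        euler (s i j) (Y i j) t - dal i j (s i j) * Y i j t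
          = - (t 0 (s i j) * mulTh X (s i j) i j t),
      forall i t, vn t < r ->
        \sum_p euler p (Y i i) t = \sum_p t 0 p * - mulTh X p i i t
    & forall i, Y i i 0 = 1].

Lemma partial_gauge_exists X B : (forall i j, hol r (X i j)) ->
  (forall i j, bounded_by r B (X i j)) ->
  exists Y, (forall i j, hol r (Y i j)) /\ partial_gauge X Y.
Proof.
move=> hX XB; pose B' := Num.max B 0.
have B'0 : 0 <= B' by rewrite le_max lexx orbT.
have XB' i j t : vn t < r -> nc (X i j t) <= B'.
  by move=> tr; apply: le_trans (XB i j t tr) _; rewrite le_max lexx.
have gh p i j : hol r (fun t => - mulTh X p i j t).
  by move=> t tr; apply: differentiable_opp; exact: mulTh_hol.
have gB p i j : bounded_by r (n%:R * (B' * M)) (fun t => - mulTh X p i j t).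
  by move=> t tr; rewrite ncN; apply: mulTh_le => // *; exact: XB'.
have ex (ij : 'I_n * 'I_n) : exists u, hol r u /\
  if ij.1 == ij.2 then
    u 0 = 1 /\ forall t, vn t < r ->
      \sum_p euler p u t = \sum_p t 0 p * - mulTh X p ij.1 ij.2 t
  else forall t, vn t < r ->
    euler (s ij.1 ij.2) u t - dal ij.1 ij.2 (s ij.1 ij.2) * u t
      = - (t 0 (s ij.1 ij.2) * mulTh X (s ij.1 ij.2) ij.1 ij.2 t).
  case: ij => i j /=; have [e|ne] := eqVneq i j.
    have [u [hu u0 uE]] := radial_solution (fun p => gh p i j) (fun p => gB p i j).
    exists (fun t => u t + 1); split; [|split].
    - by move=> t tr; apply: differentiable_add; [exact: hu|exact: differentiable_const].
    - by rewrite u0 add0r.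
    - move=> t tr; rewrite -uE //; apply: eq_bigr => p _.
      rewrite euler_add; [|exact: hu|exact: differentiable_const].
      by rewrite euler_const addr0.
  pose g t := - (t 0 (s i j) * mulTh X (s i j) i j t).
  have hg : hol r g.
    move=> t tr; apply: differentiable_opp; apply: differentiable_mul.
      exact: differentiable_coordinate.
    exact: mulTh_hol.
  have gb : bounded_by r (r * (n%:R * (B' * M))) g.
    move=> t tr; rewrite ncN ncM; apply: ler_pM; rewrite ?nc_ge0 //.
      by apply: ltW; apply: le_lt_trans tr; exact: nc_le_vn.
    by apply: mulTh_le => // *; exact: XB'.
  by have [u hu uE] := euler_solution (s i j) (nonres ne) hg gb; exists u.
have [Y YP] := choice ex.
exists (fun i j => Y (i, j)); split; first by move=> i j; case: (YP (i, j)).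
split.
- by move=> i j t /negPf ne tr; have [_ /=] := YP (i, j); rewrite ne; apply.
- by move=> i t tr; have [_ /=] := YP (i, i); rewrite eqxx => -[_]; apply.
- by move=> i; have [_ /=] := YP (i, i); rewrite eqxx => -[].
Qed.

Lemma mulTh_sub X X' p i j t :
  mulTh X p i j t - mulTh X' p i j t = mulTh (fun i j t => X i j t - X' i j t) p i j t.
Proof. by rewrite /mulTh -sumrB; apply: eq_bigr => l _; rewrite mulrBl. Qed.

(** The right sides carry a factor t_p, so on a small polydisc they are small
    against the datum, while the inverses are bounded independently of the
    radius. *)
Lemma partial_gauge_contract X X' Y Y' B : 0 <= B ->
  (forall i j, hol r (Y i j)) -> (forall i j, hol r (Y' i j)) ->
  partial_gauge X Y -> partial_gauge X' Y' ->
  (forall i j t, vn t < r -> nc (X i j t - X' i j t) <= B) ->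
  forall i j t, vn t < r -> nc (Y i j t - Y' i j t) <= B / 4.
Proof.
move=> B0 hY hY' [Yo Yd Y0] [Yo' Yd' Y0'] XX i j.
pose V i j t := Y i j t - Y' i j t.
have hV k l : hol r (V k l).
  by move=> t tr; apply: differentiable_sub; [exact: hY|exact: hY'].
have VE k l p t : vn t < r -> euler p (V k l) t = euler p (Y k l) t - euler p (Y' k l) t.
  by move=> tr; rewrite euler_sub //; [exact: hY|exact: hY'].
have dX p k l t : vn t < r -> nc (mulTh X p k l t - mulTh X' p k l t) <= n%:R * (B * M).
  by move=> tr; rewrite mulTh_sub; apply: mulTh_le => // *; exact: XX.
have [e|ne] := eqVneq i j.
  rewrite -{j}e => t tr; apply: le_trans (small_m B0).
  have NB0 : 0 <= n%:R * (B * M) by rewrite mulr_ge0 ?ler0n // mulr_ge0.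
  apply: (@le_trans _ _ (2 * (m%:R * (r * (n%:R * (B * M)))))); last first.
    rewrite ler_pM2l // ler_wpM2l ?ler0n // ler_pM2l // ler_peMl //.
    by rewrite lerDr ler0n.
  apply: (radial_bound (u := V i i)
    (g := fun p t => - (mulTh X p i i t - mulTh X' p i i t)) r_gt0 (hV i i)) tr.
  - by rewrite /V Y0 Y0' subrr.
  - by move=> p x xr; rewrite ncN dX.
  - move=> x xr; under eq_bigr do rewrite VE //.
    rewrite sumrB Yd // Yd' // -sumrB; apply: eq_bigr => p _.
    by move: (mulTh X p i i x) (mulTh X' p i i x) => *; ring.
move=> t tr; apply: le_trans (small_K B0).
have NB0 : 0 <= r * (n%:R * (B * M)).
  by rewrite mulr_ge0 ?(ltW r_gt0) // mulr_ge0 ?ler0n // mulr_ge0.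
apply: (KP ne NB0 (hV i j)) tr => x xr; rewrite VE //.
have -> : euler (s i j) (Y i j) x - euler (s i j) (Y' i j) x - dal i j (s i j) * V i j x
  = (euler (s i j) (Y i j) x - dal i j (s i j) * Y i j x)
    - (euler (s i j) (Y' i j) x - dal i j (s i j) * Y' i j x).
  by rewrite /V; move: (euler _ (Y i j) x) (euler _ (Y' i j) x) => *; ring.
rewrite Yo // Yo' // -opprD ncN -mulrBr ncM; apply: ler_pM; rewrite ?nc_ge0 ?dX //.
by apply: ltW; apply: le_lt_trans xr; exact: nc_le_vn.
Qed.

Lemma partial_gauge_id : partial_gauge (fun _ _ _ => 0) (fun i j _ => (i == j)%:R).
Proof.
have mul0 p i j t : mulTh (fun _ _ _ => 0) p i j t = 0.
  by rewrite /mulTh big1 // => l _; rewrite mul0r.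
split.
- by move=> i j t ne tr; rewrite euler_const (negPf ne) mul0 !mulr0 subrr oppr0.
- move=> i t tr; rewrite !big1 // => p _; first by rewrite mul0 oppr0 mulr0.
  exact: euler_const.
- by move=> i; rewrite eqxx.
Qed.

(** Picard iteration from the identity. The limit need not be differentiated:
    the solution with the limit as datum is, by contraction, the limit of the
    iterates itself. *)
Lemma partial_gauge_fixpoint : exists Y B,
  [/\ forall i j, hol r (Y i j), forall i j, bounded_by r B (Y i j)
    & partial_gauge Y Y].
Proof.
have nc_delta (i j : 'I_n) : nc ((i == j)%:R : C) <= 1.
  by case: eqP => _; rewrite ?nc1 // nc0.
have h_delta (i j : 'I_n) : hol r (fun _ : 'rV[C]_m => (i == j)%:R : C).
  by move=> t _; exact: differentiable_const.
have stay X Y : (forall i j, bounded_by r 2 (X i j)) -> (forall i j, hol r (Y i j)) ->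
    partial_gauge X Y -> forall i j t, vn t < r -> nc (Y i j t - (i == j)%:R) <= 2 / 4.
  move=> XB hY XY; apply: (partial_gauge_contract _ hY h_delta XY partial_gauge_id) => //.
  by move=> i j t tr; rewrite subr0; exact: XB.
have stay2 X Y : (forall i j, bounded_by r 2 (X i j)) -> (forall i j, hol r (Y i j)) ->
    partial_gauge X Y -> forall i j, bounded_by r 2 (Y i j).
  move=> XB hY XY i j t tr; have := stay X Y XB hY XY i j t tr; have := nc_delta i j.
  have := ncD (Y i j t - (i == j)%:R) (i == j)%:R; rewrite subrK; lra.
pose St := {X : 'I_n -> 'I_n -> fn |
  (forall i j, hol r (X i j)) /\ (forall i j, bounded_by r 2 (X i j))}.
have step (X : St) : exists Y : St, partial_gauge (sval X) (sval Y).
  case: X => X [hX XB]; have [Y [hY XY]] := partial_gauge_exists hX XB.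
  by exists (exist _ Y (conj hY (stay2 X Y XB hY XY))).
have [F FP] := choice step.
have delta2 (i j : 'I_n) : bounded_by r 2 (fun _ : 'rV[C]_m => (i == j)%:R : C).
  by move=> t _ /=; have := nc_delta i j; lra.
pose H0 : St := exist _ (fun (i j : 'I_n) (t : 'rV[C]_m) => (i == j)%:R : C) (conj h_delta delta2).
pose H N := sval (iter N F H0).
have HS N : partial_gauge (H N) (H N.+1) by exact: FP.
have hH N i j : hol r (H N i j) by rewrite /H; case: (iter N F H0) => X [].
have HB N i j : bounded_by r 2 (H N i j) by rewrite /H; case: (iter N F H0) => X [].
have H1 N i j t : vn t < r -> nc (H N.+1 i j t - H N i j t) <= 1 / 2 ^+ N.
  elim: N i j t => [|N IH] i j t tr.
    have := stay _ _ (HB 0%N) (hH 1%N) (HS 0%N) i j t tr.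
    by rewrite expr0 divr1 => /le_trans; apply; lra.
  have p0 : 0 <= 1 / (2 : R) ^+ N by rewrite divr_ge0 ?exprn_ge0.
  have c : nc (H N.+2 i j t - H N.+1 i j t) <= 1 / 2 ^+ N / 4.
    exact: (partial_gauge_contract p0 (hH N.+2) (hH N.+1) (HS N.+1) (HS N) IH).
  rewrite exprS invfM; lra.
have HN i j t N k : vn t < r -> nc (H (N + k)%N i j t - H N i j t) <= 2 / 2 ^+ N.
  move=> tr; have p2 q : 0 < (2 : R) ^- q by rewrite invr_gt0 exprn_gt0.
  suff : nc (H (N + k)%N i j t - H N i j t) <= 2 / 2 ^+ N - 2 / 2 ^+ (N + k).
    have := p2 (N + k)%N; lra.
  elim: k => [|k IH]; first by rewrite addn0 !subrr nc0.
  rewrite addnS -(subrKA (H (N + k)%N i j t)).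
  apply: le_trans (ncD _ _) _; have := H1 (N + k)%N i j t tr.
  rewrite exprS invfM; move: IH; lra.
have [h hP] : exists h, forall i j t, vn t < r -> forall N,
    nc (H N i j t - h i j t) <= 4 / 2 ^+ N.
  have lim (x : 'I_n * 'I_n * 'rV[C]_m) : exists l, vn x.2 < r ->
      forall N, nc (H N x.1.1 x.1.2 x.2 - l) <= 4 / 2 ^+ N.
    case: x => [[i j] t] /=; have [tr|_] := ltP (vn t) r; last by exists 0.
    have [l lP] := cauchy_geometric (fun N k => HN i j t N k tr).
    by exists l => _ N; have := lP N; lra.
  have [l lP] := choice lim; exists (fun i j t => l ((i, j), t)) => i j t tr.
  exact: (lP ((i, j), t)).
have hh i j : hol r (h i j).
  move=> t tr; have rho_gt0 : 0 < r - vn t by rewrite subr_gt0.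
  case: (@differentiable_uniform_limit _ _ (fun N => H N i j) (h i j) t (r - vn t) 2 4 rho_gt0) => //.
  - by move=> N x /polydisc_shift xr; exact: hH.
  - by move=> N x /polydisc_shift xr; exact: HB.
  - by move=> N x /polydisc_shift xr; exact: hP.
have hB i j : bounded_by r 6 (h i j).
  move=> t tr; have := hP i j t tr 0%N; have := HB 0%N i j t tr.
  have := ncB (H 0%N i j t) (H 0%N i j t - h i j t).
  rewrite opprB addrC subrK expr0; lra.
have [Y [hY hYg]] := partial_gauge_exists hh hB.
have Yh i j t : vn t < r -> Y i j t = h i j t.
  move=> tr; apply/eqP; rewrite -subr_eq0; apply/eqP/Normc.eq0_normc/eqP.
  rewrite eq_le nc_ge0 andbT; apply: (@le_geometric _ _ _ 3) => N.
  have p4 : 0 <= 4 / (2 : R) ^+ N by rewrite divr_ge0 ?exprn_ge0.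
  have c : nc (H N.+1 i j t - Y i j t) <= 4 / 2 ^+ N / 4.
    have XX k l x : vn x < r -> nc (H N k l x - h k l x) <= 4 / 2 ^+ N.
      by move=> xr; exact: hP.
    exact: (partial_gauge_contract p4 (hH N.+1) hY (HS N) hYg XX).
  have := hP i j t tr N.+1; rewrite exprS invfM.
  have := ncB (H N.+1 i j t - h i j t) (H N.+1 i j t - Y i j t).
  rewrite opprB addrC subrKA; lra.
exists Y, 6; split=> // [i j t tr|]; first by rewrite Yh // hB.
have mulE p i j t : vn t < r -> mulTh h p i j t = mulTh Y p i j t.
  by move=> tr; apply: eq_bigr => l _; rewrite Yh.
case: hYg => Yo Yd Y0; split=> // [i j t ne tr|i t tr].
- by rewrite Yo // mulE.
- by rewrite Yd //; apply: eq_bigr => p _; rewrite mulE.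
Qed.

(** t_p times the dt_p component of dY - [Omega_0, Y] + Y Theta, which vanishes
    for a gauge transformation to Omega_0. *)
Definition gauge_defect Y p i j : fn := fun t =>
  euler p (Y i j) t - dal i j p * Y i j t + \sum_l Y i l t * T l j p t.

Section Defect.
Variables (Y : 'I_n -> 'I_n -> fn) (B : R).
Hypothesis hY : forall i j, hol r (Y i j).
Hypothesis YB : forall i j, bounded_by r B (Y i j).

Local Notation Psi := (gauge_defect Y).

Let T_hol i j p : hol r (T i j p).
Proof.
move=> t tr; apply: differentiable_mul; first exact: differentiable_coordinate.
exact: Thr.
Qed.

Let sum_hol i j p : hol r (fun t => \sum_l Y i l t * T l j p t).
Proof.
move=> t tr; apply: differentiable_bigsum => l.
by apply: differentiable_mul; [exact: hY|exact: T_hol].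
Qed.

Let eY_hol i j p : hol r (euler p (Y i j)).
Proof. exact: euler_hol (hY i j) (YB i j). Qed.

Lemma defect_hol p i j : hol r (Psi p i j).
Proof.
move=> t tr; apply: differentiable_add; last exact: sum_hol.
apply: differentiable_sub; first exact: eY_hol.
by apply: differentiable_mul; [exact: differentiable_const|exact: hY].
Qed.

Lemma euler_defect p q i j t : vn t < r ->
  euler q (Psi p i j) t = euler q (euler p (Y i j)) t - dal i j p * euler q (Y i j) t
    + \sum_l (euler q (Y i l) t * T l j p t + Y i l t * euler q (T l j p) t).
Proof.
move=> tr; rewrite euler_add; [|apply: differentiable_sub|exact: sum_hol].
- rewrite euler_sub; [|exact: eY_hol|].
    rewrite euler_mul; [|exact: differentiable_const|exact: hY].
    rewrite euler_const mul0r add0r; congr (_ + _).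
    rewrite euler_bigsum; last first.
      by move=> l; apply: differentiable_mul; [exact: hY|exact: T_hol].
    apply: eq_bigr => l _.
    by rewrite euler_mul; [|exact: hY|exact: T_hol].
  by apply: differentiable_mul; [exact: differentiable_const|exact: hY].
- exact: eY_hol.
- by apply: differentiable_mul; [exact: differentiable_const|exact: hY].
Qed.

(** The defect is the covariant differential of Y for the connection induced
    on Hom by Omega_0 and Omega; both are flat, so its own covariant
    differential is zero. *)
Lemma defect_closed p q i j t : vn t < r ->
  euler q (Psi p i j) t - dal i j q * Psi p i j t
    = euler p (Psi q i j) t - dal i j p * Psi q i j t
      + \sum_l (Psi q i l t * T l j p t - Psi p i l t * T l j q t).
Proof.
move=> tr; rewrite !euler_defect // (euler_comm p q (hY i j) (YB i j) tr).
pose E c l := euler c (Y i l) t.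
have flat l : euler q (T l j p) t = euler p (T l j q) t
    - (dal l j p * T l j q t - dal l j q * T l j p t
      + \sum_k (T l k p t * T k j q t - T l k q t * T k j p t)).
  by rewrite -flatT; [rewrite opprB addrC subrK|exact: lt_le_trans r_le].
pose y l := Y i l t; pose a l := T l j p t; pose b l := T l j q t.
pose S := \sum_l \sum_k y k * (T k l q t * a l - T k l p t * b l).
have dbl : \sum_l y l * (\sum_k (T l k p t * T k j q t - T l k q t * T k j p t)) = - S.
  rewrite /S exchange_big -sumrN /=; apply: eq_bigr => l _.
  rewrite mulr_sumr -sumrN; apply: eq_bigr => k _.
  by rewrite /a /b; ring.
have PsiE c d l : Psi c i l t * d l = E c l * d l - dal i l c * y l * d l
    + \sum_k y k * T k l c t * d l.
  by rewrite /gauge_defect mulrDl mulrBl mulr_suml.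
pose L1 := \sum_l (E q l * a l + y l * euler p (T l j q) t
  - dal l j p * (y l * b l) + dal l j q * (y l * a l)).
pose L2 := \sum_l (E q l * a l - dal i l q * y l * a l - E p l * b l
  + dal i l p * y l * b l).
pose L3 := \sum_l (E p l * b l + y l * euler p (T l j q) t).
pose ya := \sum_l y l * a l; pose yb := \sum_l y l * b l.
have lhs : \sum_l (E q l * a l + y l * euler q (T l j p) t) = L1 + S.
  rewrite -[S]opprK -dbl -sumrN -big_split; apply: eq_bigr => l _ /=.
  rewrite flat -/(a l) -/(b l).
  move: (\sum_k (_ - _)) (euler p _ t) (E q l) (dal l j p) (dal l j q) (y l) (a l) (b l).
  by move=> *; ring.
have rhs : \sum_l (Psi q i l t * a l - Psi p i l t * b l) = L2 + S.
  rewrite /S -big_split; apply: eq_bigr => l _ /=.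
  rewrite !PsiE.
  have -> : \sum_k y k * (T k l q t * a l - T k l p t * b l)
      = \sum_k y k * T k l q t * a l - \sum_k y k * T k l p t * b l.
    by rewrite -sumrB; apply: eq_bigr => k _; rewrite mulrBr !mulrA.
  move: (\sum_k y k * _ * a l) (\sum_k y k * _ * b l) (E q l) (E p l) => *; ring.
have key : L1 = L3 - dal i j p * yb + L2 + dal i j q * ya.
  rewrite /L1 /L3 /L2 /ya /yb !mulr_sumr -sumrB -!big_split; apply: eq_bigr => l _ /=.
  rewrite /dal; move: (euler p _ t) (E q l) (E p l) => *; ring.
rewrite [X in _ - _ + X - _]lhs [X in _ = _ + X]rhs /gauge_defect.
rewrite -/L3 -/(E p j) -/(E q j) -/ya -/yb -/(y j) key.
clearbody L1 L2 L3 ya yb S.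
move: (euler p (euler q (Y i j)) t) (E q j) (E p j) (y j) => *; ring.
Qed.

End Defect.

Section Vanishing.
Variables (Y : 'I_n -> 'I_n -> fn) (B : R).
Hypothesis hY : forall i j, hol r (Y i j).
Hypothesis YB : forall i j, bounded_by r B (Y i j).
Hypothesis Yg : partial_gauge Y Y.

Local Notation Psi := (gauge_defect Y).

Let sum_T i j p t : \sum_l Y i l t * T l j p t = t 0 p * mulTh Y p i j t.
Proof. by rewrite /mulTh mulr_sumr; apply: eq_bigr => l _; rewrite mulrCA. Qed.

Let defect_chosen i j t : i != j -> vn t < r -> Psi (s i j) i j t = 0.
Proof.
by case: Yg => Yo _ _ ne tr; rewrite /gauge_defect sum_T Yo // addNr.
Qed.

Let defect_radial i t : vn t < r -> \sum_q Psi q i i t = 0.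
Proof.
case: Yg => _ Yd _ tr; rewrite /gauge_defect big_split sumrB /= Yd //.
rewrite [X in _ - X]big1 => [|q _]; last by rewrite /dal subrr mul0r.
by rewrite subr0 -big_split big1 //= => q _; rewrite sum_T mulrN addNr.
Qed.

Let r2 : R := r / 2.

Let r2_gt0 : 0 < r2. Proof. by rewrite divr_gt0. Qed.

Let r2_le : r2 <= r.
Proof. by have r0 := r_gt0; rewrite /r2; lra. Qed.

Let T_le i j p t : vn t < r -> nc (T i j p t) <= r * M.
Proof.
move=> tr; rewrite ncM; apply: ler_pM; rewrite ?nc_ge0 //.
  by apply: ltW; apply: le_lt_trans tr; exact: nc_le_vn.
by apply: Th_le; exact: lt_le_trans r_le.
Qed.

(** The Cauchy estimate for the derivative needs room up to the boundary,
    whence half the radius. *)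
Lemma defect_bounded : exists2 B0, 0 <= B0 & forall p i j, bounded_by r2 B0 (Psi p i j).
Proof.
pose B' := Num.max B 0.
have B'0 : 0 <= B' by rewrite le_max lexx orbT.
have YB' i j : bounded_by r B' (Y i j).
  by move=> t tr; apply: le_trans (YB i j tr) _; rewrite le_max lexx.
pose A : R := \sum_(x : 'I_n * 'I_n * 'I_m) nc (dal x.1.1 x.1.2 x.2).
have A0 : 0 <= A by apply: sumr_ge0 => x _; exact: nc_ge0.
have dA i j p : nc (dal i j p) <= A.
  by rewrite /A (bigD1 (i, j, p)) //= lerDl; apply: sumr_ge0 => x _; exact: nc_ge0.
have rM0 : 0 <= r * M by rewrite mulr_ge0 // ltW.
exists (r * (16 * B' / r2) + A * B' + n%:R * (B' * (r * M))).
  have p1 : 0 <= r * (16 * B' / r2).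
    by apply: mulr_ge0; [exact: ltW|apply: divr_ge0; [exact: mulr_ge0|exact: ltW]].
  have p2 : 0 <= A * B' by exact: mulr_ge0.
  have p3 : 0 <= n%:R * (B' * (r * M)) by apply: mulr_ge0; [exact: ler0n|exact: mulr_ge0].
  exact: addr_ge0 (addr_ge0 p1 p2) p3.
move=> p i j t tr2; have tr : vn t < r by exact: lt_le_trans r2_le.
apply: le_trans (ncD _ _) _; apply: lerD.
  apply: le_trans (ncB _ _) _; apply: lerD; rewrite ncM; apply: ler_pM;
    rewrite ?nc_ge0 ?dA //; last exact: YB'.
    by apply: ltW; apply: le_lt_trans tr; exact: nc_le_vn.
  apply: le_trans (pder_bound p (hY i j) (YB' i j) tr) _.
  apply: ler_wpM2l; first exact: mulr_ge0.
  have d0 : r2 <= r - vn t by move: tr2; rewrite /r2; lra.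
  by rewrite lef_pV2 // posrE // (lt_le_trans r2_gt0).
apply: le_trans (nc_sum _ _ _) _.
rewrite -[n in n%:R]card_ord -sum1_card natr_sum mulr_suml; apply: ler_sum => l _.
by rewrite mul1r ncM; apply: ler_pM; rewrite ?nc_ge0 ?T_le //; exact: YB'.
Qed.

(** The components of the defect that were solved for are zero, so closedness
    becomes an Euler equation for the others, whose right side is again small
    against the defect. *)
Lemma defect_halved B' : 0 <= B' -> (forall p i j, bounded_by r2 B' (Psi p i j)) ->
  forall p i j, bounded_by r2 (B' / 2) (Psi p i j).
Proof.
move=> B'0 PB p i j.
have hPsi q k l : hol r2 (Psi q k l) := hol_le r2_le (defect_hol hY YB q k l).
have [e|ne] := eqVneq i j.
  rewrite -{j}e => t tr2; have BM0 : 0 <= B' * M by exact: mulr_ge0.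
  have nBM0 : 0 <= n%:R * (B' * M) by rewrite mulr_ge0 ?ler0n.
  apply: (@le_trans _ _ (B' / 4)); last by lra.
  apply: le_trans (small_m B'0).
  apply: (@le_trans _ _ (2 * (m%:R * (r2 * ((m%:R + 1) * (n%:R * (B' * M))))))); last first.
    rewrite ler_pM2l // ler_wpM2l ?ler0n // ler_wpM2r // mulr_ge0 // addr_ge0 ?ler0n //.
  pose g x t := (if x == p then \sum_q \sum_l Psi q i l t * Th l i p t else 0)
    - \sum_l Psi p i l t * Th l i x t.
  have inner q x y : vn y < r2 -> nc (\sum_l Psi q i l y * Th l i x y) <= n%:R * (B' * M).
    move=> yr; apply: le_trans (nc_sum _ _ _) _.
    rewrite -[n in n%:R]card_ord -sum1_card natr_sum mulr_suml; apply: ler_sum => l _.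
    rewrite mul1r ncM; apply: ler_pM; rewrite ?nc_ge0 //; first exact: PB.
    by apply: Th_le; apply: lt_le_trans yr _; exact: le_trans r2_le r_le.
  apply: (radial_bound (g := g) r2_gt0 (hPsi p i i)) tr2.
  - rewrite /gauge_defect /euler /dal subrr mul0r subr0 mxE mul0r add0r big1 // => l _.
    by rewrite /T mxE mul0r mulr0.
  - move=> x y yr; apply: le_trans (ncB _ _) _; rewrite mulrDl mul1r; apply: lerD.
      case: eqP => _; last by rewrite nc0 mulr_ge0 ?ler0n.
      apply: le_trans (nc_sum _ _ _) _.
      rewrite -[m in m%:R]card_ord -sum1_card natr_sum mulr_suml; apply: ler_sum => q _.
      by rewrite mul1r inner.
    exact: inner.
  move=> y yr2; have yr : vn y < r by exact: lt_le_trans r2_le.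
  have closed q : euler q (Psi p i i) y = euler p (Psi q i i) y
      + \sum_l (Psi q i l y * T l i p y - Psi p i l y * T l i q y).
    have := defect_closed hY YB p q i i yr.
    by rewrite /dal !subrr !mul0r !subr0.
  under eq_bigr do rewrite closed.
  rewrite big_split -euler_bigsum /=; last by move=> q; exact: (defect_hol hY YB q i i).
  rewrite {1}/euler (pder_zero (r' := r)) //; last by move=> x; exact: defect_radial.
  rewrite mulr0 add0r.
  under [RHS]eq_bigr do rewrite mulrBr.
  rewrite [RHS]sumrB [X in _ = X - _](bigD1 p) //= eqxx.
  rewrite [X in _ + X - _]big1 ?addr0 => [|q /negPf ->]; last by rewrite mulr0.
  rewrite mulr_sumr -sumrB; apply: eq_bigr => q _.
  rewrite !mulr_sumr -sumrB; apply: eq_bigr => l _.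
  by rewrite /T; ring.
have B2 : 0 <= 2 * B' by rewrite mulr_ge0.
have Bq0 : 0 <= r * (n%:R * (2 * B' * M)).
  by rewrite mulr_ge0 ?(ltW r_gt0) // mulr_ge0 ?ler0n // mulr_ge0.
have := KP ne Bq0 (hPsi p i j); move=> bound t tr2.
apply: le_trans (bound _ t tr2) _; last first.
  by apply: le_trans (small_K B2) _; lra.
move=> y yr2; have yr : vn y < r by exact: lt_le_trans r2_le.
rewrite (defect_closed hY YB p (s i j) i j yr).
rewrite {1}/euler (pder_zero (r' := r)) //; last by move=> x; exact: defect_chosen.
rewrite defect_chosen // !mulr0 subrr add0r.
apply: le_trans (nc_sum _ _ _) _.
rewrite -[n in n%:R]card_ord -sum1_card natr_sum mulr_suml mulr_sumr; apply: ler_sum => l _.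
apply: le_trans (ncB _ _) _.
rewrite (ncM _ (T l j p y)) (ncM _ (T l j (s i j) y)) mul1r.
have c1 := PB (s i j) i l y yr2; have c2 := PB p i l y yr2.
have c3 := T_le l j p yr; have c4 := T_le l j (s i j) yr.
have e1 := ler_pM (nc_ge0 _) (nc_ge0 _) c1 c3.
have e2 := ler_pM (nc_ge0 _) (nc_ge0 _) c2 c4.
lra.
Qed.

Lemma defect_zero p i j t : vn t < r2 -> Psi p i j t = 0.
Proof.
move=> tr; have [B0 B00 PB] := defect_bounded.
apply/Normc.eq0_normc/eqP; rewrite eq_le nc_ge0 andbT.
apply: (@le_geometric _ _ _ B0) => N; rewrite add0r.
elim: N p i j t tr => [|N IH] p i j t tr; first by rewrite expr0 divr1; exact: PB.
have p0 : 0 <= B0 / (2 : R) ^+ N by rewrite divr_ge0 ?exprn_ge0.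
have := defect_halved p0 IH p i j tr.
by rewrite exprS invfM; lra.
Qed.

End Vanishing.

End Radius.

(** Near the origin, a flat logarithmic connection whose residues are diagonal
    and nonresonant is gauge equivalent to its diagonal part. *)
Lemma nonresonant_gauge : exists2 r, 0 < r <= R0 & exists Y : 'I_n -> 'I_n -> fn,
  [/\ forall i j, hol r (Y i j), exists B, forall i j, bounded_by r B (Y i j),
    forall i j, Y i j 0 = (i == j)%:R
    & forall p i j t, vn t < r ->
        euler p (Y i j) t = dal i j p * Y i j t - \sum_l Y i l t * T l j p t].
Proof.
have [K K0 KP] := uniform_euler_bound.
pose k : R := K + 2 * (m%:R * (m%:R + 1)); pose N : R := n%:R * M.
have k0 : 0 <= k by rewrite addr_ge0 // mulr_ge0 // mulr_ge0 ?addr_ge0 ?ler0n.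
have N0 : 0 <= N by rewrite mulr_ge0 ?ler0n.
have kN0 : 0 <= k * N by exact: mulr_ge0.
(* The contraction constant k r N is then at most 1/4. *)
pose r := Num.min R0 (4 * (k * N + 1))^-1.
have r_gt0 : 0 < r by rewrite lt_min R0_gt0 invr_gt0 mulr_gt0 // ltr_wpDl.
have r_le : r <= R0 by rewrite ge_min lexx.
have small : k * (r * N) <= 4^-1.
  have c : r <= (4 * (k * N + 1))^-1 by rewrite ge_min lexx orbT.
  have d : 0 < k * N + 1 by rewrite ltr_wpDl.
  have := ler_wpM2l kN0 c; rewrite invfM.
  have : k * N * (4^-1 * (k * N + 1)^-1) <= 4^-1.
    by rewrite mulrCA ler_piMr // ler_pdivrMr // mul1r lerDl.
  lra.
have [Y [B [hY YB Yg]]] := partial_gauge_fixpoint K0 KP r_gt0 r_le small.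
exists (r / 2); first by rewrite divr_gt0 //=; lra.
exists Y; split.
- by move=> i j; apply: hol_le (hY i j); lra.
- by exists B => i j; apply: bounded_le (YB i j); lra.
- case: Yg => Yo _ Y0 i j; have [<-|ne] := eqVneq i j; first exact: Y0.
  have := Yo i j 0 ne; rewrite vn0 => /(_ r_gt0).
  rewrite /euler mxE !mul0r sub0r => /eqP; rewrite eqr_opp mulf_eq0.
  by case/orP => /eqP // d0; case: (nonres ne (z := 0)).
- move=> p i j t tr.
  have := defect_zero K0 KP r_gt0 r_le small hY YB Yg p i j tr.
  rewrite /gauge_defect => /eqP; rewrite addr_eq0 subr_eq => /eqP ->.
  by rewrite addrC.
Qed.

End NormalForm.

(** * Matrices of holomorphic functions *)

Section Matrices.
Context {R : realType} {m n : nat}.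
Local Notation C := R[i].
Implicit Types (t : 'rV[C]_m).

Lemma differentiable_matrix (Y : 'I_n -> 'I_n -> 'rV[C]_m -> C) t :
  (forall i j, differentiable (Y i j) t) ->
  differentiable (fun t => \matrix_(i, j) Y i j t : 'M[C]_n) t.
Proof.
move=> dY.
have -> : (fun t => \matrix_(i, j) Y i j t : 'M[C]_n)
    = \sum_(i < n) \sum_(j < n) (fun t => Y i j t *: delta_mx i j).
  apply/funext => x; rewrite [LHS]matrix_sum_delta fct_sumE.
  apply: eq_bigr => i _; rewrite fct_sumE; apply: eq_bigr => j _.
  by rewrite mxE.
apply: differentiable_sum => i; apply: differentiable_sum => j.
exact: differentiableZl.
Qed.

Lemma partial_entry p (H : 'rV[C]_m -> 'M[C]_n) t i j : differentiable H t ->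
  partial p H t i j = pder p (fun x => H x i j) t.
Proof.
move=> dH; rewrite pder.unlock /partial.
have dv : derivable H t (delta_mx 0 p) by exact: diff_derivable.
apply/esym/cvg_lim => //.
have := cvg_comp _ (fun N : 'M[C]_n => N i j) dv (@coord_continuous _ n n i j _).
by apply: cvg_trans; apply: near_eq_cvg; near=> h; rewrite /= !mxE.
Unshelve. all: by end_near. Qed.

Lemma differentiable_bigprod (I : Type) (e : seq I) (f : I -> 'rV[C]_m -> C) t :
  (forall i, differentiable (f i) t) ->
  differentiable (fun x => \prod_(i <- e) f i x) t.
Proof.
move=> df; elim: e => [|i e IH].
  by under eq_fun do rewrite big_nil; exact: differentiable_const.
under eq_fun do rewrite big_cons.
exact: differentiable_mul (df i) IH.
Qed.

Lemma differentiable_det (Y : 'I_n -> 'I_n -> 'rV[C]_m -> C) t :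
  (forall i j, differentiable (Y i j) t) ->
  differentiable (fun x => \det (\matrix_(i, j) Y i j x)) t.
Proof.
move=> dY.
have -> : (fun x => \det (\matrix_(i, j) Y i j x))
    = (fun x => \sum_(w : 'S_n) (-1) ^+ w * \prod_i Y i (w i) x).
  apply/funext => x; apply: eq_bigr => w _; congr (_ * _).
  by apply: eq_bigr => i _; rewrite mxE.
apply: differentiable_bigsum => w; apply: differentiable_mul.
  exact: differentiable_const.
exact: differentiable_bigprod.
Qed.

End Matrices.

(** * Neighbourhoods of the origin *)

Section Neighbourhoods.
Context {R : realType} {m : nat}.
Local Notation C := R[i].
Implicit Types (t h : 'rV[C]_m) (f g : 'rV[C]_m -> C).

Lemma polydisc_open_nbhs (r : R) : 0 < r ->
  open_nbhs (0 : 'rV[C]_m) [set t : 'rV[C]_m | vn t < r].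
Proof.
move=> r_gt0; split; last by rewrite /= vn0.
rewrite openE => t /= tr; apply/nbhs_ballP; exists (r - vn t)%:C => /=.
  by rewrite ltcR subr_gt0.
move=> y; rewrite -ball_normE /= norm_vn ltcR => yt.
by rewrite -[y](subKr t); apply: le_lt_trans (vnD _ _) _; rewrite vnN; lra.
Qed.

(** A holomorphic function that vanishes off the coordinate hyperplanes
    vanishes: the diagonal direction leaves all of them at once. *)
Lemma hol_eq0_dense (r : R) f : hol r f ->
  (forall t, vn t < r -> (forall p, t 0 p != 0) -> f t = 0) ->
  forall t, vn t < r -> f t = 0.
Proof.
move=> hf f0 t tr; apply: nc_le_eps => e e_gt0.
have [d d_gt0 dP] := differentiable_cont (hf t tr) e_gt0.
have [|p|d1 d1_gt0 d1P] := @common_delta _ _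
  (fun p (d : R) => forall x : R, 0 < x <= d -> t 0 p + x%:C != 0).
- move=> p d1 d2 dd H x /andP[x0 xd]; apply: H.
  by rewrite x0 (le_trans xd dd).
- have [t0|t0] := eqVneq (t 0 p) 0.
    exists 1 => // x /andP[x0 _]; rewrite t0 add0r -nc_gt0 nc_real normr_gt0.
    by rewrite gt_eqF.
  exists (nc (t 0 p) / 2); first by rewrite divr_gt0 // nc_gt0.
  move=> x /andP[x0 xd]; apply/eqP => /eqP; rewrite addr_eq0 => /eqP tx.
  move: xd; rewrite tx ncN nc_real gtr0_norm //; lra.
pose x := Num.min (Num.min d d1) ((r - vn t) / 2).
have rt : 0 < r - vn t by rewrite subr_gt0.
have x_gt0 : 0 < x by rewrite !lt_min d_gt0 d1_gt0 divr_gt0.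
have xd : x <= d by rewrite !ge_min lexx.
have xd1 : x <= d1 by rewrite !ge_min lexx orbT.
have xr : x <= (r - vn t) / 2 by rewrite ge_min lexx orbT.
pose h : 'rV[C]_m := const_mx x%:C.
have hx : vn h <= x.
  apply: vn_le => [|p]; first exact: ltW.
  by rewrite mxE nc_real gtr0_norm.
have := dP h (le_trans hx xd); rewrite (f0 (t + h)); first by rewrite sub0r ncN.
  by apply: polydisc_shift; lra.
by move=> p; rewrite !mxE; apply: d1P; rewrite x_gt0.
Qed.

Lemma small_polydisc_bound (I : finType) (r : R) (f : I -> 'rV[C]_m -> C) :
  0 < r -> (forall a, hol r (f a)) ->
  exists2 r', 0 < r' <= r & exists2 M, 0 <= M & forall a, bounded_by r' M (f a).
Proof.
move=> r_gt0 hf.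
have [|a|d d_gt0 dP] := @common_delta _ _
  (fun a (d : R) => forall h, vn h <= d -> nc (f a (0 + h) - f a 0) <= 1).
- by move=> a d d' dd H h hd; apply: H; exact: le_trans hd dd.
- by apply: differentiable_cont => //; apply: hf; rewrite vn0.
exists (Num.min r d); first by rewrite lt_min r_gt0 d_gt0 ge_min lexx.
have S0 : 0 <= \sum_a nc (f a 0) by apply: sumr_ge0 => a _; exact: nc_ge0.
exists (1 + \sum_a nc (f a 0)); first by rewrite addr_ge0.
move=> a t; rewrite lt_min => /andP[_ td].
have := dP a t (ltW td); rewrite add0r => fa.
have := ncD (f a t - f a 0) (f a 0); rewrite subrK.
have : nc (f a 0) <= \sum_a nc (f a 0).
  by rewrite (bigD1 a) //= lerDl; apply: sumr_ge0 => b _; exact: nc_ge0.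
lra.
Qed.

End Neighbourhoods.

(** * Logarithmic forms *)

Section LogarithmicForms.
Context {R : realType} {m n k : nat} (le_km : (k <= m)%N).
Local Notation C := R[i].
Variable A : 'I_k -> 'M[C]_n.
Hypothesis A_diag : forall s : 'I_k, is_diag_mx (A s).
Implicit Types (t : 'rV[C]_m).

(** Zero for a coordinate without pole, so that all coordinates can be treated
    alike, through the logarithmic forms dt_p / t_p. *)
Definition residue (i : 'I_n) (p : 'I_m) : C :=
  \sum_(s < k | p == widen_ord le_km s) A s i i.

Lemma residue_widen i s : residue i (widen_ord le_km s) = A s i i.
Proof. by rewrite /residue (big_pred1 s). Qed.

Lemma residue_free i p : (forall s, p != widen_ord le_km s) -> residue i p = 0.
Proof. by move=> ps; rewrite /residue big1 // => s /eqP E; move: (ps s); rewrite E eqxx. Qed.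

Lemma log_mxformE i j p t :
  log_mxform le_km A i j p t = (i == j)%:R * residue i p * (t 0 p)^-1.
Proof.
rewrite /log_mxform /residue mulr_sumr mulr_suml [RHS]big_mkcond.
apply: eq_bigr => s _; rewrite /dlog; case: eqP => [->|_]; last by rewrite mulr0.
have [->|ne] := eqVneq i j; first by rewrite mul1r.
by have /is_diag_mxP/(_ _ _ ne) -> := A_diag s; rewrite !mul0r.
Qed.

Lemma normal_crossing_free t : (forall p, t 0 p != 0) -> ~ normal_crossing le_km t.
Proof. by move=> t0 /eqP; apply/negP; apply/prodf_neq0 => s _; exact: t0. Qed.

Lemma normal_crossing_widen t s : ~ normal_crossing le_km t -> t 0 (widen_ord le_km s) != 0.
Proof.
by move=> tS; apply/eqP => t0; apply: tS; rewrite /normal_crossing /= (bigD1 s) //= t0 mul0r.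
Qed.

Lemma nonresonant_direction (p0 : 'I_m) : ~ resonant A -> exists s : 'I_n -> 'I_n -> 'I_m,
  forall i j, i != j -> forall z : int, residue i (s i j) - residue j (s i j) <> z%:~R.
Proof.
move=> nonres.
have ex (ij : 'I_n * 'I_n) : exists p, ij.1 != ij.2 ->
    forall z : int, residue ij.1 p - residue ij.2 p <> z%:~R.
  case: ij => i j /=; apply: contrapT => none; apply: nonres; exists i, j.
  have ne : i != j by apply/negP => ij; apply: none; exists p0; rewrite ij.
  split=> // s; apply: contrapT => nz; apply: none.
  exists (widen_ord le_km s) => _ z; rewrite !residue_widen => E.
  by apply: nz; exists z.
have [s sP] := choice ex; exists (fun i j => s (i, j)) => i j ne.
exact: sP (i, j) ne.
Qed.

(** The logarithmic coefficient of dt_q depends on t_q only. *)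
Lemma partial_add_log (Th : mxform1 R m n) i j p q t : p != q ->
  partial p (mxform_add (log_mxform le_km A) Th i j q) t = pder p (Th i j q) t.
Proof.
move=> pq; rewrite pder.unlock /partial /derive; set F := mxform_add _ _ _ _ _.
have -> // : (fun h : C => h^-1 *: ((F \o shift t) (h *: delta_mx 0 p) - F t))
  = (fun h => h^-1 *: ((Th i j q \o shift t) (h *: delta_mx 0 p) - Th i j q t)).
apply/funext => h /=; congr (_ *: _); rewrite /F /mxform_add !log_mxformE.
have -> : (h *: delta_mx 0 p + t : 'rV[C]_m) 0 q = t 0 q.
  by rewrite !mxE eq_sym (negPf pq) andbF mulr0 add0r.
by rewrite opprD addrACA subrr add0r.
Qed.

(** Flatness multiplied by the coordinates: all poles cancel, and the identity
    extends across the polar locus. *)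
Lemma flat_euler (Th : mxform1 R m n) (r M : R) (D : set 'rV[C]_m) :
  (forall t, vn t < r -> D t) ->
  (forall i j p, hol r (Th i j p)) -> (forall i j p, bounded_by r M (Th i j p)) ->
  flat (D `\` normal_crossing le_km) (mxform_add (log_mxform le_km A) Th) ->
  let T i j p t := t 0 p * Th i j p t in
  forall i j p q t, vn t < r ->
    euler p (T i j q) t - euler q (T i j p) t
    = (residue i p - residue j p) * T i j q t - (residue i q - residue j q) * T i j p t
      + \sum_l (T i l p t * T l j q t - T i l q t * T l j p t).
Proof.
move=> rD hTh ThM fl T i j p q.
have hT i' j' p' : hol r (T i' j' p').
  move=> t tr; apply: differentiable_mul; first exact: differentiable_coordinate.
  exact: hTh.
have dTh i' j' p' q' : hol r (pder p' (Th i' j' q')) := pder_hol p' (hTh i' j' q') (ThM i' j' q').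
have [->|pq] := eqVneq p q.
  by move=> t tr; rewrite !subrr big1 ?addr0 // => l _; rewrite subrr.
have TE a b t : a != b -> vn t < r ->
    euler a (T i j b) t = t 0 a * (t 0 b * pder a (Th i j b) t).
  move=> ab tr; rewrite /euler pder_mul.
  - by rewrite pder_coordinate (negPf ab) mul0r add0r.
  - exact: differentiable_coordinate.
  - exact: hTh.
have qp : q != p by rewrite eq_sym.
pose G t := t 0 p * (t 0 q * pder p (Th i j q) t) - t 0 q * (t 0 p * pder q (Th i j p) t)
  - ((residue i p - residue j p) * T i j q t - (residue i q - residue j q) * T i j p t
      + \sum_l (T i l p t * T l j q t - T i l q t * T l j p t)).
suff G0 : forall t, vn t < r -> G t = 0.
  move=> t tr; rewrite !TE //; apply/eqP; rewrite -subr_eq0; apply/eqP; exact: G0.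
apply: hol_eq0_dense.
  move=> t tr; repeat (first [apply: differentiable_sub | apply: differentiable_add |
    apply: differentiable_bigsum => ? | apply: hT => // | apply: dTh => // |
    apply: differentiable_coordinate | apply: differentiable_const |
    apply: differentiable_mul]).
move=> t tr t0.
have tS : ~ normal_crossing le_km t by exact: normal_crossing_free.
have := fl i j p q t (conj (rD t tr) tS); rewrite /extd !partial_add_log //.
move=> /(congr1 (fun z => t 0 p * t 0 q * z)).
rewrite mulrBr mulr_sumr => E.
pose d (a b : 'I_n) : C := (a == b)%:R.
have VE a b c : t 0 c * mxform_add (log_mxform le_km A) Th a b c t
    = d a b * residue a c + T a b c t.
  rewrite /mxform_add log_mxformE mulrDr -/(T a b c t); congr (_ + _).
  by rewrite mulrCA mulfV ?mulr1.
have sumE (x : 'I_n -> C) (y : C) a : \sum_l d a l * y * x l = y * x a.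
  rewrite (bigD1 a) //= /d eqxx mul1r big1 ?addr0 // => l la.
  by rewrite eq_sym (negPf la) !mul0r.
have sumE' (x y : 'I_n -> C) b : \sum_l x l * (d l b * y l) = x b * y b.
  rewrite (bigD1 b) //= /d eqxx mul1r big1 ?addr0 // => l lb.
  by rewrite (negPf lb) mul0r mulr0.
have prodE a b : \sum_l (t 0 a * mxform_add (log_mxform le_km A) Th i l a t)
      * (t 0 b * mxform_add (log_mxform le_km A) Th l j b t)
  = d i j * residue i a * residue j b + residue i a * T i j b t + T i j a t * residue j b
    + \sum_l T i l a t * T l j b t.
  have -> : d i j * residue i a * residue j b = \sum_l d i l * residue i a * (d l j * residue l b).
    rewrite sumE /d; case: eqP => [->|_]; first by rewrite !mul1r.
    by rewrite !mul0r mulr0.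
  rewrite -(sumE (fun l => T l j b t)) -(sumE' (fun l => T i l a t) (fun l => residue l b)).
  rewrite -!big_split; apply: eq_bigr => l _ /=; rewrite !VE.
  by rewrite mulrDl !mulrDr !addrA.
rewrite /G; apply/eqP; rewrite subr_eq0; apply/eqP.
transitivity (t 0 p * t 0 q * pder p (Th i j q) t - t 0 p * t 0 q * pder q (Th i j p) t).
  by move: (pder p _ t) (pder q _ t) => *; ring.
rewrite E.
transitivity (\sum_l (t 0 p * mxform_add (log_mxform le_km A) Th i l p t)
      * (t 0 q * mxform_add (log_mxform le_km A) Th l j q t)
  - \sum_l (t 0 q * mxform_add (log_mxform le_km A) Th i l q t)
      * (t 0 p * mxform_add (log_mxform le_km A) Th l j p t)).
  rewrite -sumrB; apply: eq_bigr => l _; rewrite /wedge; ring.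
rewrite !prodE sumrB.
move: (\sum_l T i l p t * _) (\sum_l T i l q t * _) => S1 S2.
have dd a b : d i j * residue i a * residue j b = d i j * residue i b * residue j a.
  rewrite /d; case: eqP => [->|_]; last by rewrite !mul0r.
  by rewrite !mul1r mulrC.
rewrite (dd q p).
move: (T i j p t) (T i j q t) => x y; ring.
Qed.

End LogarithmicForms.

(** * The normal form theorem *)

Theorem theorem6p1 (R : realType) (m n k : nat)
    (k_gt0 : (1 <= k)%N) (le_km : (k <= m)%N) (n_gt0 : (1 <= n)%N)
    (A : 'I_k -> 'M[R[i]]_n)
    (A_diag : forall s : 'I_k, is_diag_mx (A s))
    (A_nonres : ~ resonant A)
    (U : set 'rV[R[i]]_m) (U_nbhd : open_nbhs (0 : 'rV[R[i]]_m) U)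
    (Theta : mxform1 R m n)
    (Theta_hol : holomorphic_mxform U Theta)
    (Omega_flat : flat (U `\` normal_crossing le_km)
                       (mxform_add (log_mxform le_km A) Theta)) :
  exists V : set 'rV[R[i]]_m,
    [/\ open_nbhs (0 : 'rV[R[i]]_m) V, V `<=` U &
        gauge_equiv V (normal_crossing le_km)
          (mxform_add (log_mxform le_km A) Theta) (log_mxform le_km A)].
Proof.
have /nbhs0_vn[r0 r0_gt0 r0P] := open_nbhs_nbhs U_nbhd.
have hTh (a : 'I_n * 'I_n * 'I_m) : hol r0 (Theta a.1.1 a.1.2 a.2).
  by move=> t tr; apply: Theta_hol; apply: r0P; exact: ltW.
have [r1 /andP[r1_gt0 r1_le] [M M0 ThM]] := small_polydisc_bound r0_gt0 hTh.
have inU t : vn t < r1 -> U t.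
  by move=> tr; apply: r0P; apply: ltW; exact: lt_le_trans r1_le.
have hTh1 i j p : hol r1 (Theta i j p) := hol_le r1_le (hTh (i, j, p)).
have ThM1 i j p : bounded_by r1 M (Theta i j p) := ThM (i, j, p).
have [s sP] := nonresonant_direction le_km (widen_ord le_km (Ordinal k_gt0)) A_nonres.
have fl := flat_euler A_diag inU hTh1 ThM1 Omega_flat.
have [r /andP[r_gt0 r_le] [Y [hY [B YB] Y0 YE]]] :=
  nonresonant_gauge r1_gt0 M0 sP hTh1 ThM1 fl.
pose H t : 'M[R[i]]_n := \matrix_(i, j) Y i j t.
have H0 : \det (H 0) = 1.
  have -> : H 0 = 1%:M by apply/matrixP => i j; rewrite !mxE Y0.
  exact: det1.
have t0 : vn (0 : 'rV[R[i]]_m) < r by rewrite vn0.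
have half : 0 < (2^-1 : R) by rewrite invr_gt0.
have [d d_gt0 dP] :=
  differentiable_cont (differentiable_det (fun i j => hY i j 0 t0)) half.
pose r' := Num.min r d.
have r'_gt0 : 0 < r' by rewrite lt_min r_gt0.
have r'_le : r' <= r by rewrite ge_min lexx.
exists [set t | vn t < r']; split; first exact: polydisc_open_nbhs.
  by move=> t /= tr; apply: inU; apply: lt_le_trans tr _; exact: le_trans r_le.
have HU t : vn t < r' -> H t \in unitmx.
  move=> tr; rewrite unitmxE unitfE; apply/eqP => Ht.
  have := dP t; rewrite add0r -/(H t) -/(H 0) Ht H0 sub0r ncN nc1.
  by move=> /(_ (ltW (lt_le_trans tr _))); rewrite ge_min lexx orbT => /(_ isT); lra.
have dH t : vn t < r' -> differentiable H t.
  by move=> tr; apply: differentiable_matrix => i j; apply: hY; exact: lt_le_trans r'_le.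
(* Where t_p carries a pole this is the Euler equation divided by t_p; for the
   other coordinates t_p may vanish, and density gives the equation there. *)
have entry p i j t : vn t < r -> ~ normal_crossing le_km t ->
    (residue le_km A i p - residue le_km A j p) * (t 0 p)^-1 * Y i j t
    = pder p (Y i j) t + \sum_l Y i l t * Theta l j p t.
  move=> tr tS.
  have E x : vn x < r -> x 0 p * (pder p (Y i j) x + \sum_l Y i l x * Theta l j p x)
      = (residue le_km A i p - residue le_km A j p) * Y i j x.
    move=> xr; rewrite mulrDr -/(euler p (Y i j) x) YE // mulr_sumr -addrA.
    rewrite [X in _ + X]addrC [X in _ + X](_ : _ = 0) ?addr0 //.
    by rewrite -sumrB big1 // => l _; rewrite mulrCA subrr.
  have [/existsP[s0 /eqP ps]|free] := boolP [exists s0, p == widen_ord le_km s0].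
    have tp : t 0 p != 0 by rewrite ps; exact: normal_crossing_widen.
    by rewrite mulrAC -E // mulrC mulKf.
  have pfree s0 : p != widen_ord le_km s0 by move: free; rewrite negb_exists => /forallP.
  rewrite !residue_free // subrr !mul0r; apply/esym.
  apply: (hol_eq0_dense (r := r)
    (f := fun x => pder p (Y i j) x + \sum_l Y i l x * Theta l j p x)) tr.
    move=> x xr; apply: differentiable_add; first exact: pder_hol (hY i j) (YB i j) x xr.
    apply: differentiable_bigsum => l; apply: differentiable_mul; first exact: hY.
    by apply: hTh1; exact: lt_le_trans r_le.
  move=> x xr x0; apply: (mulfI (x0 p)).
  by rewrite mulr0 E // !residue_free // subrr mul0r.
apply: (ex_intro _ H); split=> //.
move=> p t [/= tr tS].
have tr0 : vn t < r by exact: lt_le_trans r'_le.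
apply: (can_inj (mulmxK (HU t tr))).
rewrite mulmxDl !mulmxKV ?HU //.
apply/matrixP => i j; rewrite mxE [in RHS]mxE (partial_entry p i j (dH t tr)).
have -> : (fun x => H x i j) = Y i j by apply/funext => x; rewrite mxE.
rewrite [X in _ = _ + X]mxE.
have delta (f : 'I_n -> R[i]) (c : R[i]) a : \sum_l (a == l)%:R * c * f l = c * f a.
  rewrite (bigD1 a) //= eqxx mul1r big1 ?addr0 // => l la.
  by rewrite eq_sym (negPf la) !mul0r.
transitivity (residue le_km A i p * (t 0 p)^-1 * Y i j t).
  rewrite -[RHS](delta (fun l => Y l j t)); apply: eq_bigr => l _.
  by rewrite !mxE log_mxformE // -mulrA.
transitivity (pder p (Y i j) t + (\sum_l Y i l t * Theta l j p t
    + residue le_km A j p * (t 0 p)^-1 * Y i j t)).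
  by rewrite addrA -(entry p i j t tr0 tS); ring.
congr (_ + _); rewrite addrC.
rewrite -[X in X + _](delta (fun l => Y i l t) _ j) -big_split.
apply: eq_bigr => l _ /=; rewrite !mxE /mxform_add log_mxformE //.
rewrite eq_sym; have [->|_] := eqVneq j l; last by rewrite !mul0r !add0r.
by rewrite !mul1r mulrDr; congr (_ + _); rewrite mulrC.
Qed.
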